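(* Let $p$ be an odd prime and let $D_p=\langle r,s: r^p=s^2=(rs)^2=1\rangle$ be the dihedral group of order $2p$. Let $X$ be a smooth projective complex curve of genus $\ge2$ with an action of $D_p$ (so $D_p\subset\mathrm{Aut}(X)$), and let $Y=X/D_p$. Let $U'$ be the nontrivial one-dimensional $\mathbb{Q}$-representation of $D_p$ and let $W$ be the irreducible $\mathbb{Q}$-representation with $W\otimes_{\mathbb{Q}}\mathbb{C}=V_1\oplus\cdots\oplus V_{\frac{p-1}{2}}$, the sum of all two-dimensional irreducible complex representations of $D_p$. Then $$JX\sim JY\times B_{U'}\times B_W^2$$ with $$B_{U'}\sim P(X_{\langle r\rangle}/Y)\quad\text{and}\quad B_W\sim P(X_{\langle s\rangle}/Y),$$ where $X_M=X/M$ for a subgroup $M$.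
   Context: $\sim$ means ''isogenous to''. For a finite morphism $f:X'\to Y'$ of smooth projective curves, $P(X'/Y'):=\ker(\mathrm{Nm} f:JX'\to JY')^{\circ}$ (connected component of $0$ of the kernel of the norm map). For a finite group $G\subset\mathrm{Aut}(X)$ let $\rho:\mathbb{Q}[G]\to\mathrm{End}_{\mathbb{Q}}(JX)$ be the induced homomorphism. For an irreducible $\mathbb{Q}$-representation $R$ of $G$ with $D=\mathrm{End}_G(R)$, let $Q_R\simeq\mathrm{End}_D(R)$ be the corresponding simple factor of $\mathbb{Q}[G]$ and let $e$ be a primitive idempotent of $Q_R$. Then $B_R:=\mathrm{Im}(\rho(me))\subset JX$ for any positive integer $m$ with $me\in\mathbb{Z}[G]$; its isogeny class does not depend on $e$. *)

(* Defs.v *)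
(* Varieties are treated classically: a variety is its set of closed points,
   given with homogeneous coordinates in some projective space.  Topological
   words (closed, open, connected, ...) refer to the Zariski topology. *)
From HB Require Import structures.
From mathcomp Require Import all_boot all_order all_algebra all_fingroup.
From mathcomp Require Import all_character.
From mathcomp Require Import boolp classical_sets cardinality reals.
From mathcomp Require Import complex mpoly.

Set Implicit Arguments.
Unset Strict Implicit.
Unset Printing Implicit Defensive.

Import Order.TTheory GRing.Theory Num.Theory.
Local Open Scope ring_scope.
Local Open Scope classical_set_scope.

Section Varieties.
Variable k : fieldType.

(* [hcoord x] is a choice of homogeneous coordinates of the point [x]; nothing
   below depends on the chosen scaling.  This is raw data: it is a projective
   algebraic set only under [projective]. *)
Record variety := Variety {
  point :> Type;
  hdim : nat;
  hcoord : point -> 'rV[k]_hdim }.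

Definition heval (X : variety) (P : {mpoly k[hdim X]}) (x : X) : k :=
  P.@[fun i => hcoord x ord0 i].

Definition all_homog n (S : set {mpoly k[n]}) : Prop :=
  forall P, S P -> exists d : nat, P \is d.-homog.

Definition projective (X : variety) : Prop :=
  [/\ forall x : X, hcoord x != 0,
      forall (x y : X) (c : k), hcoord x = c *: hcoord y -> x = y &
      exists2 S : set {mpoly k[hdim X]}, all_homog S &
        forall v : 'rV[k]_(hdim X), v != 0 ->
          (forall P, S P -> P.@[fun i => v ord0 i] = 0) <->
          exists (x : X) (c : k), v = c *: hcoord x].

Section Topology.
Variable X : variety.

Definition zclosed (Z : set X) : Prop :=
  exists2 S : set {mpoly k[hdim X]}, all_homog S &
    Z = [set x | forall P, S P -> heval P x = 0].

Definition zopen (U : set X) : Prop := zclosed (~` U).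

Definition zirreducible (Z : set X) : Prop :=
  Z !=set0 /\
  forall Z1 Z2, zclosed Z1 -> zclosed Z2 -> Z `<=` Z1 `|` Z2 ->
    Z `<=` Z1 \/ Z `<=` Z2.

Definition zconnected (Z : set X) : Prop :=
  forall Z1 Z2, zclosed Z1 -> zclosed Z2 ->
    Z `<=` Z1 `|` Z2 -> Z `&` Z1 `&` Z2 = set0 -> Z `<=` Z1 \/ Z `<=` Z2.

Definition zcomponent (K : set X) (x : X) : set X :=
  [set y | exists Z : set X, [/\ Z `<=` K, zconnected Z, Z x & Z y]].

Definition irreducible_chain (d : nat) : Prop :=
  exists Z : nat -> set X,
    (forall i, (i <= d)%N -> zclosed (Z i) /\ zirreducible (Z i)) /\
    (forall i, (i < d)%N -> Z i `<=` Z i.+1 /\ Z i <> Z i.+1).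

Definition krull_dim (d : nat) : Prop :=
  irreducible_chain d /\ ~ irreducible_chain d.+1.

(* Functions are total on [X]; only their germ at [x] matters here. *)
Definition regular_at (f : X -> k) (x : X) : Prop :=
  exists (d : nat) (P Q : {mpoly k[hdim X]}),
    [/\ P \is d.-homog, Q \is d.-homog, heval Q x != 0 &
        forall y, heval Q y != 0 -> f y = heval P y / heval Q y].

Definition regular_on (U : set X) (f : X -> k) : Prop :=
  forall x, U x -> regular_at f x.

(* Tangent vectors at [x]: the derivations of the local ring at [x] with values
   in the residue field, as maps on representatives of germs; their values on
   functions that are not regular at [x] are irrelevant. *)
Definition tangent_vector (x : X) (v : (X -> k) -> k) : Prop :=
  [/\ forall U f g, zopen U -> U x -> (forall y, U y -> f y = g y) ->
        regular_at f x -> regular_at g x -> v f = v g,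
      forall a f g, regular_at f x -> regular_at g x ->
        v (fun y => a * f y + g y) = a * v f + v g &
      forall f g, regular_at f x -> regular_at g x ->
        v (fun y => f y * g y) = f x * v g + g x * v f].

(* The tangent space at [x] is one-dimensional: it is the line spanned by [v]. *)
Definition tangent_line (x : X) : Prop :=
  exists v, [/\ tangent_vector x v,
    exists2 f, regular_at f x & v f != 0 &
    forall w, tangent_vector x w ->
      exists c : k, forall f, regular_at f x -> w f = c * v f].

(* A family of cotangent vectors is a regular differential if it is locally of
   the form  \sum_i f_i dg_i  with f_i, g_i regular. *)
Definition regular_differential (w : X -> ((X -> k) -> k) -> k) : Prop :=
  forall x, exists (U : set X) (n : nat) (f g : 'I_n -> X -> k),
    [/\ zopen U, U x,
        forall i, regular_on U (f i) /\ regular_on U (g i) &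
        forall y v, U y -> tangent_vector y v ->
          w y v = \sum_(i < n) f i y * v (g i)].

(* dim H^0(X, Omega) >= g *)
Definition genus_ge (g : nat) : Prop :=
  exists2 w : 'I_g -> X -> ((X -> k) -> k) -> k,
    forall i, regular_differential (w i) &
    forall a : 'I_g -> k,
      (forall y v, tangent_vector y v -> \sum_(i < g) a i * w i y v = 0) ->
      forall i, a i = 0.

Definition smooth_projective_curve : Prop :=
  [/\ projective X, zirreducible [set: X], krull_dim 1 &
      forall x, tangent_line x].

End Topology.

Definition vmorphism (X Y : variety) (f : X -> Y) : Prop :=
  (forall Z : set Y, zclosed Z -> zclosed (f @^-1` Z)) /\
  (forall (U : set Y) (h : Y -> k), zopen U -> regular_on U h ->
     regular_on (f @^-1` U) (h \o f)).

(* Segre embedding *)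
Definition vprod (X Y : variety) : variety :=
  @Variety (X * Y)%type (hdim X * hdim Y)
    (fun z => mxvec ((hcoord z.1)^T *m hcoord z.2)).

Definition subvariety (X : variety) (S : set X) : variety :=
  @Variety {x : X | S x} (hdim X) (fun x => hcoord (sval x)).

(* Commutativity of the group law is automatic for abelian varieties. *)
Record gvariety := GVariety {
  gpoint :> zmodType;
  ghdim : nat;
  ghcoord : gpoint -> 'rV[k]_ghdim }.

Definition gvar (A : gvariety) : variety := @Variety A (ghdim A) (@ghcoord A).

Definition gvprod (A B : gvariety) : gvariety :=
  @GVariety (A * B)%type (ghdim A * ghdim B)
    (@hcoord (vprod (gvar A) (gvar B))).

Definition abelian_variety (A : gvariety) : Prop :=
  [/\ projective (gvar A), zirreducible [set: gvar A],
      @vmorphism (vprod (gvar A) (gvar A)) (gvar A) (fun z => z.1 + z.2 : A) &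
      @vmorphism (gvar A) (gvar A) (fun x => - x : A)].

Definition av_hom (A B : gvariety) (h : A -> B) : Prop :=
  (forall x y, h (x + y) = h x + h y) /\ @vmorphism (gvar A) (gvar B) h.

(* A subgroup of an abelian variety, with the induced algebraic structure. *)
Record abelian_subvar := AbSub {
  ambient : gvariety;
  support : set ambient }.

Arguments support : clear implicits.

Definition whole (A : gvariety) : abelian_subvar := @AbSub A setT.

Definition abprod (A B : abelian_subvar) : abelian_subvar :=
  @AbSub (gvprod (ambient A) (ambient B)) (support A `*` support B).

Definition abvar (A : abelian_subvar) : variety :=
  @subvariety (gvar (ambient A)) (support A).

Definition isogeny (A B : abelian_subvar) (h : abvar A -> abvar B) : Prop :=
  [/\ vmorphism h,
      forall x y z : abvar A, sval z = sval x + sval y :> ambient A ->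
        sval (h z) = sval (h x) + sval (h y) :> ambient B,
      forall b, exists a, h a = b &
      finite_set [set x | sval (h x) = 0 :> ambient B]].

Definition isogenous (A B : abelian_subvar) : Prop :=
  exists h : abvar A -> abvar B, isogeny h.

(* The Jacobian, with an Abel-Jacobi map [aj] (for some, unspecified, base
   point), as the universal abelian variety receiving a morphism from the
   curve: morphisms from X to abelian varieties factor, up to translation,
   through [aj]. *)
Definition jacobian (X : variety) (J : gvariety) (aj : X -> J) : Prop :=
  [/\ abelian_variety J, @vmorphism X (gvar J) aj &
      forall (B : gvariety) (b : X -> B), abelian_variety B ->
        @vmorphism X (gvar B) b ->
        exists h : J -> B,
          [/\ av_hom h, exists t : B, forall x, b x = h (aj x) + t &
              forall h' : J -> B, av_hom h' ->
                (exists t : B, forall x, b x = h' (aj x) + t) -> h' = h]].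

(* [N] is Nm f : JX -> JY, the homomorphism sending the class of the divisor
   x - x' to that of f x - f x'.  It is unique by the universal property of JX.
   For an automorphism f, it is the induced automorphism of JX. *)
Definition norm_map (X Y : variety) (JX JY : gvariety)
    (ajX : X -> JX) (ajY : Y -> JY) (f : X -> Y) (N : JX -> JY) : Prop :=
  av_hom N /\ forall x x', N (ajX x - ajX x') = ajY (f x) - ajY (f x').

(* P(X/Y), in terms of the norm map N : JX -> JY *)
Definition prym (JX JY : gvariety) (N : JX -> JY) : abelian_subvar :=
  @AbSub JX (@zcomponent (gvar JX) [set x | N x = 0] 0).

Section GroupAction.
Variable gT : finGroupType.

Definition curve_action (X : variety) (act : gT -> X -> X) : Prop :=
  [/\ forall g, vmorphism (act g),
      forall x, act 1%g x = x,
      forall g h x, act (g * h)%g x = act g (act h x) &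
      forall g, (forall x, act g x = x) -> g = 1%g].

(* [q : X -> Y] exhibits Y as the (geometric) quotient X / M. *)
Definition quotient_by (X Y : variety) (act : gT -> X -> X) (M : {set gT})
    (q : X -> Y) : Prop :=
  [/\ forall y, exists x, q x = y,
      forall x x', q x = q x' <-> exists2 g, g \in M & x' = act g x,
      forall Z : set Y, zclosed (q @^-1` Z) <-> zclosed Z &
      forall (U : set Y) (f : Y -> k), zopen U ->
        regular_on U f <-> regular_on (q @^-1` U) (f \o q)].

(* The element \sum_g (c g) g of Z[G], acting on J through rho *)
Definition gring_act (J : gvariety) (rho : gT -> J -> J) (c : gT -> int)
    (x : J) : J := \sum_(g : gT) rho g x *~ c g.

Definition image_of (J : gvariety) (u : J -> J) : abelian_subvar :=
  @AbSub J (range u).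

End GroupAction.
End Varieties.

Coercion gvar : gvariety >-> variety.

(* The group algebra F[G] is [group_ring F G], i.e. the span of the matrices of
   the regular representation; [irr_comp sG rG] indexes the simple factor on
   which [rG] is supported, and [Wedderburn_subring] is that factor. *)
Definition primitive_idempotent_of (F : fieldType) (gT : finGroupType)
    (G : {group gT}) (sG : irrType F G) (n : nat)
    (rG : mx_representation F G n) (e : 'M[F]_#|G|) : Prop :=
  let Q := Wedderburn_subring (irr_comp sG rG) in
  [/\ (e \in Q)%MS, e != 0, e *m e = e &
      forall e1 e2 : 'M[F]_#|G|, (e1 \in Q)%MS -> (e2 \in Q)%MS ->
        e1 *m e1 = e1 -> e2 *m e2 = e2 -> e1 *m e2 = 0 -> e2 *m e1 = 0 ->
        e = e1 + e2 -> e1 = 0 \/ e2 = 0].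

(* m e is the element \sum_g (c g) g of Z[G], with m > 0. *)
Definition integral_multiple (gT : finGroupType) (G : {group gT})
    (e : 'M[rat]_#|G|) (m : nat) (c : gT -> int) : Prop :=
  (0 < m)%N /\
  m%:R *: e = \sum_(g in G) (c g)%:~R *: regular_repr rat G g.

(* Extension of scalars of a rational representation *)
Definition extend_scalars (F : numFieldType) (gT : finGroupType)
    (G : {group gT}) (n : nat) (rG : mx_representation rat G n) :
  mx_representation F G n := map_repr (ratr : {rmorphism rat -> F}) rG.

(* The direct sum of the irreducible representations of degree d, one for each
   isomorphism class *)
Definition sum_irr_of_degree (F : fieldType) (gT : finGroupType)
    (G : {group gT}) (sG : irrType F G) (d : nat) : representation F G :=
  \big[dadd_grepr/grepr0]_(i : sG | irr_degree i == d)
    Representation (irr_repr i).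

(* Main.v *)
Require Import Defs.
From mathcomp Require Import all_boot all_order all_algebra all_fingroup.
From mathcomp Require Import all_solvable all_field all_character.
From mathcomp Require Import boolp classical_sets cardinality reals.
From mathcomp Require Import complex mpoly ring.

(* Write N for the sum of the rotations.  In Q[D_p], the elements e_s =
   (1 - N/p)(1 + s)/2 and e_s' = (1 - N/p)(1 - s)/2 are orthogonal idempotents
   with sum 1 - N/p, and r - r^-1, which is invertible modulo N and anticommutes
   with s, conjugates one into the other.  Any primitive idempotent e of Q_W is
   equivalent to e_s: e = t' t and e_s = t t'.  Acting on JX, these identities
   give homomorphisms both ways between JX and JY x B_U' x B_W^2 whose
   composites are multiplications by nonzero integers on each factor; the
   pullbacks JY -> JX exist because a sum over an orbit is a morphism on the
   quotient curve.  Similarly the norms JX -> J(X/<r>) and JX -> J(X/<s>) map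
   B_U' and (via t) B_W onto the identity components of the kernels.

   This uses three facts on an abelian variety A.  Its n-torsion is finite:
   multiplication by n acts as n on the cotangent space, so that 0 is isolated in
   A[n].  The image of a homomorphism is closed: it contains a nonempty open
   subset of its closure, since generic specializations extend.  And A is
   divisible: the closed subgroups n^j A stabilize, and the stable one has finite
   index in A. *)

Set Implicit Arguments.
Unset Strict Implicit.
Unset Printing Implicit Defensive.

Import Order.TTheory GRing.Theory Num.Theory.
Local Open Scope ring_scope.


(** * Noetherian rings *)

Section Noetherian.
Local Open Scope classical_set_scope.

(** Isogenies are certified without dimensions: a kernel is trapped in the torsion of some explicit
    integer, and preimages are written down after dividing by an integer. As JX has torsion,
    rational identities cannot act on it; each is cleared of denominators and compared coefficient
    by coefficient in Z[G], which is the origin of the many integer constants. The oddness of p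
    makes r - r^-1 invertible modulo N: r^2 generates the rotations, and the sum of i r^(2i+1) over
    i is an inverse up to the factor p. The equivalence of e and e_s rests on the irreducibility of
    the p-th cyclotomic polynomial, which makes W faithful on the ideal of Q[G] killed by N, so that
    equations there can be checked on matrices. A Prym variety is defined as a connected component,
    hence it is compared with the image of a homomorphism by covering the kernel with finitely many
    closed cosets of that image. Polynomial rings are built one variable at a time because
    specializations are extended one coordinate at a time. *)

Definition ideal_pred (B : comNzRingType) (I : set B) :=
  [/\ I 0, forall x y, I x -> I y -> I (x + y) & forall a x, I x -> I (a * x)].

Definition ideal_gen (B : comNzRingType) (S : set B) : set B :=
  [set x | exists2 s : seq (B * B), (forall u, u \in s -> S u.2) &
             x = \sum_(u <- s) u.1 * u.2].

Definition noetherian (B : comNzRingType) := forall I : set B, ideal_pred I ->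
  exists2 s : seq B, (forall x, x \in s -> I x) &
    forall x, I x -> ideal_gen [set` s] x.

Lemma ideal_genP (B : comNzRingType) (S : set B) : ideal_pred (ideal_gen S).
Proof.
split.
- by exists [::]; rewrite ?big_nil.
- move=> _ _ [s Ss ->] [t St ->]; exists (s ++ t); last by rewrite big_cat.
  by move=> u; rewrite mem_cat => /orP[/Ss|/St].
- move=> a _ [s Ss ->]; exists [seq (a * u.1, u.2) | u <- s].
    by move=> _ /mapP[u /Ss Su ->].
  by rewrite big_map mulr_sumr; apply: eq_bigr => u _; rewrite mulrA.
Qed.

Lemma ideal_gen_in (B : comNzRingType) (S : set B) x : S x -> ideal_gen S x.
Proof.
move=> Sx; exists [:: (1, x)]; last by rewrite big_seq1 mul1r.
by move=> u /[1!inE]/eqP->.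
Qed.

Lemma ideal_gen_min (B : comNzRingType) (S I : set B) :
  ideal_pred I -> S `<=` I -> ideal_gen S `<=` I.
Proof.
move=> [I0 ID IM] SI _ [s Ss ->]; elim: s Ss => [|u s IH] Ss; first by rewrite big_nil.
rewrite big_cons; apply: ID; first by apply/IM/SI/Ss; rewrite mem_head.
by apply: IH => v vs; apply: Ss; rewrite inE vs orbT.
Qed.

(** Each generator of the ideal is a combination of finitely many members of [S], so the generators
    can be taken in [S]. In [finite_zeros] they must be images of given polynomials. *)
Lemma noetherian_set (B : comNzRingType) (S : set B) : noetherian B ->
  exists2 s : seq B, (forall x, x \in s -> S x) &
    forall x, S x -> ideal_gen [set` s] x.
Proof.
move=> /(_ _ (ideal_genP S))[s sS Sg].
suff [t tS st] : exists2 t : seq B, (forall x, x \in t -> S x) &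
    forall x, x \in s -> ideal_gen [set` t] x.
  exists t => // x Sx; have := Sg x (ideal_gen_in Sx).
  by apply: ideal_gen_min; [exact: ideal_genP | exact: st].
elim: s sS {Sg} => [|a s IH] sS; first by exists [::].
have [t tS st] : exists2 t : seq B, (forall x, x \in t -> S x) &
    forall x, x \in s -> ideal_gen [set` t] x.
  by apply: IH => x xs; apply: sS; rewrite inE xs orbT.
have [w wS aE] := sS a (mem_head a s).
exists ([seq u.2 | u <- w] ++ t).
  by move=> x; rewrite mem_cat => /orP[/mapP[u /wS ? ->]|/tS].
move=> x /[1!inE]/predU1P[->|/st].
  exists w => // u uw; rewrite /= mem_cat; apply/orP; left; exact: map_f.
apply: ideal_gen_min; first exact: ideal_genP.
by move=> y /= yt; apply: ideal_gen_in; rewrite /= mem_cat yt orbT.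
Qed.

Lemma noetherian_field (F : fieldType) : noetherian F.
Proof.
move=> I [I0 ID IM]; have [[x Ix x0]|H] := pselect (exists2 x, I x & x != 0).
  exists [:: x]; first by move=> y /[1!inE]/eqP->.
  move=> y Iy; have [_ _ M] := ideal_genP [set` [:: x]].
  by rewrite -(divfK x0 y); apply: M; apply: ideal_gen_in; rewrite /= mem_head.
exists [::] => // y Iy; suff -> : y = 0 by have [] := ideal_genP [set` ([::] : seq F)].
by apply/eqP/negPn/negP => y0; apply: H; exists y.
Qed.

(** Hilbert's basis theorem. [L d] collects the coefficients of ['X^d] in the members of [I] of size
    at most [d.+1]; these ideals grow with [d] and stop growing at some [D], so lifts of generators
    of [L 0], ..., [L D] generate [I]. *)
Lemma noetherian_poly (B : comNzRingType) : noetherian B -> noetherian {poly B}.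
Proof.
move=> NB I [I0 ID IM].
have Isum (r : seq {poly B}) (F : {poly B} -> {poly B}) :
    (forall u, u \in r -> I (F u)) -> I (\sum_(u <- r) F u).
  move=> Ir; rewrite big_seq; elim/big_ind: _ => //.
pose L d : set B := [set a | exists2 f : {poly B}, I f & (size f <= d.+1)%N /\ f`_d = a].
have LS d e a : (d <= e)%N -> L d a -> L e a.
  move=> de [f If [sf fa]]; exists ('X^(e - d) * f); first exact: IM.
  split; last by rewrite coefXnM ltnNge leq_subr /= subKn.
  apply: leq_trans (size_polyMleq _ _) _; rewrite size_polyXn /=.
  by apply: leq_trans (leq_add (leqnn _) sf) _; rewrite addnS subnK.
have LI d : ideal_pred (L d).
  split; first by exists 0; rewrite ?size_poly0 ?coef0.
    move=> a b [f If [sf fa]] [g Ig [sg ga]]; exists (f + g); first exact: ID.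
    split; last by rewrite coefD fa ga.
    by apply: leq_trans (size_polyD _ _) _; rewrite geq_max sf.
  move=> c a [f If [sf fa]]; exists (c%:P * f); first exact: IM.
  split; last by rewrite coefCM fa.
  by rewrite mul_polyC; apply: leq_trans (size_scale_leq _ _) _.
have LuI : ideal_pred [set a | exists d, L d a].
  split; first by exists 0%N; have [] := LI 0%N.
    move=> a b [d La] [e Lb]; exists (maxn d e).
    have [_ LD _] := LI (maxn d e); apply: LD.
      by apply: LS La; rewrite leq_maxl.
    by apply: LS Lb; rewrite leq_maxr.
  by move=> c a [d La]; exists d; have [_ _ LM] := LI d; apply: LM.
have [s sL sgen] := NB _ LuI.
have [D sD] : exists D, forall a, a \in s -> L D a.
  elim: s sL {sgen} => [|a s IH] sL; first by exists 0%N.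
  have [D HD] : exists D, forall a, a \in s -> L D a.
    by apply: IH => x xs; apply: sL; rewrite inE xs orbT.
  have [d Ld] := sL a (mem_head a s); exists (maxn d D) => x.
  rewrite inE => /predU1P[->|/HD].
    by apply: LS Ld; rewrite leq_maxl.
  by apply: LS; rewrite leq_maxr.
have LmD e a : L e a -> L (minn e D) a.
  move=> La; case: (leqP e D) => [//|De].
  have : ideal_gen [set` s] a by apply: sgen; exists e.
  by apply: ideal_gen_min; [exact: LI | exact: sD].
have lift e : exists F : seq {poly B}, (forall g, g \in F -> I g) /\
    forall a, L e a -> exists2 h, ideal_gen [set` F] h &
       (size h <= e.+1)%N /\ h`_e = a.
  have [t tL tgen] := NB _ (LI e).
  have /choice[l lP] : forall a, exists f : {poly B},
      a \in t -> [/\ I f, (size f <= e.+1)%N & f`_e = a].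
    move=> a; case: (boolP (a \in t)) => [/tL[f If [sf fa]]|_]; last by exists 0.
    by exists f.
  exists [seq l a | a <- t]; split=> [_ /mapP[a /lP[Ia _ _] ->] //|a /tgen[w wt ->]].
  exists (\sum_(u <- w) u.1%:P * l u.2).
    exists [seq (u.1%:P, l u.2) | u <- w]; last by rewrite big_map.
    by move=> _ /mapP[u /wt ut ->] /=; apply: map_f.
  split.
    rewrite big_seq; elim/big_ind: _ => [|f g sf sg|u /wt/lP[_ su _]].
    - by rewrite size_poly0.
    - by apply: leq_trans (size_polyD _ _) _; rewrite geq_max sf.
    - by rewrite mul_polyC; apply: leq_trans (size_scale_leq _ _) _.
  rewrite coef_sum big_seq [RHS]big_seq; apply: eq_bigr => u /wt/lP[_ _ ue].
  by rewrite coefCM ue.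
have /choice[F FP] := lift.
pose G := flatten [seq F e | e <- iota 0 D.+1].
have FG e : (e <= D)%N -> ideal_gen [set` F e] `<=` ideal_gen [set` G].
  move=> eD; apply: ideal_gen_min; first exact: ideal_genP.
  move=> g gF; apply: ideal_gen_in; apply/flatten_mapP; exists e => //.
  by rewrite mem_iota.
have GI : ideal_gen [set` G] `<=` I.
  apply: ideal_gen_min => // g /flatten_mapP[e _]; exact: (FP e).1.
exists G; first by move=> g gG; apply: GI; apply: ideal_gen_in.
have [_ GD GM] := ideal_genP [set` G].
suff H : forall n (f : {poly B}), (size f <= n)%N -> I f -> ideal_gen [set` G] f.
  by move=> f If; apply: H If.
elim=> [|d IH] f sf If.
  move: sf; rewrite leqn0 size_poly_eq0 => /eqP->.
  by have [] := ideal_genP [set` G].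
have [h hF [sh hE]] := (FP (minn d D)).2 _ (LmD _ _ (ex_intro2 _ _ f If (conj sf erefl))).
have hG : ideal_gen [set` G] h by apply: FG hF; apply: geq_minr.
(* The shifted lift has the same coefficient of degree [d] as [f], so the difference is smaller. *)
pose g := 'X^(d - minn d D) * h.
rewrite -[f](subrK g); apply: GD; last exact: GM.
apply: IH; last by rewrite -mulN1r; apply: ID => //; exact: (IM _ _ (IM _ _ (GI _ hG))).
apply/leq_sizeP => j dj; rewrite coefB /g coefXnM.
have := dj; rewrite leq_eqVlt => /predU1P[<-|dj'].
  by rewrite ltnNge leq_subr /= subKn ?geq_minl // hE subrr.
rewrite (nth_default 0 (leq_trans sf dj')) sub0r; case: ifP => _; first by rewrite oppr0.
rewrite nth_default ?oppr0 //; apply: leq_trans sh _.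
rewrite ltn_subRL; apply: leq_ltn_trans _ dj'; by rewrite subnK ?geq_minl.
Qed.

(** Polynomials in [n] variables, adjoined one at a time: the basis theorem and the extension of
    specializations both proceed by a single variable. *)
Fixpoint tower (B : idomainType) n : idomainType :=
  if n is m.+1 then {poly tower B m} : idomainType else B.

Lemma noetherian_tower (B : idomainType) n : noetherian B -> noetherian (tower B n).
Proof. by move=> NB; elim: n => //= n IH; apply: noetherian_poly. Qed.

End Noetherian.

(** * Extension of specializations *)

Section Extension.
Local Open Scope classical_set_scope.
Variable k : closedFieldType.

Definition prime_pred (B : comNzRingType) (I : set B) :=
  [/\ ideal_pred I, ~ I 1 & forall x y, I (x * y) -> I x \/ I y].

Lemma prime_predX (B : comNzRingType) (I : set B) x n :
  prime_pred I -> I (x ^+ n) -> I x.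
Proof.
move=> [_ I1 Ip]; elim: n => [/I1 //|n IH].
by rewrite exprS => /Ip[|/IH].
Qed.

Lemma min_size (B : idomainType) (P : set {poly B}) f : P f ->
  exists2 g, P g & forall h, P h -> (size g <= size h)%N.
Proof.
move=> Pf; have ex : exists n, `[< exists2 g, P g & size g = n >].
  by exists (size f); apply/asboolP; exists f.
case: (ex_minnP ex) => n /asboolP[g Pg gn] H; exists g => // h Ph.
by rewrite gn; apply: H; apply/asboolP; exists h.
Qed.

(* Either the last coordinate is transcendental over the others, and generic
   values of it are allowed, or it is algebraic, and one takes a root of the
   specialized minimal equation F; c is then an algebraic multiple of Q. *)
Lemma extend_specialization1 (B : idomainType) (Pr : set {poly B}) (Q : {poly B}) :
  prime_pred Pr -> ~ Pr Q ->
  exists2 b : B, ~ Pr b%:P & forall phi : {rmorphism B -> k},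
    (forall c, Pr c%:P -> phi c = 0) -> phi b != 0 ->
    exists2 xi : k, forall P, Pr P -> (map_poly phi P).[xi] = 0 &
                    (map_poly phi Q).[xi] != 0.
Proof.
move=> Prp; have [[Pr0 PrD PrM] Pr1 Prpr] := Prp => nQ.
have PrMl x a : Pr x -> Pr (x * a) by rewrite mulrC; apply: PrM.
have PrN x : Pr x -> Pr (- x) by rewrite -mulN1r; apply: PrM.
have PrB x y : Pr x -> Pr y -> Pr (x - y) by move=> ? ?; apply/PrD/PrN.
have PrZ a x : Pr x -> Pr (a *: x) by rewrite -mul_polyC; apply: PrM.
have PrZV a n x : ~ Pr a%:P -> Pr (a ^+ n *: x) -> Pr x.
  move=> na; rewrite -mul_polyC rmorphXn /= => /Prpr[|//].
  by move/(prime_predX Prp).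
have PrK x y : Pr (x - y) -> Pr y -> Pr x.
  by move=> xy Py; rewrite -(subrK y x); apply: PrD.
have PrK' x y : Pr (x - y) -> Pr x -> Pr y.
  by move=> xy Px; have := PrB _ _ Px xy; rewrite opprB addrC subrK.
pose p0 c := Pr c%:P.
(* [sm P] says that [P] vanishes over the residue domain of the prime [p0] of [B]. *)
pose sm (P : {poly B}) := forall i, p0 P`_i.
have smPr P : sm P -> Pr P.
  move=> sP; rewrite -[P]coefK poly_def; elim/big_ind: _ => // i _.
  by rewrite -mul_polyC; apply/PrMl/sP.
have p0D a b : p0 a -> p0 b -> p0 (a + b).
  by rewrite /p0 polyCD; apply: PrD.
have p0N a : p0 a -> p0 (- a) by rewrite /p0 polyCN; apply: PrN.
have p0M a b : p0 a -> p0 (b * a) by rewrite /p0 polyCM; apply: PrM.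
have smD P P' : sm P -> sm P' -> sm (P + P').
  by move=> s s' i; rewrite coefD; apply: p0D.
have smM P P' : sm P -> sm (P * P').
  move=> s i; rewrite coefM; elim/big_ind: _ => [||j _]; [exact: Pr0 | exact: p0D |].
  by rewrite mulrC; apply: p0M.
have trunc (P : {poly B}) : P != 0 -> p0 (lead_coef P) ->
    exists2 P' : {poly B}, (size P' < size P)%N & sm (P - P').
  move=> P0 lP; exists (P - lead_coef P *: 'X^((size P).-1)).
    have sP : (0 < size P)%N by rewrite size_poly_gt0.
    rewrite -(prednK sP) ltnS; apply/leq_sizeP => j.
    rewrite coefB coefZ coefXn leq_eqVlt => /predU1P[<-|jP].
      by rewrite eqxx mulr1 subrr.
    by rewrite gtn_eqF // mulr0 subr0 nth_default // -(prednK sP).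
  by rewrite subKr => i; rewrite coefZ mulrC; apply: p0M.
(* If every member of [Pr] is [sm], the last coordinate is transcendental: any [xi] off the roots of
   the specialized [Q] will do. *)
have [[P PP /existsNP[i0 nP]]|allsm] := pselect (exists2 P, Pr P & ~ sm P); last first.
  have [[i ni]|/forallNP Qs] := pselect (exists i, ~ p0 Q`_i); last first.
    by case: nQ; apply: smPr => i; apply: contrapT; apply: Qs.
  exists Q`_i => // phi phi0 phiQ.
  have /closed_nonrootP[xi nxi] : map_poly phi Q != 0.
    by apply: contraNneq phiQ => /polyP/(_ i); rewrite coef_map coef0 => ->.
  exists xi => // P PP; suff -> : map_poly phi P = 0 by rewrite horner0.
  apply/polyP => j; rewrite coef_map coef0; apply: phi0.
  suff: sm P by apply.
  by apply: contrapT => nsP; apply: allsm; exists P.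
(* [F] plays the role of the minimal polynomial of the last coordinate over the fraction field of
   [B] modulo [p0]. *)
have [F [PF nsF] Fmin] := @min_size B [set P : {poly B} | Pr P /\ ~ sm P] P
   (conj PP (fun sP => nP (sP i0))).
have F0 : F != 0.
  by apply/eqP => F0; apply: nsF => i; rewrite F0 coef0; exact: Pr0.
have small (H : {poly B}) : Pr H -> (size H < size F)%N -> sm H.
  move=> PH; apply: contraPP => nsH; apply/negP; rewrite -leqNgt.
  exact: (Fmin H (conj PH nsH)).
have nlF : ~ p0 (lead_coef F).
  move=> /(trunc _ F0)[F' sF' smF]; apply: nsF.
  rewrite -(subrK F' F); apply: smD => //; apply: small => //.
  by apply: PrK' PF; apply: smPr.
have sF1 : (1 < size F)%N.
  rewrite ltnNge; apply/negP => /size1_polyC Fc; apply: nlF.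
  by rewrite Fc lead_coefC /p0 -Fc.
have redF (H : {poly B}) : Pr (lead_coef F ^+ scalp H F *: H - H %% F).
  by rewrite Pdiv.Idomain.divp_eq addrK; apply: PrM.
have QQ : Pr (1 * Q - Q) by rewrite mul1r subrr.
(* [G] is a multiple of [Q] modulo [Pr], outside [Pr] and of least size. Once it is constant, [U]
   inverts [Q] up to an element of [B]. *)
have [G [nG [U UQ]] Gmin] := @min_size B [set G : {poly B} | ~ Pr G /\ exists U, Pr (U * Q - G)]
   Q (conj nQ (ex_intro _ 1 QQ)).
have G0 : G != 0 by apply/eqP => G0; apply: nG; rewrite G0.
have nlG : ~ p0 (lead_coef G).
  move=> /(trunc _ G0)[G' sG' /smPr smG].
  suff: (size G <= size G')%N by rewrite leqNgt sG'.
  apply: Gmin; split; first by move=> PG'; apply: nG; apply: PrK PG'.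
  by exists U; rewrite -(subrK G (U * Q)) -addrA; apply: PrD.
have sGF : (size G < size F)%N.
  apply: leq_ltn_trans (Gmin (G %% F) _) _; last by rewrite ltn_modp.
  split=> [PG'|]; first by apply: nG; apply: PrZV nlF _; apply: PrK (redF G) PG'.
  exists (lead_coef F ^+ scalp G F *: U); rewrite -scalerAl.
  set c := _ ^+ _; rewrite -(subrK (c *: G) (c *: (U * Q))) -scalerBr -addrA.
  by apply: PrD (redF G); apply: PrZ.
(* Otherwise divide [F] by [G]: remainder and quotient lie in [Pr] and are smaller than [F], hence
   [sm], so a multiple of [F] by an element outside [p0] is [sm], against [nlF]. *)
have sG1 : (size G <= 1)%N.
  rewrite leqNgt; apply/negP => sG.
  have FE := Pdiv.Idomain.divp_eq F G.
  set c := _ ^+ _ in FE.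
  have PR : Pr (F %% G).
    apply: contrapT => nR; suff: (size G <= size (F %% G)%R)%N.
      by rewrite leqNgt ltn_modp G0.
    apply: Gmin; split=> //; exists (- (F %/ G) * U).
    have -> : - (F %/ G) * U * Q - F %% G = - (F %/ G) * (U * Q - G) - c *: F.
      by rewrite FE mulrBr mulrA opprD addrA !mulNr opprK addrK.
    by apply: PrB; [apply: PrM | apply: PrZ].
  have sR : sm (F %% G).
    by apply: small => //; apply: ltn_trans sGF; rewrite ltn_modp.
  have PH : Pr (F %/ G).
    have : Pr (F %/ G * G).
      have -> : F %/ G * G = c *: F - F %% G by rewrite FE addrK.
      by apply: PrB => //; apply: PrZ.
    by case/Prpr.
  have sH : sm (F %/ G).
    apply: small => //; rewrite Pdiv.Idomain.size_divp //.
    rewrite ltn_subrL (ltn_trans _ sF1) // andbT.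
    by rewrite -ltnS prednK // (ltn_trans _ sG).
  have : sm (c *: F) by rewrite FE; apply: smD => //; apply: smM.
  move=> /(_ (size F).-1); rewrite coefZ -lead_coefE /p0 polyCM rmorphXn /=.
  by case/Prpr => [/(prime_predX Prp)|].
have Gc := size1_polyC sG1.
(* The leading coefficient keeps the degree of [F] under [phi] and lets pseudo-division be
   cancelled; the constant [G] keeps [Q] nonzero at [xi]. *)
exists (lead_coef F * G`_0).
  rewrite polyCM => /Prpr[//|]; by rewrite -Gc.
move=> phi phi0; rewrite rmorphM mulf_eq0 negb_or => /andP[phF phG].
have [xi rxi] : exists xi, root (map_poly phi F) xi.
  by apply/closed_rootP; rewrite size_map_poly_id0 // gtn_eqF.
have sm0 H : sm H -> map_poly phi H = 0.
  by move=> sH; apply/polyP => j; rewrite coef_map coef0; apply/phi0/sH.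
have PrE H : Pr H -> (map_poly phi H).[xi] = 0.
  move=> PH; have : sm (H %% F).
    apply: small; last by rewrite ltn_modp.
    by apply: PrK' (redF H) (PrZ _ _ PH).
  move=> /sm0 R0; have := congr1 (fun p => (map_poly phi p).[xi]) (Pdiv.Idomain.divp_eq H F).
  rewrite map_polyZ hornerZ rmorphD rmorphM /= R0 addr0 hornerM (rootP rxi) mulr0.
  move/eqP; rewrite mulf_eq0 rmorphXn expf_eq0 (negPf phF) andbF /=.
  by move/eqP.
exists xi => //; have := PrE _ UQ; rewrite rmorphB rmorphM /= hornerD hornerN hornerM Gc.
rewrite map_polyC hornerC => /eqP; rewrite subr_eq0 => /eqP E.
by move: phG; apply: contraNneq => Q0; rewrite -E Q0 mulr0.
Qed.

Variable B : idomainType.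

Fixpoint tconst n : {rmorphism B -> tower B n} :=
  if n is m.+1 then (polyC \o tconst m : {rmorphism B -> {poly tower B m}})
  else idfun.

Fixpoint tvar n (i : nat) : tower B n :=
  if n is m.+1 return tower B n then
    (if i == m then 'X else (tvar m i)%:P : {poly tower B m}) else 0.

Lemma prime_tower n (Pr : set (tower B n.+1)) :
  prime_pred Pr -> prime_pred [set c : tower B n | Pr (c%:P : {poly tower B n})].
Proof.
move=> [[P0 PD PM] P1 Pp]; split; first split => //=.
- by move=> x y; rewrite polyCD; apply: PD.
- by move=> a x; rewrite polyCM; apply: PM.
- exact: P1.
- by move=> x y /=; rewrite polyCM => /Pp.
Qed.

(** Variables are removed from the outermost inwards: the condition [b] found for one variable
    becomes the nonvanishing requirement [Q] for the next. *)
Lemma extend_specialization n (Pr : set (tower B n)) (Q : tower B n) :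
  prime_pred Pr -> ~ Pr Q ->
  exists2 b : B, ~ Pr (tconst n b) & forall phi : {rmorphism B -> k},
    (forall c, Pr (tconst n c) -> phi c = 0) -> phi b != 0 ->
    exists psi : {rmorphism tower B n -> k},
      [/\ forall c, psi (tconst n c) = phi c, forall P, Pr P -> psi P = 0 &
          psi Q != 0].
Proof.
elim: n Pr Q => [|n IH] Pr Q Prp nQ.
  exists Q => // phi phi0 phiQ; exists phi; split=> //.
have [b nb ext1] := extend_specialization1 Prp nQ.
have [b' nb' ext] := IH _ b (prime_tower Prp) nb.
exists b' => // phi phi0 phib'.
have [psi [psiC psi0 psib]] := ext phi phi0 phib'.
have [xi xi0 xiQ] := ext1 psi psi0 psib.
have cfu : commr_rmorph psi xi by move=> x; apply: mulrC.
exists (horner_morph cfu : {rmorphism {poly tower B n} -> k}); split=> // c.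
rewrite /= /horner_morph map_polyC hornerC; exact: psiC.
Qed.

Fixpoint teval n (phi : {rmorphism B -> k}) (xi : nat -> k) :
    {rmorphism tower B n -> k} :=
  if n is m.+1 return {rmorphism tower B n -> k} then
    horner_morph (fun x => mulrC _ _ : GRing.comm (xi m) (teval m phi xi x))
  else phi.

Lemma tevalC n phi xi c : teval n phi xi (tconst n c) = phi c.
Proof. by elim: n => //= n IH; rewrite /horner_morph map_polyC hornerC. Qed.

Lemma teval_var n phi xi i : (i < n)%N -> teval n phi xi (tvar n i) = xi i.
Proof.
elim: n => //= n IH; rewrite ltnS leq_eqVlt => /predU1P[->|].
  by rewrite eqxx /horner_morph map_polyX hornerX.
move=> lin; rewrite ltn_eqF // /horner_morph map_polyC hornerC; exact: IH.
Qed.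

End Extension.

(** * Zariski topology and morphisms *)

Section Zariski.
Local Open Scope classical_set_scope.
Variable k : fieldType.
Implicit Types X Y Z : variety k.

Definition homogeneous n (P : {mpoly k[n]}) := exists d : nat, P \is d.-homog.

Lemma homogeneousM n (P Q : {mpoly k[n]}) :
  homogeneous P -> homogeneous Q -> homogeneous (P * Q).
Proof. by move=> [d Pd] [e Qe]; exists (d + e)%N; apply: dhomogM. Qed.

Lemma homogeneous1 n : homogeneous (1 : {mpoly k[n]}).
Proof. by exists 0%N; apply: dhomog1. Qed.

Lemma homogeneousX n (i : 'I_n) : homogeneous ('X_i : {mpoly k[n]}).
Proof. by exists 1%N; rewrite dhomogX /= mdeg1. Qed.

Lemma meval_homog n d (P : {mpoly k[n]}) (c : k) (v : 'I_n -> k) :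
  P \is d.-homog -> P.@[fun i => c * v i] = c ^+ d * P.@[v].
Proof.
move=> /dhomogP Pd; rewrite !mevalE mulr_sumr [LHS]big_seq [RHS]big_seq.
apply: eq_bigr => m /Pd md; rewrite mulrCA; congr (_ * _).
rewrite -md /= mdegE -prodrXr -big_split /=.
by apply: eq_bigr => i _; rewrite exprMn.
Qed.

Lemma hevalM X P Q (x : X) : heval (P * Q) x = heval P x * heval Q x.
Proof. exact: mevalM. Qed.

Lemma hevalD X P Q (x : X) : heval (P + Q) x = heval P x + heval Q x.
Proof. exact: mevalD. Qed.

(** Neighbourhoods are generated by the nonvanishing loci of single forms; products of forms give
    intersections, so local statements need no explicit open sets. *)
Definition znear X (x : X) (U : set X) := exists2 P : {mpoly k[hdim X]},
  homogeneous P & heval P x != 0 /\ forall y, heval P y != 0 -> U y.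

Lemma znearT X (x : X) : znear x setT.
Proof. by exists 1; [exact: homogeneous1 | rewrite /heval meval1 oner_neq0]. Qed.

Lemma znearS X (x : X) (U V : set X) : U `<=` V -> znear x U -> znear x V.
Proof. by move=> UV [P Ph [Px PU]]; exists P => //; split=> // y /PU/UV. Qed.

Lemma znear_in X (x : X) (U : set X) : znear x U -> U x.
Proof. by case=> P _ [Px]; apply. Qed.

Lemma znearI X (x : X) (U V : set X) :
  znear x U -> znear x V -> znear x (U `&` V).
Proof.
move=> [P Ph [Px PU]] [Q Qh [Qx QV]]; exists (P * Q); first exact: homogeneousM.
rewrite hevalM mulf_neq0 //; split=> // y.
by rewrite hevalM mulf_eq0 negb_or => /andP[/PU ? /QV].
Qed.

Lemma znear_near X (x : X) (U : set X) :
  znear x U -> znear x [set y | znear y U].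
Proof.
by move=> [P Ph [Px PU]]; exists P => //; split=> // y Py; exists P.
Qed.

Lemma znear_all X (I : finType) (x : X) (U : I -> set X) :
  (forall i, znear x (U i)) -> znear x [set y | forall i, U i y].
Proof.
move=> H.
suff: znear x [set y | forall i, i \in enum I -> U i y].
  by apply: znearS => y Hy i; apply: Hy; rewrite mem_enum.
elim: (enum I) => [|a l IH]; first by apply: znearS (znearT x).
apply: znearS (znearI (H a) IH) => y [Hay Hy] i.
by rewrite inE => /predU1P[->|/Hy].
Qed.

Lemma zclosedP X (Z : set X) :
  zclosed Z <-> forall x, ~ Z x -> exists2 P : {mpoly k[hdim X]},
    homogeneous P & heval P x != 0 /\ forall y, Z y -> heval P y = 0.
Proof.
split=> [[S Sh ->] x /= /existsNP[P /not_implyP[SP Px]]|H].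
  exists P; [exact: Sh | split; first exact/eqP].
  by move=> y; apply.
exists [set P | homogeneous P /\ forall y, Z y -> heval P y = 0].
  by move=> P [].
apply/seteqP; split=> x /= Hx; first by move=> P [_]; apply.
apply: contrapT => /H[P Ph [/eqP Px PZ]]; apply: Px; exact: Hx.
Qed.

Lemma zopenP X (U : set X) : zopen U <-> forall x, U x -> znear x U.
Proof.
rewrite /zopen zclosedP; split=> H x Ux.
  have [|P Ph [Px PU]] := H x; first by move/(_ Ux).
  exists P => //; split=> // y /eqP Py.
  by apply: contrapT => /PU.
have [|P Ph [Px PU]] := H x; first exact: contrapT.
by exists P => //; split=> // y nUy; apply/eqP/negPn/negP=> /PU.
Qed.

Lemma zclosed_near X (Z : set X) :
  zclosed Z <-> forall x, ~ Z x -> znear x (~` Z).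
Proof. by rewrite -zopenP /zopen setCK. Qed.

Lemma zopen_near X (U : set X) : zopen [set y | znear y U].
Proof. by apply/zopenP => y /znear_near. Qed.

Lemma zclosedU X (Z1 Z2 : set X) :
  zclosed Z1 -> zclosed Z2 -> zclosed (Z1 `|` Z2).
Proof.
rewrite !zclosed_near => H1 H2 x nZ.
have n1 : znear x (~` Z1) by apply: H1 => Zx; apply: nZ; left.
have n2 : znear x (~` Z2) by apply: H2 => Zx; apply: nZ; right.
by apply: znearS (znearI n1 n2) => y [? ?] [].
Qed.

Lemma zclosed0 X : zclosed (set0 : set X).
Proof. by rewrite zclosed_near => x _; apply: znearS (znearT x) => y _ []. Qed.

Lemma zclosedT X : zclosed (setT : set X).
Proof. by rewrite zclosed_near => x nT; case: nT. Qed.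

(** [regular_at] asks for equality wherever the denominator is nonzero, so the form [H] cutting out
    the neighbourhood is multiplied into both terms of the fraction. *)
Lemma regular_at_near X (f g : X -> k) x :
  znear x [set y | f y = g y] -> regular_at g x -> regular_at f x.
Proof.
move=> [H [e He] [Hx Hfg]] [d [P [Q [Pd Qd Qx gE]]]].
exists (d + e)%N, (P * H), (Q * H); split; try exact: dhomogM.
  by rewrite hevalM mulf_neq0.
move=> y; rewrite !hevalM mulf_eq0 negb_or => /andP[Qy Hy].
by rewrite Hfg // gE // -mulf_div divff // mulr1.
Qed.

Lemma regular_at_nearby X (f : X -> k) x :
  regular_at f x -> znear x [set y | regular_at f y].
Proof.
move=> [d [P [Q [Pd Qd Qx fE]]]]; exists Q; first by exists d.
by split=> // y Qy; exists d, P, Q.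
Qed.

Lemma regular_at_neq0 X (f : X -> k) x :
  regular_at f x -> f x != 0 -> znear x [set y | f y != 0].
Proof.
move=> [d [P [Q [Pd Qd Qx fE]]]] fx; exists (P * Q).
  by apply: homogeneousM; exists d.
have Px : heval P x != 0 by apply: contraNneq fx => P0; rewrite fE // P0 mul0r.
rewrite hevalM mulf_neq0 //; split=> // y.
rewrite hevalM mulf_eq0 negb_or => /andP[Py Qy] /=.
by rewrite fE // mulf_neq0 // invr_eq0.
Qed.

Lemma regular_at_cst X (c : k) (x : X) : regular_at (fun=> c) x.
Proof.
exists 0%N, c%:MP, 1; split; rewrite ?dhomog1 //.
- by rewrite -[c%:MP]mulr1 mul_mpolyC; apply: dhomogZ; apply: dhomog1.
- by rewrite /heval meval1 oner_neq0.
- by move=> y _; rewrite /heval mevalC meval1 divr1.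
Qed.

Lemma regular_atD X (f g : X -> k) x : regular_at f x -> regular_at g x ->
  regular_at (fun y => f y + g y) x.
Proof.
move=> [d [P [Q [Pd Qd Qx fE]]]] [e [P' [Q' [Pe Qe Q'x gE]]]].
exists (d + e)%N, (P * Q' + P' * Q), (Q * Q'); split.
- by apply: dhomogD; [apply: dhomogM | rewrite addnC; apply: dhomogM].
- exact: dhomogM.
- by rewrite hevalM mulf_neq0.
move=> y; rewrite hevalD !hevalM mulf_eq0 negb_or => /andP[Qy Q'y].
by rewrite fE // gE // addf_div.
Qed.

Lemma regular_atM X (f g : X -> k) x : regular_at f x -> regular_at g x ->
  regular_at (fun y => f y * g y) x.
Proof.
move=> [d [P [Q [Pd Qd Qx fE]]]] [e [P' [Q' [Pe Qe Q'x gE]]]].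
exists (d + e)%N, (P * P'), (Q * Q'); split; try exact: dhomogM.
  by rewrite hevalM mulf_neq0.
move=> y; rewrite !hevalM mulf_eq0 negb_or => /andP[Qy Q'y].
by rewrite fE // gE // mulf_div.
Qed.

Lemma regular_atV X (f : X -> k) x : regular_at f x -> f x != 0 ->
  regular_at (fun y => (f y)^-1) x.
Proof.
move=> [d [P [Q [Pd Qd Qx fE]]]] fx.
have Px : heval P x != 0 by apply: contraNneq fx => P0; rewrite fE // P0 mul0r.
exists (d + d)%N, (Q * Q), (P * Q); split; try exact: dhomogM.
  by rewrite hevalM mulf_neq0.
move=> y; rewrite !hevalM mulf_eq0 negb_or => /andP[Py Qy].
by rewrite fE // invf_div -mulf_div divff // mulr1.
Qed.

Lemma regular_at_sum X (I : Type) (r : seq I) (Pr : pred I) (f : I -> X -> k) x :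
  (forall i, regular_at (f i) x) ->
  regular_at (fun y => \sum_(i <- r | Pr i) f i y) x.
Proof.
move=> H; elim: r => [|i r IH].
  apply: regular_at_near (regular_at_cst 0 x).
  by apply: znearS (znearT x) => y _ /=; rewrite big_nil.
have Hi : regular_at (fun y => if Pr i then f i y else 0) x.
  by case: (Pr i); [apply: H | apply: regular_at_cst].
apply: regular_at_near (regular_atD Hi IH).
apply: znearS (znearT x) => y _ /=; rewrite big_cons.
by case: (Pr i); rewrite ?add0r.
Qed.

Lemma regular_at_prod X (I : Type) (r : seq I) (Pr : pred I) (f : I -> X -> k) x :
  (forall i, regular_at (f i) x) ->
  regular_at (fun y => \prod_(i <- r | Pr i) f i y) x.
Proof.
move=> H; elim: r => [|i r IH].
  apply: regular_at_near (regular_at_cst 1 x).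
  by apply: znearS (znearT x) => y _ /=; rewrite big_nil.
have Hi : regular_at (fun y => if Pr i then f i y else 1) x.
  by case: (Pr i); [apply: H | apply: regular_at_cst].
apply: regular_at_near (regular_atM Hi IH).
apply: znearS (znearT x) => y _ /=; rewrite big_cons.
by case: (Pr i); rewrite ?mul1r.
Qed.

Lemma regular_atX X (f : X -> k) m x :
  regular_at f x -> regular_at (fun y => f y ^+ m) x.
Proof.
move=> fx; apply: regular_at_near (regular_at_prod (index_enum 'I_m) xpredT
  (fun _ => fx)).
by apply: znearS (znearT x) => y _ /=; rewrite prodr_const card_ord.
Qed.

Lemma regular_at_meval X n (P : {mpoly k[n]}) (f : 'I_n -> X -> k) x :
  (forall i, regular_at (f i) x) -> regular_at (fun y => P.@[fun i => f i y]) x.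
Proof.
move=> H.
pose g y := \sum_(m <- msupp P) P@_m * \prod_(i < n) f i y ^+ m i.
have Hg : regular_at g x.
  apply: regular_at_sum => m; apply: regular_atM; first exact: regular_at_cst.
  by apply: regular_at_prod => i; apply: regular_atX.
apply: regular_at_near Hg; apply: znearS (znearT x) => y _ /=.
by rewrite mevalE.
Qed.

Lemma regular_at_coord X (x : X) i j : hcoord x ord0 j != 0 ->
  regular_at (fun y : X => hcoord y ord0 i / hcoord y ord0 j) x.
Proof.
move=> xj; exists 1%N, 'X_i, 'X_j; split; rewrite ?dhomogX /= ?mdeg1 //.
  by rewrite /heval mevalXU.
by move=> y; rewrite /heval !mevalXU.
Qed.

Lemma near_coord_neq0 X (x : X) j : hcoord x ord0 j != 0 ->
  znear x [set y : X | hcoord y ord0 j != 0].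
Proof.
move=> xj; exists 'X_j; first exact: homogeneousX.
by rewrite /heval mevalXU; split=> // y; rewrite mevalXU.
Qed.

Lemma heval_chart X (P : {mpoly k[hdim X]}) d (x : X) j : P \is d.-homog ->
  P.@[fun i => hcoord x ord0 i / hcoord x ord0 j]
    = (hcoord x ord0 j)^-1 ^+ d * heval P x.
Proof.
by move=> Pd; rewrite -meval_homog //; apply: meval_eq => i; rewrite mulrC.
Qed.

Lemma regular_at_zero_closed X (U : set X) (f : X -> k) :
  zopen U -> regular_on U f -> zclosed [set x | U x -> f x = 0].
Proof.
move=> /zopenP Uo fr; rewrite zclosed_near => x /not_implyP[Ux /eqP fx].
apply: znearS (znearI (Uo x Ux) (regular_at_neq0 (fr x Ux) fx)) => y [Uy /eqP fy].
by move=> /(_ Uy).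
Qed.

Lemma preim_near X Y (f : X -> Y) x (U : set Y) : vmorphism f ->
  znear (f x) U -> znear x (f @^-1` U).
Proof.
move=> [fc _] Ufx; have /zclosed_near H := fc _ (@zopen_near _ U).
have /H : ~ (f @^-1` (~` [set y | znear y U])) x by apply; exact: Ufx.
by apply: znearS => y /= /contrapT /znear_in.
Qed.

Lemma regular_at_comp X Y (f : X -> Y) h x :
  vmorphism f -> regular_at h (f x) -> regular_at (h \o f) x.
Proof.
move=> [_ fr] /regular_at_nearby/znear_near hx.
apply: (fr _ h (@zopen_near _ [set y | regular_at h y])) => [y|].
  exact: znear_in.
exact: znear_in hx.
Qed.

Lemma vmorphism_chart X Y (f : X -> Y) x i j : vmorphism f ->
  hcoord (f x) ord0 j != 0 ->
  regular_at (fun y => hcoord (f y) ord0 i / hcoord (f y) ord0 j) x.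
Proof.
by move=> fm fj; apply: (regular_at_comp fm (regular_at_coord i fj)).
Qed.

(** Homogeneous coordinates matter up to scale only, so the factor [c] may depend on [y] in any way:
    it cancels in quotients of forms of equal degree. *)
Lemma vmorphism_local X Y (f : X -> Y) :
  (forall x, exists2 G : 'I_(hdim Y) -> X -> k,
     forall i, regular_at (G i) x &
     znear x [set y | exists2 c, c != 0 &
                        forall i, G i y = c * hcoord (f y) ord0 i]) ->
  vmorphism f.
Proof.
move=> H.
have ev (P : {mpoly k[hdim Y]}) d G y c : P \is d.-homog ->
   (forall i, G i y = c * hcoord (f y) ord0 i) ->
   P.@[fun i => G i y] = c ^+ d * heval P (f y).
  by move=> Pd GE; rewrite -meval_homog //; apply: meval_eq => i; apply: GE.
split=> [Z|U h /zopenP Uo hr x Ux].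
  rewrite !zclosed_near => Zc x nZ.
  have [P [d Pd] [Px PZ]] := Zc _ nZ; have [G Gr Gn] := H x.
  have Pr := regular_at_meval P Gr.
  have Px0 : P.@[fun i => G i x] != 0.
    have [c c0 Gx] := znear_in Gn.
    by rewrite (ev _ _ _ _ _ Pd Gx) mulf_neq0 // expf_neq0.
  apply: znearS (znearI Gn (regular_at_neq0 Pr Px0)) => y [[c c0 Gy]] /=.
  rewrite (ev _ _ _ _ _ Pd Gy) mulf_eq0 negb_or => /andP[_ Py].
  exact: PZ.
have [d [P [Q [Pd Qd Qx hE]]]] := hr _ Ux; have [G Gr Gn] := H x.
have Pr := regular_at_meval P Gr; have Qr := regular_at_meval Q Gr.
have Qx0 : Q.@[fun i => G i x] != 0.
  have [c c0 Gx] := znear_in Gn.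
  by rewrite (ev _ _ _ _ _ Qd Gx) mulf_neq0 // expf_neq0.
apply: regular_at_near (regular_atM Pr (regular_atV Qr Qx0)).
apply: znearS (znearI Gn (regular_at_neq0 Qr Qx0)) => y [[c c0 Gy]] /=.
rewrite (ev _ _ _ _ _ Qd Gy) (ev _ _ _ _ _ Pd Gy).
rewrite mulf_eq0 negb_or => /andP[cd Qy].
by rewrite hE // -mulf_div divff // mul1r.
Qed.

Definition nonzero_coord Y := forall y : Y, hcoord y != 0.

Lemma coord_neq0 Y (y : Y) : hcoord y != 0 -> exists j, hcoord y ord0 j != 0.
Proof.
move=> y0; apply: contrapT => H; case/negP: y0; apply/eqP/rowP => j.
by rewrite mxE; apply/eqP/negPn/negP => yj; apply: H; exists j.
Qed.

Lemma vmorphism_comp X Y Z (f : X -> Y) (g : Y -> Z) :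
  vmorphism f -> vmorphism g -> vmorphism (g \o f).
Proof.
move=> [fc fr] [gc gr]; split=> [W /gc/fc //|U h Uo hr].
exact: (fr (g @^-1` U) (h \o g) (gc (~` U) Uo) (gr U h Uo hr)).
Qed.

Lemma vmorphism_id X : vmorphism (fun x : X => x).
Proof. by split=> //. Qed.

Lemma vmorphism_cst X Y (y : Y) : vmorphism (fun _ : X => y).
Proof.
split=> [Z Zc|U h _ _ x _]; last exact: regular_at_cst.
have [Zy|nZy] := pselect (Z y).
  have -> : (fun _ : X => y) @^-1` Z = setT by apply/seteqP; split.
  exact: zclosedT.
have -> : (fun _ : X => y) @^-1` Z = set0.
  by apply/seteqP; split=> x //= /nZy.
exact: zclosed0.
Qed.

Lemma vmorphism_eq X Y (f g : X -> Y) : f =1 g -> vmorphism f -> vmorphism g.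
Proof. by move=> /funext->. Qed.

Lemma hcoord_vprod X Y (z : vprod X Y) i j :
  hcoord z ord0 (mxvec_index i j) = hcoord z.1 ord0 i * hcoord z.2 ord0 j.
Proof. by rewrite /= mxvecE mxE big_ord1 mxE. Qed.

Lemma nonzero_coord_vprod X Y :
  nonzero_coord X -> nonzero_coord Y -> nonzero_coord (vprod X Y).
Proof.
move=> X0 Y0 z; have [i zi] := coord_neq0 (X0 z.1).
have [j zj] := coord_neq0 (Y0 z.2).
apply/eqP => /rowP/(_ (mxvec_index i j)); rewrite hcoord_vprod mxE => /eqP.
by rewrite mulf_eq0 (negPf zi) (negPf zj).
Qed.

Lemma vmorphism_pair X Y Z (f : X -> Y) (g : X -> Z) :
  nonzero_coord Y -> nonzero_coord Z -> vmorphism f -> vmorphism g ->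
  @vmorphism _ X (vprod Y Z) (fun x => (f x, g x)).
Proof.
move=> Y0 Z0 fm gm; apply: vmorphism_local => x.
have [a fa] := coord_neq0 (Y0 (f x)); have [b gb] := coord_neq0 (Z0 (g x)).
pose F i y := hcoord (f y) ord0 i / hcoord (f y) ord0 a.
pose G i y := hcoord (g y) ord0 i / hcoord (g y) ord0 b.
exists (fun l y => mxvec (\matrix_(i, j) (F i y * G j y)) ord0 l).
  move=> l; case/mxvec_indexP: l => i j.
  have rFG : regular_at (fun y => F i y * G j y) x.
    by apply: regular_atM; apply: vmorphism_chart.
  apply: regular_at_near rFG; apply: znearS (znearT x) => y _ /=.
  by rewrite mxvecE mxE.
have nf := preim_near fm (near_coord_neq0 fa).
have ng := preim_near gm (near_coord_neq0 gb).
apply: znearS (znearI nf ng) => y [/= fy gy].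
exists ((hcoord (f y) ord0 a)^-1 * (hcoord (g y) ord0 b)^-1).
  by rewrite mulf_neq0 ?invr_eq0.
move=> l; case/mxvec_indexP: l => i j.
rewrite [LHS]mxvecE [LHS]mxE.
have E := @hcoord_vprod Y Z (f y, g y) i j.
apply: etrans (congr1 (fun t => _ * t) (esym E)) => /=.
by rewrite /F /G mulrACA mulrC.
Qed.

Lemma znear_sub X (S : set X) (x : subvariety S) (U : set X) :
  znear (sval x) U -> znear x [set y : subvariety S | U (sval y)].
Proof.
by move=> [P Ph [Px PU]]; exists P => //; split=> // y; apply: PU.
Qed.

Lemma regular_at_sub X (S : set X) (x : subvariety S) (f : X -> k) :
  regular_at f (sval x) -> regular_at (fun y : subvariety S => f (sval y)) x.
Proof.
move=> [d [P [Q [Pd Qd Qx fE]]]]; exists d, P, Q; split=> // y.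
exact: fE.
Qed.

Lemma vmorphism_restrict X Y (f : X -> Y) (S : set X) (T : set Y)
    (h : subvariety S -> subvariety T) : nonzero_coord Y ->
  vmorphism f -> (forall x, sval (h x) = f (sval x)) -> vmorphism h.
Proof.
move=> Y0 fm hf; apply: vmorphism_local => x.
have [a fa] := coord_neq0 (Y0 (f (sval x))).
exists (fun i (y : subvariety S) =>
          hcoord (f (sval y)) ord0 i / hcoord (f (sval y)) ord0 a).
  move=> i; have R := @vmorphism_chart X Y f (sval x) i a fm fa.
  exact: (regular_at_sub R).
apply: znearS (znear_sub (preim_near fm (near_coord_neq0 fa))) => y /= fy.
exists (hcoord (f (sval y)) ord0 a)^-1; first by rewrite invr_eq0.
by move=> i; rewrite /= hf mulrC.
Qed.

Lemma zclosed_seq X (I : eqType) (s : seq I) (Z : I -> set X) :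
  (forall i, zclosed (Z i)) -> zclosed [set x | exists2 i, i \in s & Z i x].
Proof.
move=> Zc; elim: s => [|a l IH].
  have -> : [set x | exists2 i, i \in [::] & Z i x] = set0.
    by apply/seteqP; split=> x // [ i].
  exact: zclosed0.
have -> : [set x | exists2 i, i \in a :: l & Z i x] =
   Z a `|` [set x | exists2 i, i \in l & Z i x].
  apply/seteqP; split=> x /=.
    by move=> [i /[1!inE]/predU1P[->|il] Zi]; [left | right; exists i].
  move=> [Za|[i il Zi]]; first by exists a; rewrite ?mem_head.
  by exists i; rewrite // inE il orbT.
exact: zclosedU.
Qed.

Lemma irreducible_seq X (A : set X) (I : eqType) (s : seq I) (Z : I -> set X) :
  zirreducible A -> (forall i, zclosed (Z i)) ->
  A `<=` [set x | exists2 i, i \in s & Z i x] ->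
  exists2 i, i \in s & A `<=` Z i.
Proof.
move=> [[x0 Ax0] Ai] Zc; elim: s => [|a l IH] H.
  by have [ i] := H _ Ax0.
have [] := Ai _ _ (Zc a) (zclosed_seq l Zc).
- move=> x /H[i /[1!inE]/predU1P[->|il] Zi]; [by left | by right; exists i].
- by move=> AZ; exists a; rewrite ?mem_head.
- by move=> /IH[i il Zi]; exists i; rewrite // inE il orbT.
Qed.

End Zariski.

(** * Noetherian spaces *)

Section NoetherianSpace.
Local Open Scope classical_set_scope.
Variable k : fieldType.

Lemma rmorph_mmap n (T : comNzRingType) (f : {rmorphism k -> T})
    (h : 'I_n -> T) (psi : {rmorphism T -> k}) (P : {mpoly k[n]}) :
  (forall c, psi (f c) = c) -> psi (mmap f h P) = P.@[fun i => psi (h i)].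
Proof.
move=> fK; rewrite /mmap mevalE rmorph_sum; apply: eq_bigr => m _.
rewrite rmorphM /= fK; congr (_ * _); rewrite /mmap1 rmorph_prod.
by apply: eq_bigr => i _; rewrite rmorphXn.
Qed.

End NoetherianSpace.

Section NoetherianSpace.
Local Open Scope classical_set_scope.
Variable k : closedFieldType.
Implicit Types X : variety k.

(** [tvar] and [teval] index variables by [nat]; a tower of height [n] never reads the value 0 given
    beyond [n]. *)
Definition extend0 n (v : 'I_n -> k) (i : nat) : k :=
  if insub i is Some j then v j else 0.

Lemma extend0E n (v : 'I_n -> k) (i : 'I_n) : extend0 v i = v i.
Proof. by rewrite /extend0 valK. Qed.

(** [iota] moves the polynomials into the noetherian tower, where [phi] evaluates at [v]; finitely
    many members of [S] generate the same ideal there. *)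
Lemma finite_zeros n (S : set {mpoly k[n]}) :
  exists2 s : seq {mpoly k[n]}, (forall P, P \in s -> S P) &
    forall v : 'I_n -> k, (forall P, P \in s -> P.@[v] = 0) ->
    forall P, S P -> P.@[v] = 0.
Proof.
pose iota := mmap (tconst k n) (fun i : 'I_n => tvar k n i).
have NT : noetherian (tower k n) by apply/noetherian_tower/noetherian_field.
have [s sS sgen] := noetherian_set (iota @` S) NT.
have /choice[l lP] : forall x, exists P, x \in s -> S P /\ iota P = x.
  move=> x; case: (boolP (x \in s)) => [/sS[P SP Px]|_]; last by exists 0.
  by exists P.
exists [seq l x | x <- s]; first by move=> _ /mapP[x /lP[Sx _] ->].
move=> v v0 P SP.
pose phi := teval n (idfun : {rmorphism k -> k}) (extend0 v).
have phiE Q : phi (iota Q) = Q.@[v].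
  rewrite rmorph_mmap => [|c]; last exact: tevalC.
  by apply: meval_eq => i; rewrite [LHS]teval_var ?extend0E.
have [w ws PE] := sgen (iota P) (ex_intro2 _ _ P SP erefl).
rewrite -phiE PE rmorph_sum big_seq big1 // => u /ws us.
have [_ <-] := lP _ us; rewrite rmorphM phiE v0 ?mulr0 //.
exact: map_f.
Qed.

(** Each point [x] of [E] has a form [P x] that is nonzero at [x] and at no other point of [E].
    Finitely many of these forms have the same common zeros as all of them, and a point of [E] that
    none of the chosen forms isolates would be a common zero of all, its own form included. *)
Lemma finite_of_isolated X (E : set X) :
  (forall x, E x -> znear x [set y | E y -> y = x]) ->
  exists n (f : 'I_n -> X), forall x, E x -> exists i, f i = x.
Proof.
move=> H.
have /choice[P PP] : forall x : X, exists P : {mpoly k[hdim X]}, E x ->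
    heval P x != 0 /\ forall y : X, heval P y != 0 -> E y -> y = x.
  move=> x; have [Ex|nEx] := pselect (E x); last by exists 0.
  by have [P _ [Px PH]] := H x Ex; exists P.
have [s sS sz] := finite_zeros [set P x | x in E].
have /choice[l lP] : forall i : 'I_(size s), exists x : X, E x /\ P x = s`_i.
  by move=> i; have [x Ex <-] := sS _ (mem_nth 0 (ltn_ord i)); exists x.
exists (size s), l => y Ey; apply: contrapT => /forallNP nl.
have [Py _] := PP y Ey; case/eqP: Py.
apply: (sz (fun i => hcoord y ord0 i)); last by exists y.
move=> Q /(nthP 0)[i si <-]; have [Ex Px] := lP (Ordinal si).
apply/eqP/negPn/negP => Qy; apply: (nl (Ordinal si)); apply/esym.
by have [_] := PP _ Ex; apply => //; rewrite Px.
Qed.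

(** Finitely many forms cut out the zeros of all forms that vanish on some [Z i]; each of them
    vanishes from some index on, and the largest of these indices serves for all. *)
Lemma zclosed_stable X (Z : nat -> set X) : (forall i, zclosed (Z i)) ->
  (forall i, Z i.+1 `<=` Z i) -> exists j, forall i, Z j `<=` Z i.
Proof.
move=> Zc Zd.
have Zle i j : (i <= j)%N -> Z j `<=` Z i.
  move=> /subnK<-; elim: (j - i)%N => // n IH.
  by rewrite addSn; apply: subset_trans (Zd _) IH.
pose S := [set P : {mpoly k[hdim X]} | homogeneous P /\
   exists i, forall x, Z i x -> heval P x = 0].
have [s sS sz] := finite_zeros S.
have [j jP] : exists j, forall P, P \in s -> forall x, Z j x -> heval P x = 0.
  elim: s sS {sz} => [|P s IH] sS; first by exists 0%N.
  have [j jP] : exists j, forall P, P \in s -> forall x, Z j x -> heval P x = 0.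
    by apply: IH => Q Qs; apply: sS; rewrite inE Qs orbT.
  have [_ [i iP]] := sS P (mem_head P s); exists (maxn i j) => Q.
  rewrite inE => /predU1P[->|Qs] x Zx.
    by apply: iP; apply: Zle Zx; rewrite leq_maxl.
  by apply: (jP Q) => //; apply: Zle Zx; rewrite leq_maxr.
exists j => i x Zx; apply: contrapT => nZ.
have [P Ph [/eqP Px PZ]] := (zclosedP (Z i)).1 (Zc i) x nZ; apply: Px.
apply: (sz (fun i => hcoord x ord0 i)); last by split=> //; exists i.
by move=> Q /jP; apply.
Qed.

End NoetherianSpace.

Section ImageClosed.
Local Open Scope classical_set_scope.
Variable k : closedFieldType.

Lemma regular_at_teval (X : variety k) (B : idomainType)
    (phi : X -> {rmorphism B -> k}) (xi : X -> nat -> k) (x : X) n (F : tower B n) :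
  (forall b, regular_at (fun a => phi a b) x) ->
  (forall i, regular_at (fun a => xi a i) x) ->
  regular_at (fun a => teval n (phi a) (xi a) F) x.
Proof.
move=> phir xir; elim: n F => [|n IH] F; first exact: phir.
have R : regular_at (fun a => \sum_(i < size (F : {poly tower B n}))
     teval n (phi a) (xi a) (F : {poly tower B n})`_i * xi a n ^+ i) x.
  by apply: regular_at_sum => i; apply: regular_atM (regular_atX _ _).
apply: regular_at_near R; apply: znearS (znearT x) => a _ /=.
by rewrite /horner_morph /map_poly horner_poly.
Qed.

End ImageClosed.

(** * Images of homomorphisms are closed *)

Section MorphismsToGroups.
Local Open Scope classical_set_scope.
Variable k : fieldType.
Variables (D : gvariety k) (X : variety k).
Hypothesis D_ab : abelian_variety D.

Lemma ab_nonzero_coord : nonzero_coord D.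
Proof. by case: D_ab => [[]]. Qed.

Lemma vmorphismD (f g : X -> D) : @vmorphism _ X D f -> @vmorphism _ X D g ->
  @vmorphism _ X D (fun x => f x + g x : D).
Proof.
case: D_ab => [[D0 _ _] _ addm _] fm gm.
exact: (vmorphism_comp (vmorphism_pair D0 D0 fm gm) addm).
Qed.

Lemma vmorphismN (f : X -> D) : @vmorphism _ X D f ->
  @vmorphism _ X D (fun x => - f x : D).
Proof. case: D_ab => [_ _ _ oppm] fm; exact: (vmorphism_comp fm oppm). Qed.

Lemma vmorphism_sum (I : Type) (r : seq I) (P : pred I) (f : I -> X -> D) :
  (forall i, @vmorphism _ X D (f i)) ->
  @vmorphism _ X D (fun x => \sum_(i <- r | P i) f i x : D).
Proof.
move=> fm; elim: r => [|i r IH].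
  apply: vmorphism_eq (@vmorphism_cst _ X D (0 : D)) => x; by rewrite big_nil.
case Pi: (P i); last by apply: vmorphism_eq IH => x; rewrite big_cons Pi.
by apply: vmorphism_eq (vmorphismD (fm i) IH) => x; rewrite big_cons Pi.
Qed.

Lemma vmorphismMn (f : X -> D) n : @vmorphism _ X D f ->
  @vmorphism _ X D (fun x => f x *+ n : D).
Proof.
move=> fm; apply: vmorphism_eq (vmorphism_sum (index_enum 'I_n) xpredT (fun=> fm)).
by move=> x; rewrite sumr_const card_ord.
Qed.

Lemma vmorphismMz (f : X -> D) n : @vmorphism _ X D f ->
  @vmorphism _ X D (fun x => f x *~ n : D).
Proof.
move=> fm; case: n => n; first exact: vmorphismMn.
by apply: vmorphism_eq (vmorphismN (vmorphismMn n.+1 fm)) => x.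
Qed.

End MorphismsToGroups.

Section ImageClosed.
Local Open Scope classical_set_scope.
Variable k : closedFieldType.
Variables (A C : gvariety k) (h : A -> C).
Hypotheses (A_ab : abelian_variety A) (C_ab : abelian_variety C).
Hypothesis h_hom : av_hom h.

Let hD x y : h (x + y) = h x + h y. Proof. exact: h_hom.1. Qed.
Let h0 : h 0 = 0.
Proof. by apply: (addrI (h 0)); rewrite -hD !addr0. Qed.
Let hN x : h (- x) = - h x.
Proof. by apply: (addrI (h x)); rewrite -hD !subrr h0. Qed.
Let hm : @vmorphism _ A C h. Proof. exact: h_hom.2. Qed.

Definition zclosure (X : variety k) (S : set X) : set X :=
  [set x | forall Z, zclosed Z -> S `<=` Z -> Z x].

Lemma zclosed_closure (X : variety k) (S : set X) : zclosure S `<=` S -> zclosed S.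
Proof.
move=> cS; suff -> : S = [set x | forall P : {mpoly k[hdim X]},
    homogeneous P /\ (forall y, S y -> heval P y = 0) -> heval P x = 0].
  exists [set P : {mpoly k[hdim X]} | homogeneous P /\ forall y, S y -> heval P y = 0] => //.
  by move=> P [].
apply/seteqP; split=> x /= Sx; first by move=> P [_]; apply.
apply: cS => Z Zc SZ; apply: contrapT => nZ.
have [P Ph [/eqP Px PZ]] := (zclosedP Z).1 Zc x nZ; apply: Px.
by apply: Sx; split=> // y /SZ/PZ.
Qed.

(* A nonempty open subset of the closure of the image consists of
   specializations that extend to points of A, hence lies in the image. *)
Lemma image_contains_open : exists W : set C,
  [/\ zopen W, exists a, W (h a) & zclosure (range h) `&` W `<=` range h].
Proof.
have [[A0 Ainj [S Sh SA]] Airr _ _] := A_ab.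
have [[C0 Cinj _] _ _ _] := C_ab.
have [i0 xi0] := coord_neq0 (A0 (0 : A)).
have [j0 yj0] := coord_neq0 (C0 (h 0)).
pose x (a : A) i := hcoord (a : gvar A) ord0 i / hcoord (a : gvar A) ord0 i0.
pose yC (c : C) j := hcoord (c : gvar C) ord0 j / hcoord (c : gvar C) ord0 j0.
have yr j : exists PQ : {mpoly k[hdim (gvar A)]} * {mpoly k[hdim (gvar A)]},
    exists d, [/\ PQ.1 \is d.-homog, PQ.2 \is d.-homog, heval PQ.2 (0 : gvar A) != 0 &
      forall a : gvar A, heval PQ.2 a != 0 -> yC (h a) j = heval PQ.1 a / heval PQ.2 a].
  have [d [P [Q [Pd Qd Q0 E]]]] := vmorphism_chart j hm yj0.
  by exists (P, Q), d; split.
have {yr} /choice[PQ PQP] := yr.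
(* On [V] both affine charts are defined, and [h] is given by the fractions [PQ]. *)
pose V := [set a : gvar A | [/\ hcoord a ord0 i0 != 0,
  forall j, heval (PQ j).2 a != 0 & hcoord (h a : gvar C) ord0 j0 != 0]].
have Vn (a : gvar A) : V a -> znear a V.
  move=> [ai aQ ha].
  have nQ : znear a [set b : gvar A | forall j, heval (PQ j).2 b != 0].
    apply: znear_all => j; have [d [_ Qd _ _]] := PQP j.
    by exists (PQ j).2; first by exists d.
  have nh := preim_near hm (near_coord_neq0 ha).
  by apply: znearS (znearI (near_coord_neq0 ai) (znearI nQ nh)) => b [? []].
have Vo : zopen V by apply/zopenP.
have V0 : V (0 : A) by split=> // j; have [d []] := PQP j.
have Qx a j : heval (PQ j).2 (a : gvar A) != 0 -> hcoord (a : gvar A) ord0 i0 != 0 ->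
    (PQ j).2.@[x a] != 0.
  have [d [_ Qd _ _]] := PQP j => Qa a0.
  by rewrite /x (heval_chart _ _ Qd) mulf_neq0 // expf_neq0 // invr_eq0.
have yE a j : V a -> yC (h a) j = (PQ j).1.@[x a] / (PQ j).2.@[x a].
  move=> [a0 aQ _]; have [d [Pd Qd _ E]] := PQP j.
  rewrite E // /x (heval_chart _ _ Pd) (heval_chart _ _ Qd).
  by rewrite -mulf_div divff ?mul1r // expf_neq0 // invr_eq0.
pose B := {mpoly k[hdim (gvar C)]} : idomainType.
pose n := hdim (gvar A).
pose iota := mmap (tconst B n \o (@mpolyC (hdim (gvar C)) k)) (fun i : 'I_n => tvar B n i).
pose phi (c : C) : {rmorphism B -> k} := meval (yC c).
pose ev a := teval n (phi (h a)) (extend0 (x a)).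
have evC a b : ev a (tconst B n b) = b.@[yC (h a)] by exact: tevalC.
have evV a (i : 'I_n) : ev a (tvar B n i) = x a i.
  by rewrite /ev teval_var // extend0E.
have psi_iota (psi : {rmorphism tower B n -> k}) P :
    (forall c, psi (tconst B n c%:MP) = c) ->
    psi (iota P) = P.@[fun i : 'I_n => psi (tvar B n i)].
  move=> psiC; rewrite /iota /mmap mevalE rmorph_sum; apply: eq_bigr => m _.
  rewrite rmorphM /= psiC; congr (_ * _); rewrite /mmap1 rmorph_prod.
  by apply: eq_bigr => i _; rewrite rmorphXn.
have ev_iota a P : ev a (iota P) = P.@[x a].
  rewrite psi_iota => [|c]; last by rewrite evC mevalC.
  by apply: meval_eq => i; rewrite evV.
(* The relations between the coordinates of [a] (variables of the tower) and those of [h a] (in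
   [B]): the ideal of the graph over [V], prime because [A] is irreducible. *)
pose Pr := [set F : tower B n | forall a, V a -> ev a F = 0].
have xr a i : V a -> @regular_at _ A (fun a => x a i) a.
  by move=> [a0 _ _]; apply: regular_at_coord.
have yr a b : V a -> @regular_at _ A (fun a => b.@[yC (h a)]) a.
  move=> /[dup] Va [a0 aQ _]; apply: (regular_at_meval b (f := fun j a => yC (h a) j)) => j.
  have [d [Pd Qd _ E]] := PQP j.
  by exists d, (PQ j).1, (PQ j).2; split.
have evr F (a : gvar A) : V a -> @regular_at _ A (fun a => ev a F) a.
  move=> Va; apply: regular_at_teval => [b|i]; first exact: yr.
  rewrite /extend0; case: insubP => [j _ _|_]; first exact: xr.
  exact: regular_at_cst.
have Prp : prime_pred Pr.
  split; first split => [a _|F G F0 G0 a Va|F G G0 a Va].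
  - by rewrite rmorph0.
  - by rewrite rmorphD F0 ?G0 ?addr0.
  - by rewrite rmorphM G0 ?mulr0.
  - by move=> /(_ _ V0)/eqP; rewrite rmorph1 oner_eq0.
  move=> F G FG.
  have zc H : zclosed [set a : gvar A | V a -> ev a H = 0].
    by apply: regular_at_zero_closed => // a Va; apply: evr.
  have [|FA|GA] := Airr.2 _ _ (zc F) (zc G).
  - move=> a _ /=; have [Va|nVa] := pselect (V a); last by left=> /nVa.
    have /eqP := FG a Va; rewrite rmorphM mulf_eq0 => /orP[]/eqP E; [left|right]=> //.
  - by left=> a; apply: FA.
  - by right=> a; apply: GA.
(* [Q0] nonzero at the extended point makes the fractions for [h] meaningful there. *)
pose Q0 := \prod_j (PQ j).2.
have nQ : ~ Pr (iota Q0).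
  move=> /(_ _ V0)/eqP; rewrite ev_iota /Q0 rmorph_prod => /prodf_eq0[j _].
  by have [V1 V2 _] := V0; apply/negP/Qx.
have [b nb ext] := extend_specialization k Prp nQ.
have {nb} [a0 [Va0 ba0]] : exists a, V a /\ b.@[yC (h a)] != 0.
  apply: contrapT => /forallNP H; apply: nb => a Va; rewrite evC.
  by apply/eqP/negPn/negP => ba; apply: (H a).
pose W := [set c : gvar C | hcoord c ord0 j0 != 0 /\ b.@[yC c] != 0].
have yCr (c : gvar C) F : hcoord c ord0 j0 != 0 -> regular_at (fun c : gvar C => F.@[yC c]) c.
  move=> c0; apply: (regular_at_meval F (f := fun j c => yC c j)) => j.
  exact: regular_at_coord.
exists W; split.
- apply/zopenP => c [c0 bc]; apply: znearI; first exact: near_coord_neq0.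
  by apply: regular_at_neq0 => //; apply: yCr.
- by exists a0; split=> //; case: Va0.
move=> c [cl [c0 bc]].
(* A relation among the coordinates of [h a] alone holds on the image near [h 0], hence on its
   closure, which contains [c]. *)
have phi0 F : Pr (tconst B n F) -> phi c F = 0.
  move=> PF.
  have Zc : zclosed [set c : gvar C | hcoord c ord0 j0 != 0 -> F.@[yC c] = 0].
    apply: regular_at_zero_closed => [|c' c'0]; last exact: yCr.
    by apply/zopenP => c'; apply: near_coord_neq0.
  apply: (cl _ Zc) => // _ [a _ <-].
  have [|HA|HA] := Airr.2 _ _ (hm.1 _ Zc) (Vo : zclosed (~` V)).
  - move=> a' _; have [Va|nVa] := pselect (V a'); last by right.
    by left => _; have := PF _ Va; rewrite evC.
  - exact: HA.
  - by case: (HA (0 : A)).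
have [psi [psiC psi0 psiQ]] := ext (phi c) phi0 bc.
have psiC' d : psi (tconst B n d%:MP) = d by rewrite psiC /= mevalC.
pose xi (i : 'I_n) := psi (tvar B n i).
have psiE P : psi (iota P) = P.@[xi] by apply: psi_iota.
(* The relation [x a i0 = 1] passes to [xi], which is thus a nonzero vector; it also satisfies the
   equations of [A], hence represents a point. *)
have xi1 : xi i0 = 1.
  have : psi (tvar B n i0 - 1) = 0.
    apply: psi0 => a [a1 _ _]; rewrite rmorphB rmorph1 evV /x divff ?subrr //.
  by rewrite rmorphB rmorph1 => /eqP; rewrite subr_eq0 => /eqP.
pose v : 'rV[k]_n := \row_i xi i.
have vE P : P.@[fun i => v ord0 i] = P.@[xi] by apply: meval_eq => i; rewrite mxE.
have v0 : v != 0.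
  by apply/eqP => /rowP/(_ i0); rewrite !mxE xi1 => /eqP; rewrite oner_eq0.
have [a [l vl]] : exists (a : A) (l : k), v = l *: hcoord (a : gvar A).
  apply/(SA v v0) => P SP; rewrite vE -psiE; apply: psi0 => a [a1 _ _].
  have [d Pd] := Sh P SP; rewrite ev_iota /x (heval_chart _ _ Pd).
  suff -> : heval P (a : gvar A) = 0 by rewrite mulr0.
  have/(SA _ (A0 a)) : exists (a' : A) (l : k), hcoord (a : gvar A) = l *: hcoord (a' : gvar A).
    by exists a, 1; rewrite scale1r.
  by apply.
have xiE : xi =1 (fun i => l * hcoord (a : gvar A) ord0 i).
  by move=> i; move/rowP/(_ i): vl; rewrite !mxE.
have l0 : l != 0 by apply: contraNneq v0 => l0; rewrite vl l0 scale0r.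
have yj j : yC c j = yC (h a) j.
  have [d [Pd Qd _ E]] := PQP j.
  have Q0j : (PQ j).2.@[xi] != 0.
    move: psiQ; rewrite psiE /Q0 rmorph_prod; apply: contraNneq => Qj.
    by apply/eqP; rewrite (bigD1 j) //= Qj mul0r.
  have Qj : heval (PQ j).2 (a : gvar A) != 0.
    apply: contraNneq Q0j => Qa.
    by rewrite (meval_eq _ xiE) (meval_homog _ _ Qd) [X in _ * X]Qa mulr0.
  rewrite E //.
  have : psi (tconst B n 'X_j * iota (PQ j).2 - iota (PQ j).1) = 0.
    apply: psi0 => a' Va'; rewrite rmorphB rmorphM evC !ev_iota /= mevalXU yE //.
    rewrite divfK ?subrr //; have [? ? _] := Va'; exact: Qx.
  rewrite rmorphB rmorphM psiC !psiE /= mevalXU => /eqP; rewrite subr_eq0 => /eqP yPQ.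
  apply: (mulIf Q0j); rewrite yPQ (meval_eq _ xiE) (meval_homog _ _ Pd).
  rewrite (meval_eq _ xiE) (meval_homog _ _ Qd) mulrCA; congr (_ * _).
  exact/esym/divfK.
exists a => //; apply/esym.
have ha0 : hcoord (h a : gvar C) ord0 j0 != 0.
  apply/eqP => h00; have /eqP := yj j0.
  by rewrite /yC h00 invr0 mulr0 divff // oner_eq0.
apply: (Cinj c (h a) (hcoord (c : gvar C) ord0 j0 / hcoord (h a : gvar C) ord0 j0)).
apply/rowP => j; rewrite mxE.
have := yj j; rewrite /yC => /(congr1 (fun t => t * hcoord (c : gvar C) ord0 j0)).
rewrite divfK // => ->.
by rewrite [LHS]mulrC [LHS]mulrA [RHS]mulrAC.
Qed.

(** A subgroup containing a nonempty open part of its closure is closed. If [c] is in the closure,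
    so is each [c - h a], and it suffices that one of them falls in [W]. If none did, the image, and
    so its closure, would lie in the closed set of [x] with [c - x] outside [W]; but [c - h a0] is
    in the closure and [c - (c - h a0) = h a0] is in [W]. *)
Lemma image_closed : zclosed (range h : set (gvar C)).
Proof.
have [W [Wo [a0 Wa0] clW]] := image_contains_open.
apply: zclosed_closure => c clc.
have clD d a : zclosure (range h : set (gvar C)) d ->
    zclosure (range h : set (gvar C)) (d - h a : C).
  move=> cld Z Zc hZ.
  have tm : @vmorphism _ C C (fun x => x + - h a : C).
    by apply: vmorphismD => //; exact: vmorphism_cst.
  apply: (cld _ (tm.1 _ Zc)) => _ [b _ <-]; apply: hZ; exists (b - a) => //.
  by rewrite hD hN.
suff [a Wa] : exists a, W (c - h a).
  have [b _ bE] := clW _ (conj (clD c a clc) Wa).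
  by exists (b + a) => //; rewrite hD bE subrK.
apply: contrapT => /forallNP nW.
have tm : @vmorphism _ C C (fun x => c + - x : C).
  apply: vmorphismD => //; first exact: vmorphism_cst.
  by apply: vmorphismN.
have := clD c a0 clc _ (tm.1 _ (Wo : zclosed (~` W))).
apply=> [_ [b _ <-]|]; first exact: nW.
by rewrite /= opprB addrC subrK.
Qed.

End ImageClosed.

(** * Cotangent spaces *)

Lemma mpoly_ring_ind (k : comNzRingType) n (P : {mpoly k[n]} -> Prop) :
  (forall c, P c%:MP) -> (forall i, P 'X_i) ->
  (forall p q, P p -> P q -> P (p + q)) -> (forall p q, P p -> P q -> P (p * q)) ->
  forall p, P p.
Proof.
move=> PC PX PD PM p; rewrite [p]mpolyE.
apply: (big_ind P) => [||m _]; [by rewrite -(mpolyC0 n k) | exact: PD|].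
rewrite -mul_mpolyC; apply: (PM (p@_m)%:MP) => //; rewrite mpolyXE_id.
apply: (big_ind P) => [||i _]; [by rewrite -(mpolyC1 n k) | exact: PM|].
elim: (m i) => [|e IH]; first by rewrite expr0 -(mpolyC1 n k).
by rewrite exprS; apply: PM.
Qed.

Section Cotangent.
Local Open Scope classical_set_scope.
Variables (k : fieldType) (X : variety k) (o : X).

Definition germ_max (f : X -> k) := regular_at f o /\ f o = 0.

(** The square of the maximal ideal of the local ring at [o], on representatives of germs; functions
    are congruent modulo it when their difference satisfies this predicate. *)
Definition germ_max2 (f : X -> k) := exists (I : finType) (u v : I -> X -> k),
  [/\ forall i, germ_max (u i), forall i, germ_max (v i) &
      znear o [set x | f x = \sum_i u i x * v i x]].

Lemma germ_maxM f g : regular_at f o -> germ_max g -> germ_max (fun x => f x * g x).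
Proof.
by move=> fr [gr g0]; split; [exact: regular_atM | rewrite g0 mulr0].
Qed.

Lemma germ_max_sum (I : Type) (r : seq I) (f : I -> X -> k) :
  (forall i, germ_max (f i)) -> germ_max (fun x => \sum_(i <- r) f i x).
Proof.
move=> fm; split; first by apply: regular_at_sum => i; case: (fm i).
by rewrite big1 // => i _; case: (fm i).
Qed.

Lemma germ_max2_near f g : znear o [set x | f x = g x] -> germ_max2 g -> germ_max2 f.
Proof.
move=> fg [I [u [v [um vm E]]]]; exists I, u, v; split=> //.
by apply: znearS (znearI fg E) => x [/= -> ->].
Qed.

Lemma germ_max2_eq f g : f =1 g -> germ_max2 g -> germ_max2 f.
Proof. by move=> /funext->. Qed.

Lemma germ_max2_0 : germ_max2 (fun=> 0).
Proof.
exists 'I_0, (fun _ _ => 0), (fun _ _ => 0); split=> [[]|[]|] //.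
by apply: znearS (znearT o) => x _ /=; rewrite big_ord0.
Qed.

Lemma germ_max2M f g : germ_max f -> germ_max g -> germ_max2 (fun x => f x * g x).
Proof.
move=> fm gm; exists 'I_1, (fun=> f), (fun=> g); split=> //.
by apply: znearS (znearT o) => x _ /=; rewrite big_ord1.
Qed.

Lemma germ_max2D f g : germ_max2 f -> germ_max2 g -> germ_max2 (fun x => f x + g x).
Proof.
move=> [I [u [v [um vm E]]]] [J [u' [v' [um' vm' E']]]].
exists (I + J)%type, (fun s => match s with inl i => u i | inr j => u' j end),
  (fun s => match s with inl i => v i | inr j => v' j end).
split; [by case | by case |].
by apply: znearS (znearI E E') => x [/= -> ->]; rewrite big_sumType.
Qed.

Lemma germ_max2Z f g : regular_at f o -> germ_max2 g -> germ_max2 (fun x => f x * g x).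
Proof.
move=> fr [I [u [v [um vm E]]]]; exists I, (fun i x => f x * u i x), v.
split=> // [i|]; first exact: germ_maxM.
apply: znearS E => x /= ->; rewrite mulr_sumr.
by apply: eq_bigr => i _; rewrite mulrA.
Qed.

Lemma germ_max2_sum (I : Type) (r : seq I) (f : I -> X -> k) :
  (forall i, germ_max2 (f i)) -> germ_max2 (fun x => \sum_(i <- r) f i x).
Proof.
move=> fm; elim: r => [|i r IH].
  by apply: germ_max2_eq germ_max2_0 => x; rewrite big_nil.
by apply: germ_max2_eq (germ_max2D (fm i) IH) => x; rewrite big_cons.
Qed.

Lemma germ_max_sub f : regular_at f o -> germ_max (fun x => f x - f o).
Proof.
by move=> fr; split; [apply/regular_atD/regular_at_cst | rewrite subrr].
Qed.

(** First-order Taylor expansion. The linear form [L] depends on [P] and [w0] only, so the same [L]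
    serves for several families [w], whose linear parts can then be compared. *)
Lemma meval_first_order n (P : {mpoly k[n]}) (w0 : 'I_n -> k) :
  exists L : 'I_n -> k, forall w : 'I_n -> X -> k,
    (forall l, regular_at (w l) o) -> (forall l, w l o = w0 l) ->
    germ_max2 (fun x => P.@[fun l => w l x] - P.@[w0]
                        - \sum_l L l * (w l x - w0 l)).
Proof.
elim/mpoly_ring_ind: P => [c|i|p q [L HL] [L' HL']|p q [L HL] [L' HL']].
- exists (fun=> 0) => w _ _; apply: germ_max2_eq germ_max2_0 => x.
  by rewrite !mevalC subrr big1 ?subr0 // => l _; rewrite mul0r.
- exists (fun l => (l == i)%:R) => w _ _; apply: germ_max2_eq germ_max2_0 => x.
  rewrite !mevalXU (bigD1 i) //= eqxx mul1r big1 ?addr0 ?subrr // => l /negPf->.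
  by rewrite mul0r.
- exists (fun l => L l + L' l) => w wr w00.
  apply: germ_max2_eq (germ_max2D (HL w wr w00) (HL' w wr w00)) => x.
  rewrite !mevalD.
  have -> : \sum_l (L l + L' l) * (w l x - w0 l) =
     \sum_l L l * (w l x - w0 l) + \sum_l L' l * (w l x - w0 l).
    by rewrite -big_split /=; apply: eq_bigr => l _; rewrite mulrDl.
  by ring.
- exists (fun l => p.@[w0] * L' l + q.@[w0] * L l) => w wr w00.
  have pm (r : {mpoly k[n]}) : germ_max (fun x => r.@[fun l => w l x] - r.@[w0]).
    have -> : r.@[w0] = r.@[fun l => w l o] by apply: meval_eq => l; rewrite w00.
    by apply: (germ_max_sub (f := fun x => r.@[fun l => w l x])); apply: regular_at_meval.
  have H1 := germ_max2Z (regular_at_cst p.@[w0] o) (HL' w wr w00).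
  have H2 := germ_max2Z (regular_at_cst q.@[w0] o) (HL w wr w00).
  apply: germ_max2_eq (germ_max2D (germ_max2M (pm p) (pm q)) (germ_max2D H1 H2)) => x.
  rewrite !mevalM.
  have -> : \sum_l (p.@[w0] * L' l + q.@[w0] * L l) * (w l x - w0 l) =
     p.@[w0] * (\sum_l L' l * (w l x - w0 l)) + q.@[w0] * \sum_l L l * (w l x - w0 l).
    rewrite !mulr_sumr -big_split /=; apply: eq_bigr => l _.
    by rewrite mulrDl !mulrA.
  by ring.
Qed.

(** As [P] vanishes at [w0], only the derivative of the numerator contributes. *)
Lemma frac_first_order n (P Q : {mpoly k[n]}) (w0 : 'I_n -> k) :
  P.@[w0] = 0 -> Q.@[w0] != 0 ->
  exists L : 'I_n -> k, forall w : 'I_n -> X -> k,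
    (forall l, regular_at (w l) o) -> (forall l, w l o = w0 l) ->
    germ_max2 (fun x => P.@[fun l => w l x] / Q.@[fun l => w l x]
                        - \sum_l L l * (w l x - w0 l)).
Proof.
move=> P0 Q0; have [L HL] := meval_first_order P w0.
exists (fun l => L l / Q.@[w0]) => w wr w00.
have Qr : regular_at (fun x => Q.@[fun l => w l x]) o by apply: regular_at_meval.
have Qo : Q.@[fun l => w l o] = Q.@[w0] by apply: meval_eq => l; rewrite w00.
have Qn : Q.@[fun l => w l o] != 0 by rewrite Qo.
have QV : germ_max (fun x => (Q.@[fun l => w l x])^-1 - Q.@[w0]^-1).
  rewrite -Qo; apply: (germ_max_sub (f := fun x => (Q.@[fun l => w l x])^-1)).
  exact: regular_atV.
have Lm : germ_max (fun x => \sum_l L l * (w l x - w0 l)).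
  apply: germ_max_sum => l; apply: germ_maxM; first exact: regular_at_cst.
  by rewrite -w00; apply: germ_max_sub.
have H := germ_max2Z (regular_atV Qr Qn) (HL w wr w00).
apply: germ_max2_eq (germ_max2D H (germ_max2M QV Lm)) => x.
have -> : \sum_l L l / Q.@[w0] * (w l x - w0 l) =
   Q.@[w0]^-1 * \sum_l L l * (w l x - w0 l).
  by rewrite mulr_sumr; apply: eq_bigr => l _; ring.
by rewrite P0; ring.
Qed.

Lemma meval_sub_span n (P : {mpoly k[n]}) (w0 : 'I_n -> k) :
  exists q : 'I_n -> {mpoly k[n]}, forall v : 'I_n -> k,
    P.@[v] - P.@[w0] = \sum_i (v i - w0 i) * (q i).@[v].
Proof.
elim/mpoly_ring_ind: P => [c|i|p q [f Hf] [g Hg]|p q [f Hf] [g Hg]].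
- exists (fun=> 0) => v; rewrite !mevalC subrr big1 // => i _.
  by rewrite mulr0.
- exists (fun l => (l == i)%:R) => v; rewrite !mevalXU (bigD1 i) //= eqxx rmorph1 mulr1.
  by rewrite big1 ?addr0 // => l /negPf->; rewrite /= raddf0 mulr0.
- exists (fun i => f i + g i) => v; rewrite !mevalD.
  transitivity ((p.@[v] - p.@[w0]) + (q.@[v] - q.@[w0])); first by ring.
  rewrite Hf Hg -big_split /=; apply: eq_bigr => i _.
  by rewrite mevalD mulrDr.
exists (fun i => f i * q + p.@[w0] *: g i) => v; rewrite !mevalM.
transitivity ((p.@[v] - p.@[w0]) * q.@[v] + p.@[w0] * (q.@[v] - q.@[w0])); first by ring.
rewrite Hf Hg mulr_suml mulr_sumr -big_split /=; apply: eq_bigr => i _.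
by rewrite mevalD mevalM mevalZ; ring.
Qed.

(** Expanding the numerator of [f] along the centered chart coordinates shows that they generate the
    maximal ideal at [o]. *)
Lemma germ_max_span j (f : X -> k) : hcoord o ord0 j != 0 -> germ_max f ->
  exists2 g : 'I_(hdim X) -> X -> k, forall i, regular_at (g i) o &
    znear o [set x | f x = \sum_i g i x *
        (hcoord x ord0 i / hcoord x ord0 j - hcoord o ord0 i / hcoord o ord0 j)].
Proof.
move=> oj [[d [P [Q [Pd Qd Qo E]]]] f0].
pose c (x : X) i := hcoord x ord0 i / hcoord x ord0 j.
have cr i : regular_at (fun x => c x i) o by apply: regular_at_coord.
have evc R (x : X) : R \is d.-homog -> R.@[c x] = (hcoord x ord0 j)^-1 ^+ d * heval R x.
  by move=> Rd; rewrite /c (heval_chart _ _ Rd).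
have Qr : regular_at (fun x => Q.@[c x]) o by apply: regular_at_meval.
have Qn : Q.@[c o] != 0 by rewrite evc // mulf_neq0 // expf_neq0 // invr_eq0.
have Po : P.@[c o] = 0.
  have/eqP := E o Qo; rewrite f0 eq_sym mulf_eq0 invr_eq0 (negPf Qo) orbF => /eqP P0.
  by rewrite evc // P0 mulr0.
have [q Hq] := meval_sub_span P (c o).
exists (fun i x => (q i).@[c x] / Q.@[c x]).
  by move=> i; apply: regular_atM; [apply: regular_at_meval | apply: regular_atV].
have nQ : znear o [set x | heval Q x != 0] by exists Q; first by exists d.
apply: znearS (znearI (near_coord_neq0 oj) nQ) => x [/= xj Qx].
have lx : (hcoord x ord0 j)^-1 ^+ d != 0 by rewrite expf_neq0 // invr_eq0.
rewrite E //; transitivity (P.@[c x] / Q.@[c x]).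
  by rewrite !evc // -mulf_div divff // mul1r.
have := Hq (c x); rewrite Po subr0 => ->; rewrite mulr_suml.
by apply: eq_bigr => i _; rewrite /c; ring.
Qed.

End Cotangent.

(** * Torsion and divisibility *)

Section Torsion.
Local Open Scope classical_set_scope.
Variable k : numClosedFieldType.
Variable A : gvariety k.
Hypothesis A_ab : abelian_variety A.

Let o : gvar A := (0 : A).

(** The differential of addition is addition. In Segre coordinates, [f (u + v)] is a fraction with
    linear part [L]; the mixed difference of the Segre coordinate of index [i], [j] is the product
    of the centered [c i (phi a)] and [c j (chi a)], hence of second order. *)
Lemma germ_max2_additive (f : A -> k) (phi chi : A -> A) : germ_max o f ->
  @vmorphism _ A A phi -> phi 0 = 0 -> @vmorphism _ A A chi -> chi 0 = 0 ->
  germ_max2 o (fun a => f (phi a + chi a) - f (phi a) - f (chi a)).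
Proof.
move=> [fr f0] phim phi0 chim chi0.
have [[A0 _ _] _ addm _] := A_ab.
have [i0 oi] := coord_neq0 (A0 (0 : A)).
have fr00 : @regular_at _ A f ((0 : A) + 0) by rewrite addr0.
have [d [P [Q [Pd Qd Q0 E]]]] := @regular_at_comp _ (vprod A A) A _ f (0 : A, 0 : A) addm fr00.
pose c i (a : A) := hcoord (a : gvar A) ord0 i / hcoord (a : gvar A) ord0 i0.
pose w (ph ch : A -> A) l (a : A) :=
  mxvec (\matrix_(i, j) (c i (ph a) * c j (ch a))) ord0 l.
pose w0 l := w (fun=> 0) (fun=> 0) l 0.
have wE (ph ch : A -> A) a l : w ph ch l a =
    (hcoord (ph a : gvar A) ord0 i0)^-1 * (hcoord (ch a : gvar A) ord0 i0)^-1 *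
    hcoord ((ph a, ch a) : vprod A A) ord0 l.
  case/mxvec_indexP: l => i j; rewrite /w mxvecE mxE.
  have -> := @hcoord_vprod _ A A (ph a, ch a) i j.
  by rewrite /c /=; ring.
have evw (R : {mpoly k[hdim (vprod A A)]}) ph ch a : R \is d.-homog -> R.@[fun l => w ph ch l a] =
   ((hcoord (ph a : gvar A) ord0 i0)^-1 * (hcoord (ch a : gvar A) ord0 i0)^-1) ^+ d *
   @heval _ (vprod A A) R (ph a, ch a).
  by move=> Rd; rewrite -meval_homog //; apply: meval_eq => l; apply: wE.
have oi2 : (hcoord o ord0 i0)^-1 * (hcoord o ord0 i0)^-1 != 0.
  by rewrite mulf_neq0 // invr_eq0.
have Qw0 : Q.@[w0] != 0 by rewrite /w0 evw // mulf_neq0 // expf_neq0.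
have Pw0 : P.@[w0] = 0.
  have /eqP := E (0 : A, 0 : A) Q0.
  rewrite /= addr0 f0 eq_sym mulf_eq0 invr_eq0 (negPf Q0) orbF => /eqP P0.
  by rewrite /w0 evw // P0 mulr0.
have [L HL] := frac_first_order o Pw0 Qw0.
have cr i (ph : A -> A) : @vmorphism _ A A ph -> ph 0 = 0 ->
    @regular_at _ A (fun a => c i (ph a)) o.
  by move=> phm ph0; apply: vmorphism_chart => //; rewrite ph0.
have core (ph ch : A -> A) : @vmorphism _ A A ph -> ph 0 = 0 ->
    @vmorphism _ A A ch -> ch 0 = 0 ->
    germ_max2 o (fun a => f (ph a + ch a) - \sum_l L l * (w ph ch l a - w0 l)).
  move=> phm ph0 chm ch0.
  have wr l : @regular_at _ A (w ph ch l) o.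
    case/mxvec_indexP: l => i j.
    apply: regular_at_near (regular_atM (cr i ph phm ph0) (cr j ch chm ch0)).
    by apply: znearS (znearT o) => a _ /=; rewrite /w mxvecE mxE.
  have wo l : w ph ch l o = w0 l.
    by case/mxvec_indexP: l => i j; rewrite /w0 /w !mxvecE !mxE ph0 ch0.
  apply: germ_max2_near (HL _ wr wo).
  have n1 := preim_near phm (near_coord_neq0 (_ : hcoord (ph o : gvar A) ord0 i0 != 0)).
  have n2 := preim_near chm (near_coord_neq0 (_ : hcoord (ch o : gvar A) ord0 i0 != 0)).
  have nQ : znear ((ph o, ch o) : vprod A A) [set z | heval Q z != 0].
    by exists Q; [exists d | rewrite /o ph0 ch0].
  have n3 := preim_near (vmorphism_pair A0 A0 phm chm) nQ.
  rewrite {1}/o ph0 {1}/o ch0 in n1 n2.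
  apply: znearS (znearI (n1 oi) (znearI (n2 oi) n3)) => a [/= pa [ca Qa]].
  have la : ((hcoord (ph a : gvar A) ord0 i0)^-1 *
    (hcoord (ch a : gvar A) ord0 i0)^-1) ^+ d != 0.
    by rewrite expf_neq0 // mulf_neq0 // invr_eq0.
  congr (_ - _); rewrite !evw // -mulf_div divff // mul1r.
  exact: (E (ph a, ch a)).
have zm : @vmorphism _ A A (fun=> 0 : A) by apply: vmorphism_cst.
pose t l a := w phi chi l a - w phi (fun=> 0) l a - w (fun=> 0) chi l a + w0 l.
have tm l : germ_max2 o (t l).
  case/mxvec_indexP: l => i j.
  have m1 : @germ_max _ A o (fun a => c i (phi a) - c i 0).
    by rewrite -phi0; apply: (germ_max_sub (cr i phi phim phi0)).
  have m2 : @germ_max _ A o (fun a => c j (chi a) - c j 0).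
    by rewrite -chi0; apply: (germ_max_sub (cr j chi chim chi0)).
  apply: germ_max2_eq (germ_max2M m1 m2) => a.
  by rewrite /t /w0 /w !mxvecE !mxE; ring.
have H1 := core phi chi phim phi0 chim chi0.
have H2 := germ_max2Z (regular_at_cst (-1) o) (core phi (fun=> 0) phim phi0 zm erefl).
have H3 := germ_max2Z (regular_at_cst (-1) o) (core (fun=> 0) chi zm erefl chim chi0).
have H4 : germ_max2 o (fun a => \sum_l L l * t l a).
  by apply: germ_max2_sum => l; apply: germ_max2Z; first exact: regular_at_cst.
apply: germ_max2_eq (germ_max2D (germ_max2D H1 (germ_max2D H2 H3)) H4) => a.
rewrite addr0 add0r.
have -> : \sum_l L l * t l a = \sum_l L l * (w phi chi l a - w0 l) -
   \sum_l L l * (w phi (fun=> 0) l a - w0 l) - \sum_l L l * (w (fun=> 0) chi l a - w0 l).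
  by rewrite -!sumrB; apply: eq_bigr => l _; rewrite /t; ring.
by ring.
Qed.

Lemma germ_max2_mulrn (f : A -> k) n : germ_max o f ->
  germ_max2 o (fun a => f (a *+ n) - f a *+ n).
Proof.
move=> fm; elim: n => [|n IH].
  have [_ f0] := fm; apply: germ_max2_eq (germ_max2_0 o) => a.
  by rewrite !mulr0n subr0; apply/esym.
have idm : @vmorphism _ A A (fun a => a) by apply: vmorphism_id.
have H := germ_max2_additive fm idm erefl (vmorphismMn A_ab n idm) (mul0rn _ _).
apply: germ_max2_eq (germ_max2D H IH) => a.
by rewrite !mulrS; ring.
Qed.

(* In the local ring at 0, the equations x_i (n a) = 0 of the n-torsion read
   (n I + M) x = 0 with the entries of M in the maximal ideal. *)
Lemma torsion_isolated0 n : (0 < n)%N ->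
  znear o [set a : gvar A | (a : A) *+ n = 0 -> a = o].
Proof.
move=> n0; have [[A0 Ainj _] _ _ _] := A_ab.
have [i0 oi] := coord_neq0 (A0 (0 : A)).
pose N := hdim (gvar A).
pose x (i : 'I_N) (a : gvar A) := hcoord a ord0 i / hcoord a ord0 i0 -
   hcoord o ord0 i / hcoord o ord0 i0.
have xm i : germ_max o (x i).
  apply: (germ_max_sub (f := fun a : gvar A => hcoord a ord0 i / hcoord a ord0 i0)).
  exact: regular_at_coord.
have : forall i, exists m : 'I_N -> gvar A -> k, (forall j, germ_max o (m j)) /\
    znear o [set a : gvar A | x i ((a : A) *+ n) - x i a *+ n = \sum_j m j a * x j a].
  move=> i; have [I [u [v [um vm E]]]] := germ_max2_mulrn n (xm i).
  have /choice[g gP] : forall l, exists g : 'I_N -> gvar A -> k,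
      (forall j, regular_at (g j) o) /\ znear o [set a | v l a = \sum_j g j a * x j a].
    by move=> l; have [g gr gE] := germ_max_span oi (vm l); exists g.
  exists (fun j a => \sum_l g l j a * u l a); split.
    by move=> j; apply: germ_max_sum => l; apply: germ_maxM => //; case: (gP l).
  have nv : znear o [set a | forall l, v l a = \sum_j g l j a * x j a].
    by apply: znear_all => l; case: (gP l).
  apply: znearS (znearI E nv) => a [/= -> vE].
  under eq_bigr do rewrite vE mulr_sumr.
  rewrite exchange_big /=; apply: eq_bigr => j _; rewrite mulr_suml.
  by apply: eq_bigr => l _; ring.
move=> /choice[m mP].
pose M (a : gvar A) : 'M[k]_N := n%:R%:M + \matrix_(i, j) m i j a.
have Mr : @regular_at _ A (fun a => \det (M a)) o.
  rewrite /determinant; apply: regular_at_sum => s.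
  apply: regular_atM; first exact: regular_at_cst.
  apply: regular_at_prod => i.
  have [mr _] := (mP i).1 (s i).
  apply: regular_at_near (regular_atD (regular_at_cst (n%:R *+ (i == s i)) o) mr).
  by apply: znearS (znearT o) => a _ /=; rewrite !mxE.
have Mo : \det (M o) != 0.
  have -> : M o = n%:R%:M.
    rewrite /M -[RHS]addr0; congr (_ + _); apply/matrixP => i j; rewrite !mxE.
    by case: ((mP i).1 j).
  by rewrite det_scalar expf_neq0 // pnatr_eq0 -lt0n.
have nE : znear o [set a : gvar A | forall i, x i ((a : A) *+ n) - x i a *+ n
   = \sum_j m i j a * x j a].
  by apply: znear_all => i; case: (mP i).
apply: znearS (znearI (near_coord_neq0 oi) (znearI nE (regular_at_neq0 Mr Mo))).
move=> a [/= ai [aE Ma]] na0.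
pose xv : 'cV[k]_N := \col_i x i a.
have Mx : M a *m xv = 0.
  apply/colP => i; rewrite mulmxDl mxE mul_scalar_mx !mxE.
  have := aE i; rewrite na0; have [_ xo] := xm i; rewrite {1}xo sub0r => /esym xE.
  under eq_bigr do rewrite !mxE.
  by rewrite xE mulr_natl subrr.
have xv0 : xv = 0.
  by rewrite -[xv](mulKmx (_ : M a \in unitmx)) ?Mx ?mulmx0 // unitmxE unitfE.
apply: (Ainj _ _ (hcoord a ord0 i0 / hcoord o ord0 i0)); apply/rowP => i.
have /eqP : x i a = 0 by move/colP/(_ i): xv0; rewrite !mxE.
rewrite /x subr_eq0 => /eqP E; rewrite mxE -mulrA [_^-1 * _]mulrC -E.
by rewrite mulrC divfK.
Qed.

(** Translation carries the isolation of 0 over to every torsion point, and [finite_of_isolated]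
    applies. *)
Lemma torsion_finite n : (0 < n)%N ->
  exists s : seq A, forall a : A, a *+ n = 0 -> a \in s.
Proof.
move=> n0; have [|m [f fP]] := @finite_of_isolated _ (gvar A) [set a : A | a *+ n = 0].
  move=> a na.
  have tm : @vmorphism _ A A (fun b => b + - a : A).
    by apply: vmorphismD => //; exact: vmorphism_cst.
  have ta : (fun b : A => b - a) a = 0 by rewrite subrr.
  have := torsion_isolated0 n0; rewrite -[o]ta => /(preim_near tm).
  apply: znearS => b /= H nb; apply/eqP; rewrite -subr_eq0; apply/eqP.
  by rewrite H ?subrr // mulrnBl na nb subrr.
by exists [seq f i | i <- enum 'I_m] => a /fP[i <-]; apply: map_f; rewrite mem_enum.
Qed.

Lemma av_hom_mulrn n : @av_hom _ A A (fun a => a *+ n).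
Proof.
by split=> [a b|]; [rewrite mulrnDl | apply: vmorphismMn => //; apply: vmorphism_id].
Qed.

(* The closed subgroups n^j A decrease, hence stabilize; the stable one has
   finite index since torsion is finite, hence is A by irreducibility. *)
Lemma divisible n : (0 < n)%N -> forall a : A, exists b, a = b *+ n.
Proof.
move=> n0; pose Z j : set (gvar A) := range (fun a : A => a *+ (n ^ j)).
have Zc j : zclosed (Z j) by apply: image_closed => //; apply: av_hom_mulrn.
have Zd j : Z j.+1 `<=` Z j.
  by move=> _ [a _ <-]; exists (a *+ n) => //; rewrite -mulrnA -expnS.
have [j jP] := zclosed_stable Zc Zd.
have [|s sP] := @torsion_finite (n ^ j)%N; first by rewrite expn_gt0 n0.
have Tc (t : A) : @zclosed _ A [set a : A | Z 1%N (a + - t : A)].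
  have tm : @vmorphism _ A A (fun b => b + - t : A).
    by apply: vmorphismD => //; exact: vmorphism_cst.
  exact: (tm.1 _ (Zc 1%N)).
have Airr : zirreducible [set: gvar A] by case: A_ab.
have [|t ts tP] := irreducible_seq Airr Tc (s := s).
  (* From [n^j a = n^(2j+1) b], the point [a - n^(j+1) b] is killed by [n^j]: [A] is covered by the
     translates of [n A] by the finitely many points of [s]. *)
  move=> a _ /=; have [b _ bE] := jP (j + j.+1)%N _ (ex_intro2 _ _ (a : A) I erefl).
  exists ((a : A) - b *+ (n ^ j.+1)); last by exists (b *+ n ^ j) => //=; rewrite -mulrnA expn1 opprB addrC subrK -expnSr.
  apply: sP; rewrite mulrnBl -mulrnA; apply/eqP; rewrite subr_eq0; apply/eqP.
  by move: bE => <-; rewrite expnD mulnC.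
(* A single translate of [n A] by [t] is everything; apply this to [a + t]. *)
move=> a; have [b /= _ bE] := tP (a + t : A) I.
by exists b; move: bE; rewrite expn1 addrK => ->.
Qed.

End Torsion.

(** * Jacobians and quotients *)

Section AvHom.
Local Open Scope classical_set_scope.
Variable k : fieldType.
Implicit Types A B C : gvariety k.

Section Basics.
Variables (A B : gvariety k) (h : A -> B).
Hypothesis hh : av_hom h.

Lemma av_homD x y : h (x + y) = h x + h y. Proof. exact: hh.1. Qed.

Lemma av_hom0 : h 0 = 0.
Proof. by apply: (addrI (h 0)); rewrite -av_homD !addr0. Qed.

Lemma av_homN x : h (- x) = - h x.
Proof. by apply: (addrI (h x)); rewrite -av_homD !subrr av_hom0. Qed.

Lemma av_homB x y : h (x - y) = h x - h y.
Proof. by rewrite av_homD av_homN. Qed.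

Lemma av_homMn x n : h (x *+ n) = h x *+ n.
Proof. by elim: n => [|n IH]; rewrite ?mulr0n ?av_hom0 // !mulrS av_homD IH. Qed.

Lemma av_homMz x n : h (x *~ n) = h x *~ n.
Proof. by case: n => n; rewrite ?NegzE ?mulrNz ?av_homN av_homMn. Qed.

Lemma av_hom_sumr (I : Type) (r : seq I) (P : pred I) (F : I -> A) :
  h (\sum_(i <- r | P i) F i) = \sum_(i <- r | P i) h (F i).
Proof. exact: (big_morph h av_homD av_hom0). Qed.

End Basics.

Lemma av_hom_comp A B C (f : A -> B) (g : B -> C) :
  av_hom f -> av_hom g -> av_hom (g \o f).
Proof.
move=> [fD fm] [gD gm]; split=> [x y|]; first by rewrite /= fD gD.
exact: vmorphism_comp fm gm.
Qed.

Lemma av_hom_id A : @av_hom _ A A (fun x => x).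
Proof. by split=> //; apply: vmorphism_id. Qed.

Lemma av_homMz_hom A B (f : A -> B) n : abelian_variety B -> av_hom f ->
  @av_hom _ A B (fun x => f x *~ n).
Proof.
move=> B_ab [fD fm]; split; first by move=> x y; rewrite fD mulrzDl.
exact: vmorphismMz.
Qed.

Lemma av_hom_sum A B (I : Type) (r : seq I) (P : pred I) (F : I -> A -> B) :
  abelian_variety B -> (forall i, av_hom (F i)) ->
  @av_hom _ A B (fun x => \sum_(i <- r | P i) F i x).
Proof.
move=> B_ab Fh; split; last by apply: vmorphism_sum => // i; case: (Fh i).
by move=> x y; rewrite -big_split; apply: eq_bigr => i _; case: (Fh i) => ->.
Qed.

End AvHom.

Section Jacobians.
Local Open Scope classical_set_scope.
Variable k : fieldType.
Implicit Types X Y : variety k.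

(** Uniqueness in the universal property is up to translation, so testing on differences of points
    of the curve is enough. *)
Lemma jacobian_ext X (J B : gvariety k) (aj : X -> J) (h h' : J -> B) :
  jacobian aj -> abelian_variety B -> av_hom h -> av_hom h' ->
  (forall x x', h (aj x - aj x') = h' (aj x - aj x')) -> h =1 h'.
Proof.
move=> [J_ab ajm univ] B_ab hh hh' E.
have hb : @vmorphism _ X B (h \o aj) by case: hh => _; apply: vmorphism_comp.
have [h0 [_ _ uniq]] := univ _ (h \o aj) B_ab hb.
suff t' : exists t : B, forall x, h (aj x) = h' (aj x) + t.
  have -> : h = h0 by apply: uniq => //; exists 0 => x; rewrite addr0.
  by have -> : h' = h0 by apply: uniq.
have [[x0 _]|nX] := pselect (exists x0 : X, True); last first.
  by exists 0 => x; case: nX; exists x.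
exists (h (aj x0) - h' (aj x0)) => x.
have := E x x0; rewrite (av_homB hh) (av_homB hh') => /eqP; rewrite subr_eq => /eqP->.
by rewrite -addrA [- _ + _]addrC.
Qed.

Lemma jacobian_lift X (J B : gvariety k) (aj : X -> J) (b : X -> B) :
  jacobian aj -> abelian_variety B -> @vmorphism _ X B b ->
  exists2 h : J -> B, av_hom h & forall x x', h (aj x - aj x') = b x - b x'.
Proof.
move=> [J_ab ajm univ] B_ab bm; have [h [hh [t tE] _]] := univ _ b B_ab bm.
by exists h => // x x'; rewrite (av_homB hh) !tE opprD addrACA subrr addr0.
Qed.

Section Quotient.
Variables (gT : finGroupType) (X Y : variety k) (act : gT -> X -> X).
Variables (M : {group gT}) (q : X -> Y).
Hypothesis act_aut : curve_action act.
Hypothesis qP : quotient_by act M q.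

Lemma quotient_vmorphism : vmorphism q.
Proof.
case: qP => _ _ qc qr; split=> [Z /qc //|U h Uo hr].
by apply/qr.
Qed.

Lemma quotient_act g x : g \in M -> q (act g x) = q x.
Proof. by case: qP => _ qE _ _ gM; apply/esym/qE; exists g. Qed.

(** Any set-theoretic section [l] of [q] will do, as [f] is constant on orbits; closedness and
    regularity on [Y] are tested after composing with [q]. *)
Lemma quotient_descent (Z : variety k) (f : X -> Z) : vmorphism f ->
  (forall g x, g \in M -> f (act g x) = f x) ->
  exists2 f' : Y -> Z, vmorphism f' & forall x, f' (q x) = f x.
Proof.
case: qP => qs qE qc qr fm finv.
have /choice[l lP] := qs.
have f'q x : f (l (q x)) = f x.
  by have [g gM xE] := (qE _ _).1 (lP (q x)); rewrite [in RHS]xE finv.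
exists (f \o l) => //.
have fq : (f \o l) \o q = f by apply/funext.
split=> [W Wc|U h Uo hr]; first by apply/(qc _).1; rewrite -comp_preimage fq; apply: fm.1.
have Vo : zopen ((f \o l) @^-1` U).
  have H : zclosed (((f \o l) \o q) @^-1` (~` U)) by rewrite fq; apply: (fm.1 (~` U)).
  exact: (qc (~` ((f \o l) @^-1` U))).1 H.
apply/(qr _ _ Vo); suff: regular_on (((f \o l) \o q) @^-1` U) (h \o ((f \o l) \o q)) by [].
by rewrite fq; apply: fm.2.
Qed.

Variables (JX JY : gvariety k) (ajX : X -> JX) (ajY : Y -> JY) (rho : gT -> JX -> JX).
Hypotheses (JXP : jacobian ajX) (JYP : jacobian ajY).
Hypothesis rhoP : forall g, norm_map ajX ajX (act g) (rho g).

Let JX_ab : abelian_variety JX. Proof. by case: JXP. Qed.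
Let JY_ab : abelian_variety JY. Proof. by case: JYP. Qed.
Let rhoh g : av_hom (rho g). Proof. by case: (rhoP g). Qed.
Let rhoE g x x' : rho g (ajX x - ajX x') = ajX (act g x) - ajX (act g x').
Proof. by case: (rhoP g). Qed.

Lemma rho1 z : rho 1%g z = z.
Proof.
apply: (jacobian_ext JXP JX_ab (rhoh 1%g) (av_hom_id JX)) => x x'.
by rewrite rhoE; case: act_aut => _ a1 _ _; rewrite !a1.
Qed.

Lemma rhoM g h z : rho (g * h)%g z = rho g (rho h z).
Proof.
apply: (jacobian_ext JXP JX_ab (rhoh _) (av_hom_comp (rhoh h) (rhoh g))) => x x'.
by rewrite /= !rhoE; case: act_aut => _ _ aM _; rewrite !aM.
Qed.

(** Both composites are compared on differences of points only; each of the [#|M|] terms of an orbit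
    sum is pushed to the same point of [Y]. *)
Lemma quotient_jacobian : exists (push : JX -> JY) (pull : JY -> JX),
  [/\ av_hom push, av_hom pull,
      forall x x', push (ajX x - ajX x') = ajY (q x) - ajY (q x'),
      forall z, pull (push z) = \sum_(g in M) rho g z &
      forall y, push (pull y) = y *+ #|M|].
Proof.
have ajXm : @vmorphism _ X JX ajX by case: JXP.
have ajYm : @vmorphism _ Y JY ajY by case: JYP.
have actm g : vmorphism (act g) by case: act_aut.
have actM g h x : act (g * h)%g x = act g (act h x) by case: act_aut.
have [push pushh pushE] := jacobian_lift JXP JY_ab
  (vmorphism_comp quotient_vmorphism ajYm).
have [||f' f'm f'E] := @quotient_descent JX (fun x => \sum_(g in M) ajX (act g x)).
- by apply: vmorphism_sum => // g; apply: vmorphism_comp (actm g) ajXm.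
- move=> h x hM; rewrite [RHS](reindex_inj (mulIg h)) /=.
  by apply: eq_big => [g|g _]; rewrite ?groupMr // actM.
have [pull pullh pullE] := jacobian_lift JYP JX_ab f'm.
have pE x x' : pull (ajY (q x) - ajY (q x')) =
    \sum_(g in M) (ajX (act g x) - ajX (act g x')).
  by rewrite pullE !f'E sumrB.
exists push, pull; split=> //.
- apply: (jacobian_ext JXP (h := pull \o push)) => // [||x x'].
  + exact: av_hom_comp.
  + exact: av_hom_sum.
  by rewrite /= pushE pE; apply: eq_bigr => g _; rewrite rhoE.
- apply: (jacobian_ext JYP (h := push \o pull)) => // [||y y'].
  + exact: av_hom_comp.
  + by apply: (@av_homMz_hom _ _ _ _ #|M|) => //; apply: av_hom_id.
  case: qP => qs _ _ _; have [x <-] := qs y; have [x' <-] := qs y'.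
  rewrite /= pE (av_hom_sumr pushh) -sumr_const; apply: eq_bigr => g gM.
  by rewrite pushE /= !quotient_act.
Qed.

End Quotient.
End Jacobians.

(** * Dihedral groups *)

Lemma sum_cycle (gT : finGroupType) (V : nmodType) (x : gT) (F : gT -> V) :
  \sum_(g in <[x]>%g) F g = \sum_(i < #[x]%g) F (x ^+ i)%g.
Proof.
have -> : <[x]>%g = [set (x ^+ (i : nat))%g | i : 'I_#[x]%g].
  apply/eqP; rewrite eq_sym eqEcard; apply/andP; split.
    by apply/fintype.subsetP=> _ /imsetP[i _ ->]; apply: mem_cycle.
  rewrite card_imset ?card_ord // => i j /eqP.
  by rewrite eq_expg_mod_order !modn_small // => /eqP/val_inj.
rewrite big_imset //= => i j _ _ /eqP.
by rewrite eq_expg_mod_order !modn_small // => /eqP/val_inj.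
Qed.

Lemma leq_card_mulG (gT : finGroupType) (A B : {group gT}) :
  (#|(A * B)%g| <= #|A| * #|B|)%N.
Proof. by rewrite mul_cardG leq_pmulr // cardG_gt0. Qed.

Section Dihedral.
Variables (gT : finGroupType) (r s : gT) (p : nat).
Hypotheses (p_prime : prime p) (p_odd : odd p).
Hypothesis order_G : #|[set: gT]| = (2 * p)%N.
Hypothesis gen_G : [set: gT] = <<[set r; s]>>%g.
Hypotheses (rp : (r ^+ p = 1)%g) (s2 : (s ^+ 2 = 1)%g) (rs2 : ((r * s) ^+ 2 = 1)%g).

Let p_gt1 : (1 < p)%N. Proof. exact: prime_gt1. Qed.

Lemma dihedral_sV : (s^-1 = s)%g.
Proof. by apply/eqP; rewrite eq_invg_mul -expg2 s2. Qed.

Lemma dihedral_conj : (s * r * s = r^-1)%g.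
Proof.
apply/eqP; rewrite eq_sym eq_invg_mul !mulgA; apply/eqP.
by move: rs2; rewrite expg2 !mulgA.
Qed.

Lemma dihedral_norm : s \in 'N(<[r]>)%g.
Proof.
by rewrite inE -cycleJ cycle_subG conjgE dihedral_sV mulgA dihedral_conj groupV cycle_id.
Qed.

Lemma dihedral_mul : [set: gT] = (<[r]> * <[s]>)%g.
Proof.
rewrite gen_G -norm_joinEr ?cycle_subG ?dihedral_norm //.
by rewrite /cycle joing_idl joing_idr.
Qed.

Lemma dihedral_order : #[r]%g = p.
Proof.
have [_ pd] := primeP p_prime; have := pd #[r]%g.
rewrite order_dvdn rp eqxx => /(_ isT)/orP[/eqP r1|/eqP//].
have : (#|(<[r]> * <[s]>)%g| <= 2)%N.
  apply: leq_trans (leq_card_mulG _ _) _; rewrite -!orderE r1 mul1n.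
  by apply: dvdn_leq => //; rewrite order_dvdn s2.
by rewrite -dihedral_mul order_G leqNgt -[X in (X < _)%N]muln1 ltn_pmul2l // p_gt1.
Qed.

Lemma dihedral_order_s : #[s]%g = 2.
Proof.
have s_dvd : (#[s]%g %| 2)%N by rewrite order_dvdn s2.
apply/eqP; rewrite eqn_leq dvdn_leq // ltnNge; apply/negP => s1.
have : (#|(<[r]> * <[s]>)%g| <= p)%N.
  apply: leq_trans (leq_card_mulG _ _) _; rewrite -!orderE dihedral_order.
  by rewrite -[X in (_ <= X)%N]muln1 leq_mul2l s1 orbT.
by rewrite -dihedral_mul order_G leqNgt -[X in (X < _)%N]mul1n ltn_pmul2r // prime_gt0.
Qed.

Lemma dihedral_s_notin : s \notin <[r]>%g.
Proof.
apply/negP => sr; have := cardSg (_ : <[s]> \subset <[r]>)%g.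
rewrite cycle_subG => /(_ sr); rewrite -!orderE dihedral_order dihedral_order_s.
by rewrite dvdn2 p_odd.
Qed.

Lemma dihedral_cover g : (g \in <[r]>)%g || (g * s \in <[r]>)%g.
Proof.
have : g \in [set: gT] by rewrite inE.
rewrite dihedral_mul => /mulsgP[a b ar /cycleP[i ->] ->].
rewrite -(expg_mod i s2) modn2; case: (odd i) => /=; last by rewrite mulg1 ar.
by rewrite expg1 -mulgA -expg2 s2 mulg1 ar orbT.
Qed.

Lemma dihedral_sum (V : nmodType) (F : gT -> V) :
  \sum_g F g = \sum_(g in <[r]>%g) F g + \sum_(g in <[r]>%g) F (g * s)%g.
Proof.
rewrite (bigID (mem <[r]>%g)) /=; congr (_ + _).
rewrite (reindex_inj (mulIg s)) /=; apply: eq_bigl => g.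
apply/idP/idP => [|gr]; last by rewrite groupMl ?dihedral_s_notin.
have := dihedral_cover (g * s)%g; rewrite -mulgA -expg2 s2 mulg1.
by case: (_ * _ \in _)%g.
Qed.

End Dihedral.

Section CyclotomicIrreducible.
Variable p : nat.
Hypothesis p_prime : prime p.

Definition prime_cyclotomic : {poly rat} := \sum_(i < p) 'X^i.

(** Irreducibility of the [p]-th cyclotomic polynomial, which is identified with the minimal
    polynomial of a primitive root of unity. *)
Lemma coprimep_prime_cyclotomic (f : {poly rat}) :
  (size f < p)%N -> f != 0 -> coprimep f prime_cyclotomic.
Proof.
move=> sf f0; have p0 := prime_gt0 p_prime.
have [z zp] := C_prim_root_exists p0.
have [q [qE qm qP]] := minCpolyP z.
have sq : size q = p.
  have := congr1 (fun t : {poly algC} => size t) qE.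
  rewrite (minCpoly_cyclotomic zp) size_cyclotomic size_map_poly => <-.
  by rewrite totient_prime // prednK.
have z1 : z - 1 != 0.
  rewrite subr_eq0; apply/eqP => z1; have := prim_order_dvd zp 1.
  rewrite z1 expr1n eqxx dvdn1 => /eqP p1.
  by have := prime_gt1 p_prime; rewrite p1.
have qPhi : q %| prime_cyclotomic.
  rewrite -qP rootE rmorph_sum horner_sum /=; apply/eqP; apply: (mulfI z1).
  rewrite mulr0; transitivity (z ^+ p - 1); last by rewrite (prim_expr_order zp) subrr.
  rewrite subrX1; congr (_ * _); apply: eq_bigr => i _.
  by rewrite map_polyXn hornerXn.
have PhiE : prime_cyclotomic %= q.
  rewrite eqp_sym -dvdp_size_eqp // sq eqn_leq; apply/andP; split.
    apply: leq_trans (dvdp_leq _ qPhi); first by rewrite sq.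
    apply/eqP => /polyP/(_ 0%N); rewrite coef0 /prime_cyclotomic coef_sum.
    rewrite -(prednK p0) big_ord_recl /= big1 ?addr0 ?coefXn //.
    by move=> i _; rewrite coefXn.
  apply/leq_sizeP => j pj; rewrite coef_sum big1 // => i _.
  by rewrite coefXn gtn_eqF // (leq_trans (ltn_ord i)).
rewrite (eqp_coprimepr _ PhiE).
have dq : gcdp f q %| q by apply: dvdp_gcdr.
have df : gcdp f q %| f by apply: dvdp_gcdl.
have q0 : q != 0 by apply: monic_neq0.
(* The minimal polynomial [q] divides [q %/ gcdp f q] or [gcdp f q]; the second would make [f] too
   large, and the first leaves a constant gcd. *)
have zq : root (map_poly ratr (q %/ gcdp f q * gcdp f q) : {poly algC}) z.
  by rewrite divpK // qP.
move: zq; rewrite rmorphM rootM /= !qP => /orP[h|h]; last first.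
  have := dvdp_leq f0 (dvdp_trans h df); by rewrite sq leqNgt sf.
have e0 : q %/ gcdp f q != 0 by rewrite dvdp_div_eq0.
have d0 : gcdp f q != 0 by apply: dvdpN0 dq q0.
have := dvdp_leq e0 h; rewrite size_divp // /coprimep leq_subRL; last first.
  by apply: leq_trans (leq_pred _) (dvdp_leq q0 dq).
rewrite -[X in (_ <= X)%N]add0n leq_add2r leqn0 => /eqP sd.
by rewrite -[size _]prednK ?size_poly_gt0 // sd.
Qed.

End CyclotomicIrreducible.

(** * The integral group ring *)

Section GroupRing.
Variable gT : finGroupType.
Local Notation G := [set: gT]%G.
Local Notation R := (regular_repr rat G).
Local Notation QG := (group_ring rat G).

Lemma regularM g h : R (g * h)%g = R g *m R h.
Proof. by rewrite repr_mxM ?inE. Qed.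

Lemma regular_in g : (R g \in QG)%MS.
Proof. by apply: envelop_mx_id; rewrite inE. Qed.

Definition zgroup_mx (c : gT -> int) : 'M[rat]_#|G| :=
  \sum_(g in G) (c g)%:~R *: R g.

Local Notation E := zgroup_mx.

Lemma zgroup_mxE c : E c = \sum_g (c g)%:~R *: R g.
Proof. by apply: eq_bigl => g; rewrite inE. Qed.

Lemma gring_row_regular g : gring_row (R g) = delta_mx 0 (gring_index G g).
Proof. by rewrite /gring_row rowK gring_indexK ?inE // mul1g. Qed.

Lemma gring_row_zgroup c g :
  gring_row (E c) ord0 (gring_index G g) = (c g)%:~R.
Proof.
rewrite zgroup_mxE linear_sum summxE (bigD1 g) //= big1 ?addr0 => [|h hg].
  by rewrite linearZ /= gring_row_regular !mxE !eqxx mulr1.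
rewrite linearZ /= gring_row_regular !mxE eqxx /=.
rewrite (inj_in_eq (can_in_inj (@gring_indexK _ G))) ?inE // eq_sym (negPf hg).
by rewrite mulr0.
Qed.

(** The coefficients can be read in the row of the identity of the regular representation. *)
Lemma zgroup_mx_inj c d : E c = E d -> c =1 d.
Proof.
move=> Ecd g; have := gring_row_zgroup c g.
by rewrite Ecd gring_row_zgroup => /intr_inj.
Qed.

(** The product of the integral group ring. *)
Definition zconv (c d : gT -> int) (g : gT) : int := \sum_h c h * d (h^-1 * g)%g.

Lemma zgroup_mxM c d : E c *m E d = E (zconv c d).
Proof.
rewrite !zgroup_mxE mulmx_suml.
transitivity (\sum_h \sum_g ((c h)%:~R * (d (h^-1 * g)%g)%:~R) *: R g : 'M[rat]__).
  apply: eq_bigr => h _; rewrite mulmx_sumr (reindex_inj (mulgI h^-1%g)) /=.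
  apply: eq_bigr => g _; rewrite -scalemxAl -scalemxAr scalerA -regularM.
  by rewrite mulKVg.
rewrite exchange_big /=; apply: eq_bigr => g _.
rewrite -scaler_suml /zconv rmorph_sum; congr (_ *: _).
by apply: eq_bigr => h _; rewrite rmorphM.
Qed.

Lemma zgroup_of_mx (A : 'M[rat]_#|G|) : (A \in QG)%MS ->
  exists m c, (0 < m)%N /\ m%:R *: A = E c.
Proof.
case/envelop_mxP => a ->.
pose m := (\prod_g `|denq (a g)|)%N.
have /fin_all_exists[c cP] : forall g, exists c : int, m%:R * a g = c%:~R.
  move=> g; rewrite /m (bigD1 g) //=; set m' := (\prod_(_ | _) _)%N.
  exists (numq (a g) * m'%:Z).
  rewrite intrM numqE natrM mulrC mulrA; congr (_ * _).
  by rewrite pmulrn abszE gtr0_norm ?denq_gt0.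
exists m, c; split.
  by rewrite prodn_gt0 // => g; rewrite absz_gt0 denq_eq0.
rewrite /zgroup_mx scaler_sumr; apply: eq_bigr => g _.
by rewrite scalerA cP.
Qed.

(** Any abelian group may be acted upon, not only a Jacobian: on the trivial module [int], the same
    operator identities yield augmentations. *)
Definition gact (V : zmodType) (rho : gT -> V -> V) (c : gT -> int) (z : V) : V :=
  \sum_g rho g z *~ c g.

Definition group_action (V : zmodType) (rho : gT -> V -> V) :=
  [/\ forall z, rho 1%g z = z, forall g h z, rho (g * h)%g z = rho g (rho h z) &
      forall g, {morph rho g : x y / x + y}].

Section Action.
Variables (V : zmodType) (rho : gT -> V -> V).
Hypothesis rhoP : group_action rho.

Lemma group_action0 g : rho g 0 = 0.
Proof. by case: rhoP => _ _ D; apply: (addrI (rho g 0)); rewrite -D !addr0. Qed.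

Lemma group_actionN g x : rho g (- x) = - rho g x.
Proof.
case: rhoP => _ _ D; apply: (addrI (rho g x)).
by rewrite -D !subrr group_action0.
Qed.

Lemma group_actionMn g x n : rho g (x *+ n) = rho g x *+ n.
Proof.
case: rhoP => _ _ D; elim: n => [|n IH]; first by rewrite !mulr0n group_action0.
by rewrite !mulrS D IH.
Qed.

Lemma group_actionMz g x n : rho g (x *~ n) = rho g x *~ n.
Proof.
by case: n => n; rewrite ?NegzE ?mulrNz ?group_actionN group_actionMn.
Qed.

Lemma group_action_sum g (I : Type) (l : seq I) (P : pred I) (F : I -> V) :
  rho g (\sum_(i <- l | P i) F i) = \sum_(i <- l | P i) rho g (F i).
Proof. by case: rhoP => _ _ D; apply: (big_morph _ (D g) (group_action0 g)). Qed.

Lemma gact_conv c d z : gact rho (zconv c d) z = gact rho c (gact rho d z).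
Proof.
case: rhoP => _ rM rD; rewrite /gact.
transitivity (\sum_h \sum_g rho g z *~ (c h * d (h^-1 * g)%g)).
  rewrite exchange_big /=; apply: eq_bigr => g _.
  have mz : {morph (fun n => rho g z *~ n) : x y / x + y} by move=> x y; rewrite mulrzDr.
  by rewrite /zconv (big_morph _ mz (mulr0z _)).
apply: eq_bigr => h _; rewrite group_action_sum.
have mz n : {morph (fun x : V => x *~ n) : x y / x + y} by move=> x y; rewrite mulrzDl.
rewrite (big_morph _ (mz (c h)) (mul0rz _ _)).
rewrite (reindex_inj (mulgI h)) /=; apply: eq_bigr => g _.
by rewrite mulKg group_actionMz rM mulrC mulrzA.
Qed.

End Action.

(** The bridge from rational identities to modules with torsion: integral elements equal in Q[G]
    have equal coefficients, hence act alike. *)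
Lemma gact_eq (V : zmodType) (rho : gT -> V -> V) c d z :
  E c = E d -> gact rho c z = gact rho d z.
Proof. by move=> /zgroup_mx_inj cd; apply: eq_bigr => g _; rewrite cd. Qed.

End GroupRing.

(** * Representations of the dihedral group that kill the rotation sum *)

Section Dihedral.
Variables (gT : finGroupType) (r s : gT) (p : nat).
Hypotheses (p_prime : prime p) (p_odd : odd p).
Hypothesis order_G : #|[set: gT]| = (2 * p)%N.
Hypothesis gen_G : [set: gT] = <<[set r; s]>>%g.
Hypotheses (rp : (r ^+ p = 1)%g) (s2 : (s ^+ 2 = 1)%g) (rs2 : ((r * s) ^+ 2 = 1)%g).

Local Notation G := [set: gT]%G.
Local Notation R := (regular_repr rat G).
Local Notation QG := (group_ring rat G).
Local Notation E := (@zgroup_mx gT).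

Let order_r : #[r]%g = p. Proof. exact: dihedral_order p_prime order_G gen_G rp s2 rs2. Qed.
Let cover g := dihedral_cover gen_G s2 rs2 g.
Let p_gt0 : (0 < p)%N. Proof. exact: prime_gt0. Qed.
Let pn0 : p%:R != 0 :> rat. Proof. by rewrite pnatr_eq0 -lt0n. Qed.
Let ss : (s * s = 1)%g. Proof. by rewrite -expg2. Qed.

Definition rot_sum : 'M[rat]_#|G| := \sum_(g in <[r]>%g) R g.
Local Notation N := rot_sum.

Lemma rot_sum_in : (N \in QG)%MS.
Proof.
rewrite /rot_sum linear_sum; apply: summx_sub => g _; exact: regular_in.
Qed.

Lemma rot_sumMl g : g \in <[r]>%g -> R g *m N = N.
Proof.
move=> gr; rewrite mulmx_sumr [RHS](reindex_inj (mulgI g)) /=.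
by apply: eq_big => [h|h _]; rewrite ?groupMl // regularM.
Qed.

Lemma rot_sumMr g : g \in <[r]>%g -> N *m R g = N.
Proof.
move=> gr; rewrite mulmx_suml [RHS](reindex_inj (mulIg g)) /=.
by apply: eq_big => [h|h _]; rewrite ?groupMr // regularM.
Qed.

Lemma rot_sum_s : R s *m N = N *m R s.
Proof.
rewrite mulmx_sumr mulmx_suml (reindex_inj (@conjg_inj _ s)) /=.
apply: eq_big => [h|h _].
  by rewrite memJ_norm // (dihedral_norm s2 rs2).
by rewrite -!regularM conjgE mulgA mulgV mul1g.
Qed.

Lemma rot_sumC A : (A \in QG)%MS -> N *m A = A *m N.
Proof.
case/envelop_mxP => a ->; rewrite mulmx_sumr mulmx_suml; apply: eq_bigr => g _.
rewrite -scalemxAr -scalemxAl; congr (_ *: _).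
have /orP[gr|gr] := cover g; first by rewrite rot_sumMl ?rot_sumMr.
have -> : R g = R (g * s)%g *m R s by rewrite -regularM -mulgA ss mulg1.
by rewrite mulmxA rot_sumMr // -mulmxA rot_sum_s mulmxA rot_sumMl.
Qed.

Lemma rot_sum_sqr : N *m N = p%:R *: N.
Proof.
rewrite {1}/rot_sum mulmx_suml (eq_bigr (fun=> N)) => [|g gr]; last exact: rot_sumMl.
by rewrite sumr_const scaler_nat -order_r.
Qed.

Section Representation.
Variables (n : nat) (W : mx_representation rat G n.+1).
Hypothesis WN : gring_op W N = 0.

Local Notation M := (W r).

Let WM g h : W (g * h)%g = W g *m W h. Proof. by rewrite repr_mxM ?inE. Qed.

Let horner_Phi : horner_mx M (prime_cyclotomic p) = 0.
Proof.
rewrite -WN rmorph_sum /rot_sum linear_sum sum_cycle order_r; apply: eq_bigr => i _.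
by rewrite rmorphXn /= horner_mx_X gring_opG ?inE // repr_mxX ?inE.
Qed.

(** As [p] is odd, [M ^+ 2 = 1] and [M ^+ p = 1] give [M = 1], and then [N] acts as [p], not as
    0. *)
Lemma rot_sqr_neq1 : M *m M != 1%:M.
Proof.
apply/eqP => MM; have Mp : M ^+ p = 1.
  by rewrite -repr_mxX ?inE // rp repr_mx1.
have M1 : M = 1.
  have M2 : M ^+ 2 = 1 by exact: MM.
  by rewrite -Mp -(odd_double_half p) p_odd exprD expr1 -mul2n exprM M2 expr1n mulr1.
have := WN; rewrite /rot_sum linear_sum sum_cycle order_r => /eqP.
rewrite (eq_bigr (fun=> 1%:M)) => [|i _]; last first.
  by rewrite /= gring_opG ?inE // repr_mxX ?inE // M1 expr1n.
rewrite sumr_const card_ord => /eqP/matrixP/(_ 0 0).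
by rewrite -scaler_nat !mxE eqxx mulr1 => /eqP; apply/negP.
Qed.

(** Since [s r s = r^-1], commutation would make the square of [M] trivial. *)
Lemma not_comm_rs : W s *m M != M *m W s.
Proof.
apply/eqP => C; case/eqP: rot_sqr_neq1.
have -> : M *m M = W (s * s)%g *m (M *m M) by rewrite ss repr_mx1 mul1mx.
by rewrite WM -mulmxA [W s *m (M *m M)]mulmxA C !mulmxA -!WM (dihedral_conj rs2) mulVg repr_mx1.
Qed.

(** [M] is a root of the irreducible [prime_cyclotomic p], so the polynomials in [M] form a copy of
    the cyclotomic field. *)
Lemma horner_rot_inv (h : {poly rat}) : (size h < p)%N -> h != 0 ->
  exists u, horner_mx M u *m horner_mx M h = 1%:M.
Proof.
move=> sh h0; have /Bezout_eq1_coprimepP[[u v] /= uv] := coprimep_prime_cyclotomic p_prime sh h0.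
exists u; have := congr1 (horner_mx M) uv.
by rewrite rmorphD !rmorphM rmorph1 /= horner_Phi mulr0 addr0.
Qed.

Lemma size_reduce_cyclotomic (h : {poly rat}) : (size h <= p)%N ->
  (size (h - h`_p.-1 *: prime_cyclotomic p)%R < p)%N.
Proof.
move=> sh; rewrite -[X in (_ < X)%N](prednK p_gt0) ltnS.
apply/leq_sizeP => j; rewrite leq_eqVlt => /predU1P[<-|pj].
  rewrite coefB coefZ coef_sum.
  rewrite (bigD1 (Ordinal (eq_ind_r (leq^~ p) (leqnn p) (prednK p_gt0)))) //=.
  rewrite coefXn eqxx big1 ?addr0 ?mulr1 ?subrr // => i.
  by rewrite -val_eqE /= coefXn eq_sym => /negPf->.
move: pj; rewrite prednK // => pj; rewrite coefB coefZ coef_sum big1 => [|i _].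
  by rewrite mulr0 subr0 nth_default // (leq_trans sh).
by rewrite coefXn gtn_eqF // (leq_trans (ltn_ord i)).
Qed.

Lemma horner_rot0 (h : {poly rat}) : (size h <= p)%N -> horner_mx M h = 0 ->
  h = h`_p.-1 *: prime_cyclotomic p.
Proof.
move=> sh h0; apply/eqP; rewrite -subr_eq0; apply/negPn/negP => hn0.
have [u] : exists u, horner_mx M u *m
    horner_mx M (h - h`_p.-1 *: prime_cyclotomic p) = 1%:M.
  by apply: horner_rot_inv => //; apply: size_reduce_cyclotomic.
rewrite rmorphB /= linearZ /= horner_Phi h0 scaler0 subr0 mulmx0 => /eqP.
by rewrite eq_sym oner_eq0.
Qed.

(* Q[G] / (N) is generated over the field Q(zeta_p) by 1 and s, and W(s) is not
   in the commutative image of that field. *)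
Lemma op_faithful A : (A \in QG)%MS -> N *m A = 0 -> gring_op W A = 0 -> A = 0.
Proof.
case/envelop_mxP => a AE NA WA.
have {}AE : A = \sum_(g in <[r]>%g) a g *: R g +
   \sum_(g in <[r]>%g) a (g * s)%g *: (R g *m R s).
  rewrite AE (eq_bigl xpredT) => [|g]; last by rewrite inE.
  rewrite (dihedral_sum p_prime p_odd order_G gen_G rp s2 rs2); congr (_ + _).
  by apply: eq_bigr => g _; rewrite regularM.
pose f := \poly_(i < p) a (r ^+ i)%g; pose h := \poly_(i < p) a (r ^+ i * s)%g.
have hE (q : nat -> rat) (B : 'M_n.+1) : horner_mx M (\poly_(i < p) q i) *m B =
    \sum_(i < p) q i *: (M ^+ i *m B).
  rewrite poly_def linear_sum mulmx_suml; apply: eq_bigr => i _.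
  by rewrite linearZ /= rmorphXn /= horner_mx_X scalemxAl.
rewrite AE linearD !linear_sum /= !sum_cycle order_r in WA.
have {}WA : horner_mx M f + horner_mx M h *m W s = 0.
  rewrite -WA -[horner_mx M f]mulmx1 !hE; congr (_ + _); apply: eq_bigr => i _.
    by rewrite mulmx1 linearZ /= gring_opG ?inE // repr_mxX ?inE.
  by rewrite linearZ /= -regularM gring_opG ?inE // WM repr_mxX ?inE.
pose h' := h - h`_p.-1 *: prime_cyclotomic p.
have hh' : horner_mx M h' = horner_mx M h.
  by rewrite rmorphB /= linearZ /= horner_Phi scaler0 subr0.
(* Were [h] nonzero at [M], its value would be invertible, and [W s] would be a polynomial in [M],
   hence commute with [M]. *)
have h0 : horner_mx M h = 0.
  apply/eqP/negPn/negP => hn0.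
  have h'0 : h' != 0 by apply: contraNneq hn0; rewrite -hh' => ->; rewrite rmorph0.
  have sh' : (size h' < p)%N.
    by apply: size_reduce_cyclotomic; apply: size_poly.
  have [u uh] := horner_rot_inv sh' h'0.
  case/eqP: not_comm_rs.
  have -> : W s = - (horner_mx M u *m horner_mx M f).
    rewrite -[LHS]mul1mx -uh -mulmxA hh'.
    by move/eqP: WA; rewrite addr_eq0 => /eqP->; rewrite mulmxN opprK.
  rewrite mulNmx mulmxN; congr (- _).
  have cM q : M *m horner_mx M q = horner_mx M q *m M by apply: comm_mx_horner.
  by rewrite mulmxA cM -!mulmxA cM.
have f0 : horner_mx M f = 0 by move: WA; rewrite h0 mul0mx addr0.
have coefP (q : nat -> rat) : horner_mx M (\poly_(i < p) q i) = 0 ->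
    forall i, (i < p)%N -> q i = q p.-1.
  move=> /(horner_rot0 (size_poly _ _))/polyP qE i ip.
  have := qE i; rewrite !coef_poly ip coefZ prednK // leqnn coef_sum.
  rewrite (bigD1 (Ordinal ip)) //= coefXn eqxx big1 ?addr0 ?mulr1 // => j.
  by rewrite -val_eqE /= coefXn eq_sym => /negPf->.
have aE g : g \in <[r]>%g -> a g = a (r ^+ p.-1)%g /\ a (g * s)%g = a (r ^+ p.-1 * s)%g.
  case/cyclePmin => i; rewrite order_r => ip ->.
  by rewrite (coefP _ f0 i ip) (coefP _ h0 i ip).
(* Both coefficient sequences are constant, so [A] is a combination of [N] and [N s], on which [N]
   acts as [p]. *)
have AN : A = a (r ^+ p.-1)%g *: N + a (r ^+ p.-1 * s)%g *: (N *m R s).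
  rewrite AE mulmx_suml !scaler_sumr.
  by congr (_ + _); apply: eq_bigr => g /aE[E1 E2]; rewrite ?E1 ?E2.
have : N *m A = p%:R *: A.
  rewrite AN mulmxDr -!scalemxAr mulmxA rot_sum_sqr -scalemxAl scalerDr !scalerA.
  by rewrite ![p%:R * _]mulrC.
by rewrite NA => /esym/eqP; rewrite scaler_eq0 (negPf pn0) => /eqP.
Qed.

End Representation.
End Dihedral.

(** * Idempotents of the rational group ring *)

Lemma mulmx_scale_mid (F : comNzRingType) m (A B X : 'M[F]_m) a :
  A *m (a *: X) *m B = a *: (A *m X *m B).
Proof. by rewrite -scalemxAr -scalemxAl. Qed.

Section IrreducibleImage.
Variables (F : fieldType) (gT : finGroupType) (G : {group gT}).
Local Notation FG := (group_ring F G).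
Local Notation R := (regular_repr F G).

Lemma group_ringD A B : (A \in FG)%MS -> (B \in FG)%MS -> (A + B \in FG)%MS.
Proof. by move=> RA RB; rewrite linearD /= addmx_sub. Qed.

Lemma group_ringZ a A : (A \in FG)%MS -> (a *: A \in FG)%MS.
Proof. by move=> RA; rewrite linearZ /= scalemx_sub. Qed.

Lemma group_ring1 : (1%:M \in FG)%MS.
Proof. by rewrite -(repr_mx1 R) envelop_mx_id. Qed.

Variables (n : nat) (W : mx_representation F G n.+1).
Hypothesis W_irr : mx_irreducible W.

(** The row [v] generates the whole irreducible module; if [B] killed all its translates, it would
    be 0. *)
Lemma irr_moves (v : 'rV[F]_n.+1) (B : 'M[F]_n.+1) : v != 0 -> B != 0 ->
  exists2 g, g \in G & v *m W g *m B != 0.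
Proof.
move=> v0 B0; apply/exists_inP; apply: contraNT B0; rewrite negb_exists_in.
move=> /forall_inP H; apply/eqP/row_matrixP => i; rewrite row0 -[B]mul1mx row_mul.
have [_ minW] := (mx_irrP W).1 W_irr.
have vn0 : cyclic_mx W v != 0.
  by apply/eqP => c0; have := cyclic_mx_id W v; rewrite c0 submx0 (negPf v0).
have : (row i 1%:M <= cyclic_mx W v)%MS.
  by apply: submx_full; apply: minW => //; apply: cyclic_mx_module.
case/cyclic_mxP => A /envelop_mxP[a ->] ->.
rewrite mulmx_sumr mulmx_suml big1 // => g gG.
rewrite -scalemxAr -scalemxAl; have /negPn/eqP -> := H g gG.
by rewrite scaler0.
Qed.

Lemma gring_op_horner (A : 'M[F]_#|G|) (q : {poly F}) : (A \in FG)%MS ->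
  exists2 B, (B \in FG)%MS & gring_op W B = horner_mx (gring_op W A) q.
Proof.
move=> RA; elim/poly_ind: q => [|q c [B RB BE]].
  by exists 0; rewrite ?linear0 ?sub0mx ?rmorph0.
exists (B *m A + c%:M).
  by apply: group_ringD; [apply: envelop_mxM | rewrite -scalemx1; apply/group_ringZ/group_ring1].
rewrite linearD /= gring_opM // BE rmorphD rmorphM /= horner_mx_X horner_mx_C.
by rewrite -[c%:M]scalemx1 linearZ /= gring_op1 scalemx1.
Qed.

(** By Cayley-Hamilton the inverse of an invertible matrix is a polynomial in it, hence again comes
    from the group ring. *)
Lemma gring_op_inv (A : 'M[F]_#|G|) : (A \in FG)%MS -> gring_op W A \in unitmx ->
  exists2 B, (B \in FG)%MS & gring_op W B *m gring_op W A = 1%:M.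
Proof.
set K := gring_op W A => RA uK.
pose chi := char_poly K; pose q := drop_poly 1 chi; pose c := chi`_0.
have chiE : chi = q * 'X + c%:P.
  apply/polyP => -[|i]; rewrite coefD coefMX coefC /= ?add0r ?addr0 //.
  by rewrite coef_drop_poly addn1.
have c0 : c != 0.
  rewrite /c char_poly_det mulf_neq0 ?expf_neq0 ?oppr_eq0 ?oner_eq0 //.
  by move: uK; rewrite unitmxE unitfE.
have [B RB BE] := gring_op_horner q RA.
exists (- c^-1 *: B); first exact: group_ringZ.
have : horner_mx K chi = 0 by exact: Cayley_Hamilton.
rewrite chiE rmorphD rmorphM /= horner_mx_X horner_mx_C -BE => /eqP.
rewrite addr_eq0 => /eqP BK; rewrite linearZ /= -scalemxAl.
have -> : gring_op W B *m gring_op W A = - c%:M by exact: BK.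
by rewrite scaleNr scalerN opprK scale_scalar_mx mulVf.
Qed.

End IrreducibleImage.

Section Primitive.
Variables (gT : finGroupType) (r s : gT) (p : nat).
Hypotheses (p_prime : prime p) (p_odd : odd p).
Hypothesis order_G : #|[set: gT]| = (2 * p)%N.
Hypothesis gen_G : [set: gT] = <<[set r; s]>>%g.
Hypotheses (rp : (r ^+ p = 1)%g) (s2 : (s ^+ 2 = 1)%g) (rs2 : ((r * s) ^+ 2 = 1)%g).

Local Notation G := [set: gT]%G.
Local Notation R := (regular_repr rat G).
Local Notation QG := (group_ring rat G).
Local Notation N := (rot_sum r).

Let cover g := dihedral_cover gen_G s2 rs2 g.
Let p_gt0 : (0 < p)%N. Proof. exact: prime_gt0. Qed.
Let pn0 : p%:R != 0 :> rat. Proof. by rewrite pnatr_eq0 -lt0n. Qed.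
Let ss : (s * s = 1)%g. Proof. by rewrite -expg2. Qed.
Let NC := rot_sumC gen_G s2 rs2.
Let NN := rot_sum_sqr p_prime order_G gen_G rp s2 rs2.
Let Rin := @regular_in gT.
Let RM := @regularM gT.

Definition rot_compl : 'M[rat]_#|G| := p%:R%:M - N.
Definition refl_sum : 'M[rat]_#|G| := 1%:M + R s.
Local Notation P := rot_compl.
Local Notation Sg := refl_sum.

(* (1 - N / p) (1 + s) / 2, a primitive idempotent of the factor of W *)
Definition refl_idem : 'M[rat]_#|G| := (2 * p)%:R^-1 *: (P *m Sg).
Local Notation es := refl_idem.

Lemma rot_compl_in : (P \in QG)%MS.
Proof.
rewrite /rot_compl -scalemx1 -scaleN1r; apply: group_ringD; apply: group_ringZ.
  exact: group_ring1.
exact: rot_sum_in.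
Qed.

Lemma rot_complC A : (A \in QG)%MS -> P *m A = A *m P.
Proof.
by move=> RA; rewrite mulmxBl mulmxBr NC // mul_scalar_mx mul_mx_scalar.
Qed.

Lemma rot_sum_compl : N *m P = 0.
Proof. by rewrite mulmxBr NN mul_mx_scalar subrr. Qed.

Lemma rot_compl_sqr : P *m P = p%:R *: P.
Proof. by rewrite {1}/rot_compl mulmxBl rot_sum_compl subr0 mul_scalar_mx. Qed.

Lemma refl_sum_in : (Sg \in QG)%MS.
Proof. by apply: group_ringD => //; apply: group_ring1. Qed.

Lemma refl_sumMl : R s *m Sg = Sg.
Proof. by rewrite mulmxDr mulmx1 -RM ss repr_mx1 addrC. Qed.

Lemma refl_sumMr : Sg *m R s = Sg.
Proof. by rewrite mulmxDl mul1mx -RM ss repr_mx1 addrC. Qed.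

Lemma refl_sum_rot g : g \in <[r]>%g -> Sg *m R g *m Sg = (R g + R g^-1%g) *m Sg.
Proof.
move=> gr; have gs : (g ^ s = g^-1)%g.
  case/cycleP: gr => i ->; rewrite conjXg conjgE (dihedral_sV s2) mulgA.
  by rewrite (dihedral_conj rs2) expgVn.
have sg : (s * g = g^-1 * s)%g by rewrite -gs conjgE (dihedral_sV s2) -!mulgA ss mulg1.
by rewrite mulmxDl mul1mx -RM sg RM !mulmxDl -!mulmxA refl_sumMl.
Qed.

Lemma refl_idem_in : (es \in QG)%MS.
Proof.
apply/group_ringZ/envelop_mxM; [exact: rot_compl_in | exact: refl_sum_in].
Qed.

Lemma rot_sum_refl_idem : N *m es = 0.
Proof. by rewrite -scalemxAr mulmxA rot_sum_compl mul0mx scaler0. Qed.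

Lemma refl_idemMl : R s *m es = es.
Proof. by rewrite -scalemxAr mulmxA -rot_complC // -mulmxA refl_sumMl. Qed.

Lemma refl_idemMr : es *m R s = es.
Proof. by rewrite -scalemxAl -mulmxA refl_sumMr. Qed.

Let p2n0 : (2 * p)%:R != 0 :> rat.
Proof. by rewrite natrM mulf_neq0 // pnatr_eq0. Qed.

(** Since [s g s = g^-1] for a rotation, compressing [g] by the idempotent averages [g] and its
    inverse. *)
Lemma refl_idem_rot g : g \in <[r]>%g ->
  es *m R g *m es = 2^-1 *: (R g + R g^-1%g) *m es.
Proof.
move=> gr; rewrite -scalemxAr -!scalemxAl -scalemxAr !scalerA.
have -> : P *m Sg *m R g *m (P *m Sg) = p%:R *: ((R g + R g^-1%g) *m (P *m Sg)).
  rewrite !mulmxA -[_ *m R g *m P]mulmxA -rot_complC // !mulmxA.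
  rewrite -[_ *m Sg *m P]mulmxA -rot_complC ?refl_sum_in // mulmxA rot_compl_sqr.
  rewrite -!scalemxAl -!mulmxA; congr (_ *: _).
  rewrite [Sg *m _]mulmxA refl_sum_rot // !mulmxA; congr (_ *m _).
  by apply: rot_complC; apply: group_ringD.
rewrite scalerA; congr (_ *: _); rewrite natrM; field.
by rewrite pn0.
Qed.

Lemma refl_idem_sqr : es *m es = es.
Proof.
have := refl_idem_rot (group1 _); rewrite invg1 repr_mx1 mulmx1 => ->.
by rewrite -mulr2n -scaler_nat scalerA mulVf // scale1r mul1mx.
Qed.

(** Compression by [es] leaves combinations of the [g + g^-1] with [g] a rotation, which are
    central; this is what makes Schur's lemma applicable to [K]. *)
Lemma refl_idem_scalar A : (A \in QG)%MS -> exists K, [/\ (K \in QG)%MS,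
  forall g, R g *m K = K *m R g & es *m A *m es = K *m es].
Proof.
case/envelop_mxP => a ->.
(* A reflection [g] is the rotation [g s] times [s], and [s] is absorbed by [es]. *)
pose rot g := if g \in <[r]>%g then g else (g * s)%g.
have rotr g : rot g \in <[r]>%g by rewrite /rot; have := cover g; case: ifP.
pose K g := R (rot g) + R (rot g)^-1%g.
have Kin g : (K g \in QG)%MS by apply: group_ringD.
have Kr h g : h \in <[r]>%g -> R h *m K g = K g *m R h.
  move=> hr; rewrite mulmxDl mulmxDr -!RM.
  have/centP cr : h \in 'C(<[r]>)%g.
    by apply: (fintype.subsetP (cycle_abelian r)).
  by rewrite !cr ?groupV.
have Ks g : R s *m K g = K g *m R s.
  have gs : ((rot g) ^ s = (rot g)^-1)%g.
    case/cycleP: (rotr g) => i ->; rewrite conjXg conjgE (dihedral_sV s2) mulgA.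
    by rewrite (dihedral_conj rs2) expgVn.
  have sg : (s * rot g = (rot g)^-1 * s)%g.
    by rewrite -gs conjgE (dihedral_sV s2) -!mulgA ss mulg1.
  have sg' : (s * (rot g)^-1 = rot g * s)%g.
    by apply: (mulIg (rot g)); rewrite mulgKV -mulgA sg mulKVg.
  by rewrite mulmxDl mulmxDr -!RM sg sg' addrC.
have KR h g : R h *m K g = K g *m R h.
  have /orP[hr|hr] := cover h; first exact: Kr.
  have -> : R h = R (h * s)%g *m R s by rewrite -RM -mulgA ss mulg1.
  by rewrite -mulmxA Ks mulmxA Kr // mulmxA.
exists (\sum_(g in G) (a g / 2) *: K g); split.
- rewrite linear_sum; apply: summx_sub => g _; exact: group_ringZ.
- move=> h; rewrite mulmx_sumr mulmx_suml; apply: eq_bigr => g _.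
  by rewrite -scalemxAr -scalemxAl KR.
rewrite mulmx_sumr !mulmx_suml; apply: eq_bigr => g _.
have KE : es *m R (rot g) *m es = 2^-1 *: K g *m es by rewrite refl_idem_rot.
rewrite mulmx_scale_mid.
have <- : es *m R (rot g) *m es = es *m R g *m es.
  rewrite /rot; case: (boolP (g \in <[r]>%g)) => // _.
  have -> : es *m R (g * s)%g *m es = es *m R g *m (R s *m es) by rewrite RM !mulmxA.
  by rewrite refl_idemMl.
by rewrite KE scalemxAl scalerA.
Qed.

Variables (sQ : irrType rat G) (n : nat) (W : mx_representation rat G n.+1).
Hypothesis W_irr : mx_irreducible W.
Hypothesis WN : gring_op W N = 0.
Variable e : 'M[rat]_#|G|.
Hypothesis eP : primitive_idempotent_of sQ W e.

Local Notation Q := (Wedderburn_subring (irr_comp sQ W)).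
Let charG : pgroup [pchar rat]^' G.
Proof. by apply/pgroupP => q _ _; rewrite inE /= pchar_num. Qed.

Lemma component_sub A : (A \in Q)%MS -> (A \in QG)%MS.
Proof.
move=> QA; rewrite -(Wedderburn_sum_pchar sQ charG).
by apply: submx_trans QA _; apply: (sumsmx_sup (irr_comp sQ W)).
Qed.

Lemma component_op_inj A : (A \in Q)%MS -> gring_op W A = 0 -> A = 0.
Proof.
move=> QA A0; apply/eqP; rewrite -mxvec_eq0 -submx0.
rewrite -(ker_irr_comp_op_pchar sQ charG W_irr) sub_capmx QA /=.
by apply/sub_kermxP; rewrite mul_vec_lin /= A0 linear0.
Qed.

Lemma component_mulMl A B : (A \in QG)%MS -> (B \in Q)%MS -> (A *m B \in Q)%MS.
Proof.
by have /andP[/mulsmx_subP H _] := Wedderburn_ideal (irr_comp sQ W); apply: H.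
Qed.

Let Qe : (e \in Q)%MS. Proof. by case: eP. Qed.
Let Re : (e \in QG)%MS. Proof. exact: component_sub. Qed.
Let ee : e *m e = e. Proof. by case: eP. Qed.

Let faithful := op_faithful p_prime p_odd order_G gen_G rp s2 rs2 WN.

(* For t in es Q e and t' in e Q es with t t' = es, the product t' t is an
   idempotent below e, hence equal to e. *)
Lemma primitive_conjugate : exists t t' : 'M[rat]_#|G|,
  [/\ (t \in QG)%MS, (t' \in QG)%MS, es *m t = t /\ t *m e = t,
      e *m t' = t' /\ t' *m es = t' & t *m t' = es /\ t' *m t = e].
Proof.
have We0 : gring_op W e != 0.
  apply/eqP => We; have [_ e0 _ _] := eP; case/eqP: e0; exact: component_op_inj.
(* If [es] acted as 0, it would be 0 by faithfulness and [s] would act as -1; then [(r s)^2 = 1]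
   would make the square of [W r] trivial. *)
have Wes0 : gring_op W es != 0.
  apply/eqP => Wes; have es0 := faithful refl_idem_in rot_sum_refl_idem Wes.
  have := rot_sqr_neq1 p_prime p_odd order_G gen_G rp s2 rs2 WN; apply/negP.
  rewrite negbK; apply/eqP.
  have PS : P *m Sg = 0.
    by apply/eqP; move/eqP: es0; rewrite scaler_eq0 invr_eq0 (negPf p2n0).
  have Ws : W s = - 1%:M.
    have := congr1 (gring_op W) PS; rewrite gring_opM ?refl_sum_in // linear0.
    rewrite linearB /= WN subr0 -[p%:R%:M]scalemx1 linearZ /= gring_op1 -scalemxAl mul1mx.
    rewrite linearD /= gring_op1 gring_opG ?inE // => /eqP.
    rewrite scaler_eq0 (negPf pn0) /= addrC addr_eq0 => /eqP //.
  have : W (r * s)%g *m W (r * s)%g = 1%:M.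
    by rewrite -repr_mxM ?inE // -expg2 rs2 repr_mx1.
  by rewrite repr_mxM ?inE // Ws mulmxN mulmx1 mulNmx mulmxN opprK.
have [i v0] : exists i, row i (gring_op W es) != 0.
  by apply/existsP; apply: contraNT Wes0 => /existsPn H; apply/eqP/row_matrixP => i;
     rewrite row0; apply/eqP/negPn/H.
(* [g] and [h] are chosen to make [es g e h es] nonzero; it equals [K es] with [K] central, hence
   invertible on [W]. *)
have [g _ vg] := irr_moves W_irr v0 We0.
have [h _ vh] := irr_moves W_irr vg Wes0.
have Rgeh := envelop_mxM (envelop_mxM (Rin g) Re) (Rin h).
have [K [RK KC KE]] := refl_idem_scalar Rgeh.
have WK0 : gring_op W K != 0.
  apply: contraNneq vh => WK0.
  have : gring_op W (es *m (R g *m e *m R h) *m es) = 0.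
    by rewrite KE gring_opM ?refl_idem_in // WK0 mul0mx.
  rewrite !gring_opM ?refl_idem_in ?Rgeh ?Re ?Rin //.
  rewrite !gring_opG ?inE // => /(congr1 (row i)); rewrite row0 !row_mul.
  by rewrite !mulmxA => ->.
have uK : gring_op W K \in unitmx.
  apply: (mx_Schur W_irr) => //; apply/centgmxP => x _.
  by rewrite -(gring_opG W) ?inE // -!gring_opM // KC.
have [K' RK' K'K] := gring_op_inv RK uK.
(* [K'] inverts [K] on [W], which normalizes [t t'] to [es]. *)
pose t := es *m R g *m e; pose t' := e *m (K' *m R h *m es).
have Rt : (t \in QG)%MS by exact: (envelop_mxM (envelop_mxM refl_idem_in (Rin g)) Re).
have Rt' : (t' \in QG)%MS.
  exact: (envelop_mxM Re (envelop_mxM (envelop_mxM RK' (Rin h)) refl_idem_in)).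
have est : es *m t = t by rewrite /t !mulmxA refl_idem_sqr.
have et' : e *m t' = t' by rewrite /t' mulmxA ee.
have te : t *m e = t by rewrite /t -mulmxA ee.
have t'es : t' *m es = t' by rewrite /t' -!mulmxA refl_idem_sqr.
have K'C : forall x, W x *m gring_op W K' = gring_op W K' *m W x.
  move=> x; have KW : W x *m gring_op W K = gring_op W K *m W x.
    by rewrite -(gring_opG W) ?inE // -!gring_opM // KC.
  have KK' := mulmx1C K'K.
  by rewrite -[LHS]mul1mx -K'K -mulmxA [X in _ *m X]mulmxA -KW -mulmxA KK' mulmx1.
have tt' : t *m t' = es.
  apply/eqP; rewrite -subr_eq0; apply/eqP; apply: faithful.
  - by apply: group_ringD; [apply: envelop_mxM | rewrite -scaleN1r; apply/group_ringZ/refl_idem_in].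
  - by rewrite mulmxBr !mulmxA rot_sum_refl_idem !mul0mx subrr.
  rewrite linearB /= /t /t'.
  have -> : es *m R g *m e *m (e *m (K' *m R h *m es)) = es *m R g *m e *m K' *m R h *m es.
    by rewrite !mulmxA -[_ *m e *m e]mulmxA ee.
  have WeC : gring_op W e *m gring_op W K' = gring_op W K' *m gring_op W e.
    case/envelop_mxP: Re => a ->; rewrite linear_sum mulmx_sumr mulmx_suml.
    by apply: eq_bigr => x _; rewrite linearZ /= gring_opG ?inE // -scalemxAl -scalemxAr K'C.
  have WesC : gring_op W es *m gring_op W K' = gring_op W K' *m gring_op W es.
    case/envelop_mxP: refl_idem_in => a ->; rewrite linear_sum mulmx_sumr mulmx_suml.
    by apply: eq_bigr => x _; rewrite linearZ /= gring_opG ?inE // -scalemxAl -scalemxAr K'C.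
  have := congr1 (gring_op W) KE.
  rewrite !gring_opM ?refl_idem_in ?Rgeh ?Re ?RK' ?Rin //.
  rewrite !gring_opG ?inE // => KE'.
  rewrite -[_ *m gring_op W e *m _]mulmxA WeC mulmxA -[_ *m W g *m _]mulmxA K'C mulmxA WesC.
  have -> : gring_op W K' *m gring_op W es *m W g *m gring_op W e *m W h *m gring_op W es =
    gring_op W K' *m (gring_op W es *m (W g *m gring_op W e *m W h) *m gring_op W es).
    by rewrite !mulmxA.
  by rewrite KE' mulmxA K'K mul1mx subrr.
clearbody t t'.
exists t, t'; split=> //; split=> //.
have [_ _ _ prim] := eP.
pose f := t' *m t.
have ff : f *m f = f by rewrite /f mulmxA -[t' *m t *m t']mulmxA tt' t'es.
have Qf : (f \in Q)%MS by rewrite /f -te mulmxA; apply: component_mulMl => //; apply: envelop_mxM.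
have ef : e *m f = f by rewrite /f mulmxA et'.
have fe : f *m e = f by rewrite /f -mulmxA te.
(* Primitivity is applied to the splitting of [e] into [f] and [e - f]; [f = 0] is excluded because
   [es = t f t'] acts nontrivially. *)
have [f0|/eqP] : f = 0 \/ e - f = 0; last by rewrite subr_eq0 => /eqP.
  apply: prim => //.
  - by rewrite linearB /= addmx_sub // -scaleN1r scalemx_sub.
  - by rewrite mulmxBl !mulmxBr ee ef fe ff subrr subr0.
  - by rewrite mulmxBr fe ff subrr.
  - by rewrite mulmxBl ef ff subrr.
  - by rewrite addrCA subrr addr0.
have : gring_op W es = 0.
  have -> : es = t *m f *m t'.
    by rewrite /f !mulmxA tt' est tt'.
  by rewrite f0 mulmx0 mul0mx linear0.
by move/eqP; rewrite (negPf Wes0).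
Qed.

End Primitive.

Lemma zgroup_mxD (gT : finGroupType) (c d : gT -> int) :
  zgroup_mx (fun g => c g + d g) = zgroup_mx c + zgroup_mx d.
Proof.
rewrite !zgroup_mxE -big_split; apply: eq_bigr => g _.
by rewrite intrD scalerDl.
Qed.

Lemma zgroup_mxMz (gT : finGroupType) (c : gT -> int) (a : int) :
  zgroup_mx (fun g => c g * a) = a%:~R *: zgroup_mx c.
Proof.
rewrite !zgroup_mxE scaler_sumr; apply: eq_bigr => g _.
by rewrite scalerA intrM mulrC.
Qed.

Lemma zgroup_mx_mem (gT : finGroupType) (A : {set gT}) :
  zgroup_mx (fun g => (g \in A)%:R) = \sum_(g in A) regular_repr rat [set: gT]%G g.
Proof.
rewrite zgroup_mxE [RHS]big_mkcond; apply: eq_bigr => g _.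
by case: (g \in A); rewrite ?scale1r ?scale0r.
Qed.

Section GroupRingAction.
Variables (gT : finGroupType) (V : zmodType) (rho : gT -> V -> V).

Lemma gactD_fun (c d : gT -> int) z :
  gact rho (fun g => c g + d g) z = gact rho c z + gact rho d z.
Proof. by rewrite /gact -big_split; apply: eq_bigr => g _; rewrite mulrzDr. Qed.

Lemma gactMz_fun (c : gT -> int) a z : gact rho (fun g => c g * a) z = gact rho c z *~ a.
Proof.
rewrite /gact; have mz : {morph (fun x : V => x *~ a) : x y / x + y}.
  by move=> x y; rewrite mulrzDl.
rewrite (big_morph _ mz (mul0rz _ _)); apply: eq_bigr => g _.
by rewrite mulrzA.
Qed.

Lemma gact_mem (A : {set gT}) z :
  gact rho (fun g => (g \in A)%:R) z = \sum_(g in A) rho g z.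
Proof.
rewrite /gact [RHS]big_mkcond; apply: eq_bigr => g _.
by case: (g \in A); rewrite ?mulr1z ?mulr0z.
Qed.

End GroupRingAction.

(** * Rotations in irreducible representations of degree 2 *)

Section RotationNontrivial.
Variables (F : numFieldType) (gT : finGroupType) (r s : gT) (p : nat).
Hypotheses (p_prime : prime p) (p_odd : odd p).
Hypothesis order_G : #|[set: gT]| = (2 * p)%N.
Hypothesis gen_G : [set: gT] = <<[set r; s]>>%g.
Hypotheses (rp : (r ^+ p = 1)%g) (s2 : (s ^+ 2 = 1)%g) (rs2 : ((r * s) ^+ 2 = 1)%g).
Local Notation G := [set: gT]%G.

(** If [r] acts trivially, the group acts through the involution [s]; then [v + v s] or, when this
    vanishes, [v] itself spans a stable line, too small for degree 2. *)
Lemma irr_degree2_rot d (rG : mx_representation F G d) :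
  mx_irreducible rG -> d = 2%N -> rG r != 1%:M.
Proof.
move=> rG_irr d2; apply/eqP => r1.
have rot1 g : g \in <[r]>%g -> rG g = 1%:M.
  case/cycleP => i ->; elim: i => [|i IH]; first by rewrite expg0 repr_mx1.
  by rewrite expgSr repr_mxM ?inE // IH r1 mul1mx.
have eig (v : 'rV[F]_d) a : v != 0 -> v *m rG s = a *: v -> False.
  move=> v0 vs; have [_ minG] := (mx_irrP rG).1 rG_irr.
  have modv : mxmodule rG v.
    apply/mxmoduleP => g _; have /orP[gr|gr] := dihedral_cover gen_G s2 rs2 g.
      by rewrite rot1 // mulmx1.
    have -> : g = (g * s * s)%g by rewrite -mulgA -expg2 s2 mulg1.
    by rewrite repr_mxM ?inE // rot1 // mul1mx vs scalemx_sub.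
  have modg : mxmodule rG <<v>>%MS by rewrite (eqmx_module _ (genmxE v)).
  have := minG _ modg; rewrite -mxrank_eq0 mxrank_gen mxrank_eq0.
  move=> /(_ v0); rewrite /row_full mxrank_gen => /eqP rv.
  by have := rank_leq_row v; rewrite rv d2.
have [v v0] : exists v : 'rV[F]_d, v != 0.
  exists (const_mx 1); apply/eqP => /rowP.
  have i : 'I_d by rewrite d2; exact: ord0.
  by move/(_ i); rewrite !mxE => /eqP; rewrite oner_eq0.
have ss : rG s *m rG s = 1%:M by rewrite -repr_mxM ?inE // -expg2 s2 repr_mx1.
have [vs0|vs0] := eqVneq (v + v *m rG s) 0.
  apply: (eig v (-1) v0); rewrite scaleN1r; apply/eqP.
  by rewrite -addr_eq0 addrC vs0.
apply: (eig _ 1 vs0); rewrite scale1r mulmxDl -mulmxA ss mulmx1.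
by rewrite addrC.
Qed.

(** The sum acts by diagonal blocks, so it is trivial on [r] only if its first summand is; positive
    degree ensures that there is one. *)
Lemma sum_irr_rot (sC : irrType F G) d : (0 < d)%N ->
  (0 < rdegree (sum_irr_of_degree sC d))%N ->
  exists2 i : sC, irr_degree i == d &
    (sum_irr_of_degree sC d r = 1%:M -> irr_repr i r = 1%:M).
Proof.
move=> d0; rewrite /sum_irr_of_degree.
elim: (index_enum _) => [|i l IH]; first by rewrite big_nil.
rewrite big_cons; case: ifP => [id _|_ /IH //].
exists i => //=; rewrite (scalar_mx_block (irr_degree i)).
by case/eq_block_mx.
Qed.

Variables (sC : irrType F G) (n : nat) (W : mx_representation rat G n.+1).
Hypothesis W_irr : mx_irreducible W.
Hypothesis W_complex : mx_rsim (extend_scalars F W) (sum_irr_of_degree sC 2).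

(** [N] is central, so by Schur it acts as 0 or invertibly; in the second case [r N = N] forces
    [W r = 1], which passes to the constituents of degree 2 over [F]. *)
Lemma op_rot_sum : gring_op W (rot_sum r) = 0.
Proof.
apply/eqP/negPn/negP => WN0.
have RN := rot_sum_in r.
have uN : gring_op W (rot_sum r) \in unitmx.
  apply: (mx_Schur W_irr) => //; apply/centgmxP => x _.
  rewrite -(gring_opG W) ?inE // -!gring_opM ?regular_in //.
  by rewrite (rot_sumC gen_G s2 rs2) ?regular_in.
have Wr : W r = 1%:M.
  have := congr1 (gring_op W) (rot_sumMl (cycle_id r)).
  rewrite gring_opM // gring_opG ?inE // => E.
  by rewrite -[LHS]mulmx1 -(mulmxV uN) mulmxA E.
have Er : extend_scalars F W r = 1%:M by rewrite /= /map_repr_mx Wr map_mx1.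
have [B degE freeB homB] := W_complex.
have [B' _ freeB' homB'] := mx_rsim_sym W_complex.
have Sr : sum_irr_of_degree sC 2 r = 1%:M.
  have := homB' r (finset.in_setT r); rewrite Er mulmx1 => E.
  have /row_freeP[B'' B'B''] := freeB'.
  by rewrite -[LHS]mulmx1 -B'B'' mulmxA E.
have [i /eqP id ir] := @sum_irr_rot sC 2 isT (eq_ind _ (fun m => 0 < m)%N (ltn0Sn n) _ degE).
have := irr_degree2_rot (socle_irr i) id.
by rewrite -[socle_repr i r]/(irr_repr i r) (ir Sr) eqxx.
Qed.

End RotationNontrivial.

Definition rot_act (gT : finGroupType) (r : gT) (V : zmodType)
  (rho : gT -> V -> V) (z : V) : V := \sum_(g in <[r]>%g) rho g z.

(** * Integral multiples of the primitive idempotents *)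

Section Operators.
Variables (gT : finGroupType) (r s : gT) (p : nat).
Hypotheses (p_prime : prime p) (p_odd : odd p).
Hypothesis order_G : #|[set: gT]| = (2 * p)%N.
Hypothesis gen_G : [set: gT] = <<[set r; s]>>%g.
Hypotheses (rp : (r ^+ p = 1)%g) (s2 : (s ^+ 2 = 1)%g) (rs2 : ((r * s) ^+ 2 = 1)%g).
Local Notation G := [set: gT]%G.
Local Notation R := (regular_repr rat G).
Local Notation QG := (group_ring rat G).
Local Notation N := (rot_sum r).
Local Notation E := (@zgroup_mx gT).
Variable sQ : irrType rat G.

Section SignRepresentation.
Variables (U' : mx_representation rat G 1).
Hypothesis U'_nontrivial : exists g, U' g <> 1%:M.
Variables (e : 'M[rat]_#|G|) (m : nat) (c : gT -> int).
Hypothesis eP : primitive_idempotent_of sQ U' e.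
Hypothesis cP : integral_multiple e m c.

Lemma sign_repr_r : U' r = 1%:M.
Proof.
have xp : (U' r 0 0) ^+ p = 1.
  have := repr_mxX U' p (finset.in_setT r); rewrite rp repr_mx1 [U' r]mx11_scalar.
  by rewrite -rmorphXn => /matrixP/(_ 0 0); rewrite !mxE eqxx !mulr1n => <-.
rewrite [U' r]mx11_scalar; congr (_%:M).
have x0 : 0 <= U' r 0 0.
  rewrite leNgt; apply/negP => x0.
  have : (U' r 0 0) ^+ p < 0 by rewrite exprn_odd_lt0.
  by rewrite xp ltr10.
by apply/eqP; rewrite -(@pexpr_eq1 _ _ p) ?prime_gt0 // xp.
Qed.

Lemma sign_repr_s : U' s = - 1%:M.
Proof.
have xs : (U' s 0 0) ^+ 2 = 1.
  have := repr_mxX U' 2 (finset.in_setT s); rewrite s2 repr_mx1 [U' s]mx11_scalar.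
  by rewrite -rmorphXn => /matrixP/(_ 0 0); rewrite !mxE eqxx !mulr1n => <-.
have /orP[/eqP x1|/eqP x1] : (U' s 0 0 == 1) || (U' s 0 0 == -1) by rewrite -sqrf_eq1 xs.
  have [g] := U'_nontrivial; case.
  have rot1 h : h \in <[r]>%g -> U' h = 1%:M.
    case/cycleP => i ->; elim: i => [|i IH]; first by rewrite expg0 repr_mx1.
    by rewrite expgSr repr_mxM ?inE // IH sign_repr_r mul1mx.
  have /orP[/rot1 //|/rot1 E] := dihedral_cover gen_G s2 rs2 g.
  have -> : g = (g * s * s)%g by rewrite -mulgA -expg2 s2 mulg1.
  by rewrite repr_mxM ?inE // E mul1mx [U' s]mx11_scalar x1.
by rewrite [U' s]mx11_scalar x1 -[1%:M]scalemx1 -scaleN1r scalemx1 scale_scalar_mx mulr1.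
Qed.

(** In the factor of [U'], [r e = e] and [s e = - e]: the coefficients of [c] are constant on
    rotations and take the opposite value on reflections, so [c] is [c 1] times [N - N s]. *)
Lemma sign_operator : exists2 a : int, a != 0 &
  forall (V : zmodType) (rho : gT -> V -> V), group_action rho -> forall z,
    gact rho c z = (rot_act r rho z - rot_act r rho (rho s z)) *~ a.
Proof.
have U'_irr : mx_irreducible U' by apply/mx_abs_irrW/linear_mx_abs_irr.
have [Qe e0 _ _] := eP; have [m0 mE] := cP.
have {}mE : m%:R *: e = E c by exact: mE.
have Re := component_sub Qe.
have act g a : U' g = a%:M -> R g *m E c = a *: E c.
  move=> Ug; rewrite -mE -scalemxAr scalerA [a * _]mulrC -scalerA; congr (_ *: _).
  apply/eqP; rewrite -subr_eq0; apply/eqP.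
  have QD : (R g *m e - a *: e \in Wedderburn_subring (irr_comp sQ U'))%MS.
    rewrite linearB linearZ /= addmx_sub //; last by rewrite -scaleN1r !scalemx_sub.
    exact: component_mulMl (regular_in g) Qe.
  apply: (component_op_inj U'_irr QD).
  rewrite linearB linearZ /= gring_opM // gring_opG ?inE // Ug mul_scalar_mx.
  by rewrite subrr.
have RE g : (R g *m E c = E (fun x => c (g^-1 * x)%g)).
  rewrite !zgroup_mxE mulmx_sumr [RHS](reindex_inj (mulgI g)) /=.
  by apply: eq_bigr => x _; rewrite -scalemxAr -regularM mulKg.
have cr g x : g \in <[r]>%g -> c (g * x)%g = c x.
  move=> gr; have Ug : U' g^-1%g = 1%:M.
    have : g^-1%g \in <[r]>%g by rewrite groupV.
    case/cycleP => i ->; elim: i => [|i IH]; first by rewrite expg0 repr_mx1.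
    by rewrite expgSr repr_mxM ?inE // IH sign_repr_r mul1mx.
  have := act _ _ Ug; rewrite RE // scale1r => /zgroup_mx_inj/(_ x).
  by rewrite invgK.
have cs : c s = - c 1%g.
  have sE : U' s = (-1)%:M by rewrite sign_repr_s -[LHS]scaleN1r scale_scalar_mx mulr1.
  have := act _ _ sE; rewrite RE // => ME.
  have : E (fun x => c (s^-1 * x)%g) = E (fun x => c x * -1) by rewrite ME zgroup_mxMz.
  by move=> /zgroup_mx_inj/(_ s); rewrite mulVg mulrN1 => ->; rewrite opprK.
exists (c 1%g).
  apply: contraNneq e0 => c1.
  have c0 g : c g = 0.
    have /orP[gr|gr] := dihedral_cover gen_G s2 rs2 g.
      by rewrite -[g]mulg1 cr.
    have -> : g = (g * s * s)%g by rewrite -mulgA -expg2 s2 mulg1.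
    by rewrite cr // cs c1 oppr0.
  have : m%:R *: e = 0.
    rewrite mE zgroup_mxE big1 // => g _; by rewrite c0 scale0r.
  by move/eqP; rewrite scaler_eq0 pnatr_eq0 (gtn_eqF m0).
move=> V rho [_ rM _] z; rewrite /gact (dihedral_sum p_prime p_odd order_G gen_G rp s2 rs2).
rewrite mulrzBl; congr (_ + _).
  have mz : {morph (fun x : V => x *~ c 1%g) : x y / x + y}.
    by move=> x y; rewrite mulrzDl.
  rewrite /rot_act (big_morph _ mz (mul0rz _ _)); apply: eq_bigr => g gr.
  by rewrite -[in LHS](mulg1 g) cr // mulg1.
have mz : {morph (fun x : V => - (x *~ c 1%g)) : x y / x + y}.
  by move=> x y; rewrite mulrzDl opprD.
have mz0 : - ((0 : V) *~ c 1%g) = 0 by rewrite mul0rz oppr0.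
rewrite /rot_act (big_morph _ mz mz0); apply: eq_bigr => g gr.
by rewrite cr // cs mulrNz rM.
Qed.

End SignRepresentation.

Section TwoDimensional.
Variables (n : nat) (W : mx_representation rat G n.+1).
Hypothesis W_irr : mx_irreducible W.
Hypothesis WN : gring_op W N = 0.
Variables (e : 'M[rat]_#|G|) (m : nat) (c : gT -> int).
Hypothesis eP : primitive_idempotent_of sQ W e.
Hypothesis cP : integral_multiple e m c.

Let ss : (s * s = 1)%g. Proof. by rewrite -expg2. Qed.
Let p_gt0 : (0 < p)%N. Proof. exact: prime_gt0. Qed.

(** [y] and [x] are integral multiples of the conjugating pair [t], [t']. Quantifying over all
    modules lets the same constants serve for the Jacobian and for the trivial module [int]. *)
Lemma conjugate_operators : exists (x y : gT -> int) (a b : int),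
  [/\ a != 0, b != 0, \sum_g y g = 0 &
  forall (V : zmodType) (rho : gT -> V -> V), group_action rho -> forall z,
    [/\ rho s (gact rho y z) = gact rho y z, rot_act r rho (gact rho y z) = 0,
        gact rho x (rho s z) = gact rho x z & gact rho x (rot_act r rho z) = 0] /\
    [/\ gact rho x (gact rho y (gact rho c z)) = gact rho c z *~ a,
        gact rho y (gact rho c (gact rho x z)) =
          ((z + rho s z) *+ p - rot_act r rho (z + rho s z)) *~ b &
        gact rho c (gact rho c z) = gact rho c z *+ m]].
Proof.
have [t [t' [Rt Rt' [est te] [et' t'es] [tt' t't]]]] :=
  primitive_conjugate p_prime p_odd order_G gen_G rp s2 rs2 W_irr WN eP.
set es := refl_idem r s p in est t'es tt'.
have [_ _ ee _] := eP; have [m0 mE] := cP.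
have {}mE : m%:R *: e = E c by exact: mE.
have [n1 [y0 [n10 y0E]]] := zgroup_of_mx Rt.
have [n2 [x [n20 xE]]] := zgroup_of_mx Rt'.
(* The factor [2 p] cancels the denominator of [refl_idem]. *)
pose y g := y0 g * (2 * p)%:Z.
have p2n0 : (2 * p)%:R != 0 :> rat by rewrite natrM mulf_neq0 // pnatr_eq0 -lt0n.
have yE : E y = ((2 * p)%:R * n1%:R) *: t.
  by rewrite zgroup_mxMz -y0E scalerA pmulrn.
have sE : E (fun g => (g \in [set s])%:R) = R s by rewrite zgroup_mx_mem big_set1.
have NE : E (fun g => (g \in <[r]>%g)%:R) = N by rewrite zgroup_mx_mem.
have gs (V : zmodType) (rho : gT -> V -> V) z :
  gact rho (fun g => (g \in [set s])%:R) z = rho s z by rewrite gact_mem big_set1.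
have gN (V : zmodType) (rho : gT -> V -> V) z :
  gact rho (fun g => (g \in <[r]>%g)%:R) z = rot_act r rho z by rewrite gact_mem.
have Nt : N *m t = 0.
  by rewrite -est mulmxA (rot_sum_refl_idem p_prime order_G gen_G rp s2 rs2) mul0mx.
have t'N : t' *m N = 0.
  rewrite -t'es -mulmxA -(rot_sumC gen_G s2 rs2) ?refl_idem_in //.
  by rewrite (rot_sum_refl_idem p_prime order_G gen_G rp s2 rs2) mulmx0.
have N0 (V : zmodType) (rho : gT -> V -> V) z : group_action rho ->
    rot_act r rho (gact rho y z) = 0.
  move=> rhoP; rewrite -gN -gact_conv // (@gact_eq _ _ _ _ (fun=> 0)).
    by rewrite /gact big1 // => g _; rewrite mulr0z.
  rewrite -zgroup_mxM NE yE -scalemxAr Nt scaler0 zgroup_mxE big1 // => g _.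
  by rewrite scale0r.
(* With [y = 2 p n1 t], [x = n2 t'] and [c = m e], one gets [x y c = (2 p n1 n2) c] and
   [y c x = (n1 n2 m) (2 p es)]. *)
exists x, y, (2 * p * n1 * n2)%:Z, (n1 * n2 * m)%:Z; split.
- by rewrite -lt0n !muln_gt0 /= p_gt0 n10 n20.
- by rewrite -lt0n !muln_gt0 n10 n20 m0.
(* On the trivial module [int], [N y = 0] says that [p] times the augmentation of [y] is 0. *)
- have trivP : group_action (fun (_ : gT) (z : int) => z) by [].
  have := N0 _ _ 1 trivP; rewrite /rot_act sumr_const -orderE => /eqP.
  rewrite (dihedral_order p_prime order_G gen_G rp s2 rs2) mulrn_eq0 -leqn0 leqNgt p_gt0 /=.
  rewrite /gact => /eqP yy; rewrite -[RHS]yy; apply: eq_bigr => g _.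
  by rewrite -mulrzr mul1r intz.
move=> V rho rhoP z.
have gx z' : gact rho x (rot_act r rho z') = 0.
  rewrite -gN -gact_conv // (@gact_eq _ _ _ _ (fun=> 0)).
    by rewrite /gact big1 // => g _; rewrite mulr0z.
  rewrite -zgroup_mxM NE -xE -scalemxAl t'N scaler0 zgroup_mxE big1 // => g _.
  by rewrite scale0r.
split; split=> //.
- rewrite -gs -gact_conv //; apply: gact_eq; rewrite -zgroup_mxM sE yE -scalemxAr.
  by rewrite -est mulmxA (refl_idemMl p gen_G s2 rs2).
- exact: N0.
- rewrite -[rho s z]gs -gact_conv //; apply: gact_eq; rewrite -zgroup_mxM sE -xE -scalemxAl.
  by rewrite -t'es -mulmxA (refl_idemMr r p s2).
- rewrite -!gact_conv // -gactMz_fun; apply: gact_eq.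
  rewrite -!zgroup_mxM zgroup_mxMz -xE yE -mE -!scalemxAl -!scalemxAr -!scalemxAl !scalerA.
  rewrite t't ee; congr (_ *: _).
  by rewrite -pmulrn !natrM; ring.
- pose pi g : int := (g \in [set 1%g])%:R * p%:Z + (g \in <[r]>%g)%:R * -1.
  pose si g : int := (g \in [set 1%g])%:R + (g \in [set s])%:R.
  have one1 : zgroup_mx (fun g => (g \in [set 1%g])%:R) = 1%:M :> 'M[rat]_#|G|.
    by rewrite zgroup_mx_mem big_set1 repr_mx1.
  have piE : E pi = rot_compl r p.
    by rewrite zgroup_mxD !zgroup_mxMz one1 NE scaleN1r scalemx1.
  have siE : E si = refl_sum s by rewrite zgroup_mxD one1 sE.
  have g1 z' : gact rho (fun g => (g \in [set 1%g])%:R) z' = z'.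
    by rewrite gact_mem big_set1; case: rhoP.
  have gpi z' : gact rho pi z' = z' *+ p - rot_act r rho z'.
    by rewrite gactD_fun !gactMz_fun g1 gN mulrN1z.
  have gsi z' : gact rho si z' = z' + rho s z' by rewrite gactD_fun g1 gs.
  rewrite -gsi -gpi -!gact_conv // -gactMz_fun; apply: gact_eq.
  rewrite zgroup_mxMz -!zgroup_mxM piE siE -xE yE -mE.
  rewrite -!scalemxAl -!scalemxAr -!scalemxAl !scalerA te tt' /es /refl_idem scalerA.
  congr (_ *: _); rewrite -pmulrn !natrM; field.
  by rewrite pnatr_eq0 -lt0n p_gt0.
- rewrite -gact_conv // pmulrn -gactMz_fun; apply: gact_eq.
  by rewrite -zgroup_mxM zgroup_mxMz -mE -scalemxAl -scalemxAr ee.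
Qed.

End TwoDimensional.
End Operators.

(** * The dihedral action on a Jacobian *)

Section RotationOperators.
Variables (gT : finGroupType) (r s : gT) (p : nat).
Hypotheses (p_prime : prime p) (p_odd : odd p).
Hypothesis order_r : #[r]%g = p.
Hypotheses (s2 : (s ^+ 2 = 1)%g) (rs2 : ((r * s) ^+ 2 = 1)%g).
Variables (V : zmodType) (rho : gT -> V -> V).
Hypothesis rhoP : group_action rho.

Let rho1 z : rho 1%g z = z. Proof. by case: rhoP. Qed.
Let rhoM g h z : rho (g * h)%g z = rho g (rho h z). Proof. by case: rhoP. Qed.
Let rhoD g x y : rho g (x + y) = rho g x + rho g y. Proof. by case: rhoP => _ _ ->. Qed.
Let rhoB g x y : rho g (x - y) = rho g x - rho g y.
Proof. by rewrite rhoD group_actionN. Qed.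

Local Notation rotN := (rot_act r rho).

Lemma rot_actD x y : rotN (x + y) = rotN x + rotN y.
Proof. by rewrite /rot_act -big_split; apply: eq_bigr => g _; rewrite rhoD. Qed.

Lemma rot_actN x : rotN (- x) = - rotN x.
Proof. by rewrite /rot_act -sumrN; apply: eq_bigr => g _; rewrite group_actionN. Qed.

Lemma rot_act_rotr g z : g \in <[r]>%g -> rotN (rho g z) = rotN z.
Proof.
move=> gr; rewrite [RHS](reindex_inj (mulIg g)) /=.
by apply: eq_big => [h|h _]; rewrite ?groupMr // rhoM.
Qed.

Lemma rot_act_rotl g z : g \in <[r]>%g -> rho g (rotN z) = rotN z.
Proof.
move=> gr; rewrite group_action_sum // [RHS](reindex_inj (mulgI g)) /=.
by apply: eq_big => [h|h _]; rewrite ?groupMl // rhoM.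
Qed.

Lemma rot_act_refl z : rho s (rotN z) = rotN (rho s z).
Proof.
rewrite group_action_sum // /rot_act (reindex_inj (@conjg_inj _ s)) /=.
apply: eq_big => [h|h _]; first by rewrite memJ_norm // (dihedral_norm s2 rs2).
by rewrite -!rhoM conjgE mulgA mulgV mul1g.
Qed.

Lemma rot_act_idem z : rotN (rotN z) = rotN z *+ p.
Proof.
rewrite {1}/rot_act (eq_bigr (fun=> rotN z)) => [|g gr]; last exact: rot_act_rotl.
by rewrite sumr_const -order_r.
Qed.

Definition rot_diff z := rho r z - rho r^-1%g z.

Lemma rot_diffD x y : rot_diff (x + y) = rot_diff x + rot_diff y.
Proof. by rewrite /rot_diff !rhoD opprD addrACA. Qed.

Lemma rot_diffN x : rot_diff (- x) = - rot_diff x.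
Proof. by rewrite /rot_diff !(group_actionN rhoP) opprD. Qed.

Lemma rot_diff_refl z : rho s (rot_diff z) = - rot_diff (rho s z).
Proof.
have srs : (s * r = r^-1 * s)%g.
  by rewrite -(dihedral_conj rs2) -!mulgA -expg2 s2 mulg1.
have srs' : (s * r^-1 = r * s)%g.
  by apply: (mulIg r); rewrite mulgKV -mulgA srs mulKVg.
by rewrite /rot_diff rhoB -!rhoM srs srs' !rhoM opprB.
Qed.

Lemma rot_act_diff z : rotN (rot_diff z) = 0.
Proof.
by rewrite rot_actD rot_actN !rot_act_rotr ?groupV ?cycle_id // subrr.
Qed.

(** For [q = r^2], [(r - r^-1) r^(2i+1) = q^(i+1) - q^i]; the weights [i] turn the telescoping sum
    into [p - N]. *)
Definition rot_antidiff0 z := \sum_(i < p) rho (r ^+ (2 * i).+1)%g z *+ i.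

Lemma rot_antidiff0_rot g z :
  g \in <[r]>%g -> rot_antidiff0 (rho g z) = rho g (rot_antidiff0 z).
Proof.
move=> /cycleP[j ->]; rewrite /rot_antidiff0 group_action_sum //.
by apply: eq_bigr => i _; rewrite group_actionMn // -!rhoM -!expgD addnC.
Qed.

Lemma rot_antidiff0D x y :
  rot_antidiff0 (x + y) = rot_antidiff0 x + rot_antidiff0 y.
Proof.
by rewrite /rot_antidiff0 -big_split; apply: eq_bigr => i _; rewrite rhoD mulrnDl.
Qed.

Lemma rot_antidiff0N x : rot_antidiff0 (- x) = - rot_antidiff0 x.
Proof.
rewrite /rot_antidiff0 -sumrN; apply: eq_bigr => i _.
by rewrite group_actionN // mulNrn.
Qed.

(* Abel summation of \sum_i i (q ^ (i + 1) - q ^ i) for q = r ^ 2. *)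
Lemma rot_diff_antidiff0 z : rot_diff (rot_antidiff0 z) = z *+ p - rotN z.
Proof.
pose f i := rho (r ^+ (2 * i))%g z.
have -> : rot_diff (rot_antidiff0 z) = \sum_(i < p) (f i.+1 - f i) *+ i.
  rewrite /rot_diff /rot_antidiff0 !group_action_sum // -sumrB.
  apply: eq_bigr => i _; rewrite !group_actionMn // -mulrnBl -!rhoM /f.
  by rewrite -expgS [in X in _ - rho X z]expgS mulKg mulnS.
have abel n : \sum_(i < n) (f i.+1 - f i) *+ i = f n *+ n - \sum_(i < n) f i.+1.
  elim: n => [|n IH]; first by rewrite !big_ord0 subrr.
  rewrite !big_ord_recr /= IH mulrSr mulrnBl.
  have aux (a b c t : V) : a - t + (b - a) = b + c - (t + c).
    by rewrite [t + c]addrC addrKA addrC addrA subrK.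
  exact: aux.
rewrite abel; congr (_ *+ _ - _).
  by rewrite /f mulnC expgM -order_r expg_order expg1n rho1.
(* As [p] is odd, [r^2] also generates the rotations. *)
have gen : <[r]>%g = <[r ^+ 2]>%g.
  by apply/eqP; rewrite -/(generator _ _) generator_coprime order_r coprimen2.
have ox : #[r ^+ 2]%g = p by rewrite /order -gen -order_r.
rewrite -(rot_act_rotl z (mem_cycle r 2)) /rot_act gen group_action_sum // sum_cycle ox.
by apply: eq_bigr => i _; rewrite /f -rhoM -expgM -expgD mulnS.
Qed.

(** Antisymmetrizing under [s] makes the inverse anticommute with [s], as [rot_diff] does; the price
    is a factor 2. *)
Definition rot_antidiff z := rot_antidiff0 z - rho s (rot_antidiff0 (rho s z)).

Let ss z : rho s (rho s z) = z.
Proof. by rewrite -rhoM -expg2 s2 rho1. Qed.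

Lemma rot_antidiff_refl z : rho s (rot_antidiff z) = - rot_antidiff (rho s z).
Proof. by rewrite /rot_antidiff rhoB !ss opprB. Qed.

Lemma rot_diff_antidiff z : rot_diff (rot_antidiff z) = (z *+ p - rotN z) *+ 2.
Proof.
have diffs x : rot_diff (rho s x) = - rho s (rot_diff x).
  by rewrite rot_diff_refl opprK.
rewrite /rot_antidiff rot_diffD rot_diffN diffs opprK !rot_diff_antidiff0 mulr2n.
by rewrite rhoB group_actionMn // ss rot_act_refl ss.
Qed.

Lemma rot_antidiff_diff z : rot_antidiff (rot_diff z) = (z *+ p - rotN z) *+ 2.
Proof.
have C x : rot_antidiff0 (rot_diff x) = x *+ p - rotN x.
  rewrite -rot_diff_antidiff0 /rot_diff rot_antidiff0D rot_antidiff0N.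
  by rewrite !rot_antidiff0_rot ?groupV ?cycle_id.
rewrite /rot_antidiff rot_diff_refl rot_antidiff0N group_actionN // opprK !C mulr2n.
by rewrite rhoB group_actionMn // ss rot_act_refl ss.
Qed.

End RotationOperators.

(** * Isogenies and Prym varieties *)

Local Notation supp A := (@Defs.support _ A).

Section Isogenies.
Local Open Scope classical_set_scope.
Variable k : fieldType.

Lemma isogenous_intro (A B : abelian_subvar k) (F : ambient A -> ambient B) :
  nonzero_coord (ambient B) -> av_hom F ->
  (forall x, supp A x -> supp B (F x)) ->
  (forall y, supp B y -> exists2 x, supp A x & F x = y) ->
  (exists s : seq (ambient A), forall x, supp A x -> F x = 0 -> x \in s) ->
  isogenous A B.
Proof.
move=> B0 [FD Fm] FAB Fsurj [l lP].
pose h (x : abvar A) : abvar B := exist _ (F (sval x)) (FAB _ (svalP x)).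
exists h; split.
- exact: (vmorphism_restrict B0 Fm).
- by move=> x y z zE; rewrite /= zE FD.
- move=> [b Bb]; have [a Aa ab] := Fsurj b Bb.
  by exists (exist _ a Aa); apply: eq_exist.
apply: (@sub_finite_set _ _ (sval @^-1` [set` l])).
  by move=> x /= /(lP _ (svalP x)).
apply: finite_preimage; last exact: finite_seq.
by move=> x y _ _; apply: eq_sig_hprop => z; apply: Prop_irrelevance.
Qed.

End Isogenies.

Section Prym.
Local Open Scope classical_set_scope.
Variable k : numClosedFieldType.

(* The image is closed, and of finite index in the kernel of N because the
   m-torsion of Jm is finite. *)
Lemma prym_eq_image (J Jm JY : gvariety k) (phi : J -> Jm) (N : Jm -> JY) m :
  abelian_variety J -> abelian_variety Jm -> (0 < m)%N ->
  av_hom phi -> av_hom N -> (forall z, N (phi z) = 0) ->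
  (forall y, N y = 0 -> exists z, phi z = y *+ m) ->
  supp (prym N) = range phi.
Proof.
move=> J_ab Jm_ab m0 phih Nh Nphi Nm.
have Ic : zclosed (range phi : set (gvar Jm)) by apply: image_closed.
have phi0 : phi 0 = 0 by apply: av_hom0.
apply/seteqP; split=> y /=; last first.
  (* The image is itself a connected subset of the kernel through 0, since [J] is irreducible. *)
  move=> Iy; exists (range phi : set (gvar Jm)); split=> //.
  - by move=> _ [z _ <-] /=.
  - move=> Z1 Z2 Z1c Z2c cov disj.
    have [_ [_ irr] _ _] := J_ab.
    have [|H|H] := irr _ _ (phih.2.1 _ Z1c) (phih.2.1 _ Z2c).
    + by move=> z _; apply: cov; exists z.
    + by left=> _ [z _ <-]; apply: H.
    + by right=> _ [z _ <-]; apply: H.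
  - by exists 0.
move=> [Z [ZK Zconn Z0 Zy]].
have [s sP] := torsion_finite Jm_ab m0.
pose coset (t : Jm) : set (gvar Jm) := [set x : Jm | range phi (x - t : Jm)].
have cosetc t : zclosed (coset t).
  have tm : @vmorphism _ Jm Jm (fun b => b + - t : Jm).
    by apply: vmorphismD => //; exact: vmorphism_cst.
  exact: (tm.1 _ Ic).
(* Torsion points outside the image: every coset met by the kernel, other than the image, has a
   representative among them, and the union [Z2] of their cosets is closed and disjoint from the
   image. *)
pose s' := [seq t <- s | `[< ~ range phi t >]].
pose Z2 : set (gvar Jm) := [set x | exists2 t, t \in s' & coset t x].
have Z2c : zclosed Z2 by apply: zclosed_seq.
have cov x : Z x -> range phi x \/ Z2 x.
  (* Dividing [z] by [m] gives [m x = m (phi z')], so [x] and [phi z'] differ by [m]-torsion. *)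
  move=> /ZK /= Nx; have [z zE] := Nm x Nx.
  have [z' z'E] := divisible J_ab m0 z.
  have [Ix|nIx] := pselect (range phi x); [by left | right].
  exists (x - phi z'); last by exists z' => //; rewrite opprB addrC subrK.
  rewrite mem_filter; apply/andP; split.
    apply/asboolP => -[w _ wE]; apply: nIx; exists (w + z') => //.
    by rewrite (av_homD phih) wE subrK.
  by apply: sP; rewrite mulrnBl -zE -(av_homMn phih) -z'E subrr.
have nZ2 x : range phi x -> Z2 x -> False.
  move=> [w _ <-] [t]; rewrite mem_filter => /andP[/asboolP nt _] [w' _ w'E].
  apply: nt; exists (w - w') => //.
  by rewrite (av_homB phih) w'E opprB addrC subrK.
have [||H|H] := Zconn _ _ Ic Z2c.
- by move=> x /cov.
- by apply/seteqP; split=> x // [[_ Ix] Z2x]; case: (nZ2 x).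
- exact: H.
- by case: (nZ2 0); [exists 0 | apply: H].
Qed.

End Prym.

Lemma absz_sqr (a : int) : (`|a| * `|a|)%N%:Z = a * a.
Proof. by case: a => n; rewrite ?NegzE ?mulrNN -PoszM. Qed.

(** Squaring the scalar makes it a natural multiple, the form in which [prym_eq_image] takes it. *)
Lemma mulrz_sqr (V : zmodType) (x : V) a : x *~ (a * a) = x *+ (`|a| * `|a|)%N.
Proof. by rewrite -absz_sqr pmulrn. Qed.

(** Recovers a multiple of [u] from [u + v] and [u - v], for two points exchanged by [s]. *)
Lemma mulrz_halves (V : zmodType) (u v : V) (n : nat) (b : int) :
  u *~ (4%:Z * n%:Z * b) = (u + v) *~ b *~ (2%:Z * n%:Z) + (u *+ 2 - v *+ 2) *+ n *~ b.
Proof.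
rewrite -mulrnBl !pmulrn -!mulrzA.
have -> : 2%:Z * (n%:Z * b) = b * (2%:Z * n%:Z) by ring.
rewrite -mulrzDl addrACA subrr addr0 -mulr2n pmulrn -mulrzA; congr (_ *~ _); ring.
Qed.

Lemma mulrz_absz (V : zmodType) (x : V) a : x *~ a = 0 -> x *+ `|a|%N = 0.
Proof.
by case: a => n // /eqP; rewrite NegzE mulrNz oppr_eq0 => /eqP.
Qed.

Section Homs.
Variable k : fieldType.
Variables (A B : gvariety k).
Hypothesis B_ab : abelian_variety B.

Lemma av_homD_hom (f g : A -> B) : av_hom f -> av_hom g ->
  @av_hom _ A B (fun x => f x + g x).
Proof.
move=> [fD fm] [gD gm]; split; first by move=> x y; rewrite fD gD addrACA.
exact: vmorphismD.
Qed.

Lemma av_homN_hom (f : A -> B) : av_hom f -> @av_hom _ A B (fun x => - f x).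
Proof.
move=> [fD fm]; split; first by move=> x y; rewrite fD opprD.
exact: vmorphismN.
Qed.

Lemma av_homMn_hom (f : A -> B) n : av_hom f -> @av_hom _ A B (fun x => f x *+ n).
Proof.
move=> [fD fm]; split; first by move=> x y; rewrite fD mulrnDl.
exact: vmorphismMn.
Qed.

Lemma av_hom_pair (C : gvariety k) (f : A -> B) (g : A -> C) :
  nonzero_coord C -> av_hom f -> av_hom g ->
  @av_hom _ A (gvprod B C) (fun x => (f x, g x)).
Proof.
move=> C0 [fD fm] [gD gm]; split; first by move=> x y; rewrite fD gD.
exact: (vmorphism_pair (ab_nonzero_coord B_ab) C0).
Qed.

End Homs.

Lemma divisible_int (k : numClosedFieldType) (A : gvariety k) (n : int) :
  abelian_variety A -> n != 0 -> forall a : A, exists b, a = b *~ n.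
Proof.
move=> A_ab n0 a; have [|b bE] := divisible A_ab (_ : 0 < `|n|)%N a; first by rewrite absz_gt0.
case: n n0 bE => n _ bE; first by exists b.
by exists (- b); rewrite NegzE mulrNz mulNrz opprK.
Qed.

Section Decomposition.
Variable k : numClosedFieldType.
Variables (gT : finGroupType) (r s : gT) (p : nat).
Hypotheses (p_prime : prime p) (p_odd : odd p).
Hypothesis order_G : #|[set: gT]%G| = (2 * p)%N.
Hypothesis gen_G : [set: gT]%G = <<[set r; s]>>%g :> {set gT}.
Hypotheses (rp : (r ^+ p = 1)%g) (s2 : (s ^+ 2 = 1)%g) (rs2 : ((r * s) ^+ 2 = 1)%g).
Variables (X Y : variety k) (act : gT -> X -> X) (qY : X -> Y).
Hypotheses (act_aut : curve_action act) (qYP : quotient_by act [set: gT]%G qY).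
Variables (JX JY : gvariety k) (ajX : X -> JX) (ajY : Y -> JY) (rho : gT -> JX -> JX).
Hypotheses (JXP : jacobian ajX) (JYP : jacobian ajY).
Hypothesis rhoP : forall g, norm_map ajX ajX (act g) (rho g).

Let JX_ab : abelian_variety JX. Proof. by case: JXP. Qed.
Let JY_ab : abelian_variety JY. Proof. by case: JYP. Qed.
Let rho_hom g : av_hom (rho g). Proof. by case: (rhoP g). Qed.
Let p_gt0 : (0 < p)%N. Proof. exact: prime_gt0. Qed.
Let order_r : #[r]%g = p. Proof. exact: dihedral_order p_prime order_G gen_G rp s2 rs2. Qed.

Lemma jacobian_action : group_action rho.
Proof.
split=> [z|g h z|g x y].
- exact: (rho1 act_aut JXP rhoP).
- exact: (rhoM act_aut JXP rhoP).
- exact: av_homD.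
Qed.
Let rhoA := jacobian_action.

Lemma gact_hom c : av_hom (gact rho c).
Proof. by apply: av_hom_sum => // g; apply: av_homMz_hom. Qed.

Lemma rot_act_hom : av_hom (rot_act r rho).
Proof. exact: av_hom_sum. Qed.

Lemma rot_diff_hom : av_hom (rot_diff r rho).
Proof. by apply: av_homD_hom => //; apply: av_homN_hom. Qed.

Lemma rot_antidiff_hom : av_hom (rot_antidiff r s p rho).
Proof.
have h0 : av_hom (rot_antidiff0 r p rho).
  by apply: av_hom_sum => // i; apply: av_homMn_hom.
apply: av_homD_hom => //; apply: av_homN_hom => //.
exact: (av_hom_comp (av_hom_comp (rho_hom s) h0) (rho_hom s)).
Qed.

Section Push.
Variables (M : {group gT}) (Xm : variety k) (q : X -> Xm) (qP : quotient_by act M q).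
Variables (Jm : gvariety k) (ajm : Xm -> Jm) (JmP : jacobian ajm).

Let Jm_ab : abelian_variety Jm. Proof. by case: JmP. Qed.

Lemma push_pull : exists (push : JX -> Jm) (pull : Jm -> JX),
  [/\ av_hom push, av_hom pull, forall z, pull (push z) = \sum_(g in M) rho g z,
      forall y, push (pull y) = y *+ #|M| &
   [/\ forall g z, g \in M -> push (rho g z) = push z,
       forall g y, g \in M -> rho g (pull y) = pull y &
       forall x x', push (ajX x - ajX x') = ajm (q x) - ajm (q x')]].
Proof.
have [push [pull [hh lh pE pull_push push_pull]]] :=
  quotient_jacobian act_aut qP JXP JmP rhoP.
exists push, pull; split=> //; split=> // [g z gM|g y gM].
  apply: (jacobian_ext JXP Jm_ab (av_hom_comp (rho_hom g) hh) hh) => x x'.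
  by case: (rhoP g) => _ E; rewrite /= E !pE !(quotient_act qP).
(* After writing [y] as [#|M|] times [y'], that is as [push (pull y')], the point [pull y] becomes a
   sum over [M], visibly invariant. *)
have [y' ->] := divisible Jm_ab (cardG_gt0 M) y.
rewrite -push_pull pull_push group_action_sum // [RHS](reindex_inj (mulgI g)) /=.
by apply: eq_big => [h|h _]; rewrite ?groupMl //; case: rhoA => _ -> _.
Qed.

End Push.

Local Notation rotN := (rot_act r rho).

Lemma sum_dihedral_act z : \sum_(g in [set: gT]%G) rho g z = rotN z + rotN (rho s z).
Proof.
rewrite (eq_bigl xpredT) => [|g]; last by rewrite inE.
rewrite (dihedral_sum p_prime p_odd order_G gen_G rp s2 rs2); congr (_ + _).
by apply: eq_bigr => g _; case: rhoA => _ ->.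
Qed.

Lemma push_norm (Xm : variety k) (q : X -> Xm) (f : Xm -> Y) (Jm : gvariety k)
    (ajm : Xm -> Jm) (Nm : Jm -> JY) (push : JX -> Jm) (pushY : JX -> JY) :
  (forall x, f (q x) = qY x) -> norm_map ajm ajY f Nm -> av_hom push -> av_hom pushY ->
  (forall x x', push (ajX x - ajX x') = ajm (q x) - ajm (q x')) ->
  (forall x x', pushY (ajX x - ajX x') = ajY (qY x) - ajY (qY x')) ->
  forall z, Nm (push z) = pushY z.
Proof.
move=> fq [Nh NE] ph pYh pE pYE.
apply: (jacobian_ext JXP JY_ab (av_hom_comp ph Nh) pYh) => x x'.
by rewrite /= pE NE pYE !fq.
Qed.

Let rotD := @rot_actD gT r JX rho rhoA.
Let rotB x y : rotN (x - y) = rotN x - rotN y.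
Proof. by rewrite rotD rot_actN. Qed.
Let rotMz x n : rotN (x *~ n) = rotN x *~ n. Proof. exact: (av_homMz rot_act_hom). Qed.
Let rot_idem z : rotN (rotN z) = rotN z *+ p. Proof. exact: rot_act_idem. Qed.
Let rot_s z : rho s (rotN z) = rotN (rho s z). Proof. exact: rot_act_refl. Qed.
Let ss z : rho s (rho s z) = z.
Proof. by case: rhoA => r1 rM _; rewrite -rM -expg2 s2 r1. Qed.

(** * The sign part of the Jacobian *)

Section SignPart.
Variables (c : gT -> int) (a : int).
Hypothesis a0 : a != 0.
Hypothesis cE : forall z, gact rho c z = (rotN z - rotN (rho s z)) *~ a.

Lemma sign_rot z : rotN (gact rho c z) = gact rho c z *+ p.
Proof.
rewrite cE rotMz rotB !rot_idem -mulrnBl pmulrn -!mulrzA mulrC.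
by rewrite mulrzA -pmulrn.
Qed.

Lemma sign_refl z : rho s (gact rho c z) = - gact rho c z.
Proof.
by rewrite cE (av_homMz (rho_hom s)) (av_homB (rho_hom s)) !rot_s ss -mulNrz opprB.
Qed.

(** [pull \o push] is the rotation sum, which multiplies the image of [c] by [p]; hence [push] has
    finite kernel there. *)
Lemma isogeny_sign (Xr : variety k) (qr : X -> Xr) (qrP : quotient_by act <[r]>%g qr)
    (fr : Xr -> Y) (frP : forall x, fr (qr x) = qY x) (Jr : gvariety k) (ajr : Xr -> Jr)
    (JrP : jacobian ajr) (Nr : Jr -> JY) (NrP : norm_map ajr ajY fr Nr) :
  isogenous (image_of (gact rho c)) (prym Nr).
Proof.
have Jr_ab : abelian_variety Jr by case: JrP.
have [pushY [pullY [pYh lYh plY _ [pYrho _ pYE]]]] := push_pull qYP JYP.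
have [push [pull [ph lh pl pp [_ _ pE]]]] := @push_pull <[r]>%G _ _ qrP _ _ JrP.
have Np := push_norm frP NrP ph pYh pE pYE.
have Nrh : av_hom Nr by case: NrP.
have plN z : pull (push z) = rotN z by rewrite pl.
have phih : av_hom (push \o gact rho c) by apply: av_hom_comp ph; apply: gact_hom.
have image : supp (prym Nr) = range (push \o gact rho c)%classic.
  (* For [y] in the kernel of [Nr], the rotation sum sends [pull y] to [p pull y] and
     [rho s (pull y)] to [- p pull y], so [c] followed by [push] maps [a pull y] to
     [2 p^2 a^2 y]. *)
  apply: (@prym_eq_image _ _ _ _ _ _ ((p * p * 2) * (`|a| * `|a|))%N) => //.
  - by rewrite !muln_gt0 p_gt0 absz_gt0 a0.
  - move=> z; rewrite /= Np cE (av_homMz pYh) (av_homB pYh) /rot_act.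
    rewrite !(av_hom_sumr pYh) -sumrB big1 ?mul0rz // => g _.
    by rewrite !pYrho ?inE // subrr.
  move=> y Ny; exists (pull y *~ a).
  have Nz : rotN (pull y) = pull y *+ p by rewrite -plN pp (av_homMn lh) -orderE order_r.
  have Tz : rotN (rho s (pull y)) = - (pull y *+ p).
    apply/eqP; rewrite -addr_eq0 addrC -Nz -sum_dihedral_act -plY -Np pp.
    by rewrite (av_homMn Nrh) Ny mul0rn (av_hom0 lYh).
  rewrite /= (av_homMz (gact_hom c)) cE -mulrzA mulrz_sqr Nz Tz opprK -mulr2n.
  by rewrite !(av_homMn ph) pp -orderE order_r -!mulrnA !mulnA.
apply: (@isogenous_intro _ (image_of _) (prym Nr) push).
- exact: ab_nonzero_coord.
- exact: ph.
- by move=> _ [z _ <-]; rewrite image; exists z.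
- by move=> y; rewrite image => -[z _ <-]; exists (gact rho c z) => //; exists z.
have [l lP] := torsion_finite JX_ab p_gt0.
exists l => _ [z _ <-] pz; apply: lP.
by rewrite -sign_rot -plN pz (av_hom0 lh).
Qed.

End SignPart.

(** * The two-dimensional part and the decomposition of the Jacobian *)

Section TwoDimensionalPart.
Variables (w x y : gT -> int) (a b : int) (m : nat).
Hypotheses (a0 : a != 0) (b0 : b != 0) (m0 : (0 < m)%N).
Hypothesis y_aug : \sum_g y g = 0.
Hypothesis ops : forall (V : zmodType) (rho : gT -> V -> V), group_action rho -> forall z,
    [/\ rho s (gact rho y z) = gact rho y z, rot_act r rho (gact rho y z) = 0,
        gact rho x (rho s z) = gact rho x z & gact rho x (rot_act r rho z) = 0] /\
    [/\ gact rho x (gact rho y (gact rho w z)) = gact rho w z *~ a,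
        gact rho y (gact rho w (gact rho x z)) =
          ((z + rho s z) *+ p - rot_act r rho (z + rho s z)) *~ b &
        gact rho w (gact rho w z) = gact rho w z *+ m].

(** [y] moves the image of [w] to points fixed by [s], where [pull \o push], being [1 + s], is
    doubling; hence the map [push \o y] to the Prym variety. *)
Lemma isogeny_two_dim (Xs : variety k) (qs : X -> Xs) (qsP : quotient_by act <[s]>%g qs)
    (fs : Xs -> Y) (fsP : forall x, fs (qs x) = qY x) (Js : gvariety k) (ajs : Xs -> Js)
    (JsP : jacobian ajs) (Ns : Js -> JY) (NsP : norm_map ajs ajY fs Ns) :
  isogenous (image_of (gact rho w)) (prym Ns).
Proof.
have Js_ab : abelian_variety Js by case: JsP.
have [pushY [pullY [pYh lYh plY _ [pYrho _ pYE]]]] := push_pull qYP JYP.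
have [push [pull [ph lh pl pp [_ _ pE]]]] := @push_pull <[s]>%G _ _ qsP _ _ JsP.
have Np := push_norm fsP NsP ph pYh pE pYE.
have Nsh : av_hom Ns by case: NsP.
have order_s : #[s]%g = 2%N by apply: dihedral_order_s p_prime order_G gen_G rp s2 rs2.
have plN z : pull (push z) = z + rho s z.
  rewrite pl sum_cycle order_s !big_ord_recl big_ord0 /= addr0.
  by rewrite /bump /= expg0 expg1; case: rhoA => ->.
have yh := gact_hom y; have wh := gact_hom w; have xh := gact_hom x.
have phih : av_hom (push \o gact rho y \o gact rho w).
  exact: (av_hom_comp wh (av_hom_comp yh ph)).
have image : supp (prym Ns) = range (push \o gact rho y \o gact rho w)%classic.
  (* The composite [y w x] is [b (p - N) (1 + s)]. Applied to [b pull y0], the factor [1 + s]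
     doubles and [N] then gives 0, as [y0] is in the kernel of [Ns]; pushing doubles again, for
     [4 p b^2] in all. *)
  apply: (@prym_eq_image _ _ _ _ _ _ ((2 * 2 * p) * (`|b| * `|b|))%N) => //.
  - by rewrite !muln_gt0 p_gt0 absz_gt0 b0.
  - move=> z; rewrite /= Np /gact (av_hom_sumr pYh).
    rewrite (eq_bigr (fun g => pushY (gact rho w z) *~ y g)) => [|g _]; last first.
      by rewrite (av_homMz pYh) pYrho ?inE.
    have mz : {morph (fun n => pushY (gact rho w z) *~ n) : u v / u + v}.
      by move=> u v; rewrite mulrzDr.
    by rewrite -(big_morph _ mz (mulr0z _)) y_aug mulr0z.
  move=> y0 Ny; exists (gact rho x (pull y0 *~ b)).
  have [_ [_ E _]] := ops rhoA (pull y0 *~ b).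
  rewrite /= E (av_homMz (rho_hom s)) -mulrzDl -plN pp -orderE order_s (av_homMn lh).
  have Tz : rotN (pull y0 *+ 2) = 0.
    have := plN (pull y0); rewrite pp -orderE order_s (av_homMn lh) => ->.
    rewrite rotD -sum_dihedral_act -plY -Np pp (av_homMn Nsh) Ny mul0rn.
    exact: av_hom0.
  rewrite rotMz Tz mul0rz subr0 /=.
  rewrite !(av_homMn ph, av_homMz ph) pp -orderE order_s.
  by rewrite !pmulrn -!mulrzA PoszM absz_sqr; congr (_ *~ _); rewrite !PoszM; ring.
apply: (@isogenous_intro _ (image_of _) (prym Ns) (push \o gact rho y)).
- exact: ab_nonzero_coord.
- exact: av_hom_comp ph.
- by move=> _ [z _ <-]; rewrite image; exists z.
- by move=> y0; rewrite image => -[z _ <-]; exists (gact rho w z) => //; exists z.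
(* If [v] in the image of [w] has [push (y v) = 0], then [2 y v = 0], and [x y v = a v] gives
   [2 a v = 0]. *)
have [|l lP] := @torsion_finite _ _ JX_ab (`|a| * 2)%N; first by rewrite muln_gt0 absz_gt0 a0.
exists l => _ [z _ <-] pz; apply: lP; rewrite mulrnA.
have [[ys _ _ _] _] := ops rhoA (gact rho w z); have [_ [xyw _ _]] := ops rhoA z.
have v2 : gact rho y (gact rho w z) *+ 2 = 0.
  have := plN (gact rho y (gact rho w z)).
  by rewrite ys -mulr2n => <-; rewrite [push _]pz (av_hom0 lh).
rewrite mulrnAC; apply: mulrz_absz.
have := congr1 (gact rho x) v2; rewrite (av_homMn xh) xyw (av_hom0 xh).
by rewrite !pmulrn -!mulrzA mulrC.
Qed.

Local Notation delta := (rot_diff r rho).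
Local Notation theta := (rot_antidiff r s p rho).
Local Notation W := (gact rho w).
Local Notation Xo := (gact rho x).
Local Notation Yo := (gact rho y).

(** On the trivial module [int] operators act by their augmentations, and [x y w = a w] with [y] of
    augmentation 0. *)
Let two_dim_aug : \sum_g w g = 0.
Proof.
have trivP : group_action (fun (_ : gT) (z : int) => z) by [].
have gE (c : gT -> int) z : gact (fun _ (z : int) => z) c z = z * \sum_g c g.
  by rewrite /gact mulr_sumr; apply: eq_bigr => g _; rewrite mulrzz.
have [_ [E _ _]] := ops trivP 1; move: E; rewrite !gE y_aug mulr0 mul0r mul1r mulrzz.
by move/esym/eqP; rewrite mulf_eq0 (negPf a0) orbF => /eqP.
Qed.

Variables (c : gT -> int) (d : int).
Hypothesis d0 : d != 0.
Hypothesis cE : forall z, gact rho c z = (rotN z - rotN (rho s z)) *~ d.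
Local Notation U := (gact rho c).

(** On such a [v] each half of [theta] only adds up copies of [v], with the same weights, and the
    halves cancel. *)
Lemma rot_antidiff_fixed v : (forall g, g \in <[r]>%g -> rho g v = v) ->
  (forall g, g \in <[r]>%g -> rho g (rho s v) = rho s v) -> theta v = 0.
Proof.
move=> fv fsv; rewrite /rot_antidiff /rot_antidiff0 group_action_sum // -sumrB.
rewrite big1 // => i _; rewrite (group_actionMn rhoA) fv ?mem_cycle //.
by rewrite fsv ?mem_cycle // ss subrr.
Qed.

(** [W Xo] detects the part fixed by [s]; composing with [theta], which anticommutes with [s],
    brings the anti-invariant part into view. Cross terms between the four summands vanish, some
    only after doubling. *)
Lemma isogeny_jacobian :
  isogenous (whole JX) (abprod (whole JY)
    (abprod (image_of U) (abprod (image_of W) (image_of W)))).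
Proof.
have [push [pull [ph lh pl pp [pr lr _]]]] := push_pull qYP JYP.
have Uh := gact_hom c; have Wh := gact_hom w; have Xh := gact_hom x.
have Yh := gact_hom y.
have dh := rot_diff_hom; have th := rot_antidiff_hom.
pose F (z : JX) : ambient (abprod (whole JY)
    (abprod (image_of U) (abprod (image_of W) (image_of W)))) :=
  (push z, (U z, (W (Xo z), W (Xo (theta z))))).
have WXh : av_hom (W \o Xo) by apply: av_hom_comp Wh.
have WXTh : av_hom (W \o Xo \o theta) by apply: av_hom_comp th (av_hom_comp Xh Wh).
have J0 := ab_nonzero_coord JX_ab; have JY0 := ab_nonzero_coord JY_ab.
have JJ0 := nonzero_coord_vprod J0 J0; have JJJ0 := nonzero_coord_vprod J0 JJ0.
have Fh : av_hom F.
  apply: (@av_hom_pair _ JX JY JY_ab (gvprod JX (gvprod JX JX))) => //.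
  apply: (@av_hom_pair _ JX JX JX_ab (gvprod JX JX)) => //.
  exact: (@av_hom_pair _ JX JX JX_ab JX).
apply: (@isogenous_intro _ (whole JX) _ F) => //.
- exact: (@nonzero_coord_vprod _ JY (vprod JX (vprod JX JX))).
- by move=> z _; split=> //; split; [exists z | split; [exists (Xo z) | exists (Xo (theta z))]].
- move=> [y0 [u0 [w1 w2]]] [_ [[z1 _ /= z1E] [[z2 _ /= z2E] [z3 _ /= z3E]]]].
  have rotY v : rotN (Yo v) = 0 by have [[]] := ops rhoA v.
  have sY v : rho s (Yo v) = Yo v by have [[]] := ops rhoA v.
  have Xs v : Xo (rho s v) = Xo v by have [[]] := ops rhoA v.
  have XN v : Xo (rotN v) = 0 by have [[]] := ops rhoA v.
  have XYW v : W (Xo (Yo (W v))) = W v *~ (a * m%:Z).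
    have [_ [E _ E']] := ops rhoA v.
    by rewrite E (av_homMz Wh) E' pmulrn -mulrzA mulrC.
  have pushg c' v : push (gact rho c' v) = push v *~ \sum_g c' g.
    have mz : {morph (fun n => push v *~ n) : i j / i + j} by move=> i j; rewrite mulrzDr.
    rewrite /gact (av_hom_sumr ph) (big_morph _ mz (mulr0z _)).
    by apply: eq_bigr => g _; rewrite (av_homMz ph) pr ?inE.
  have pullg c' t : gact rho c' (pull t) = pull t *~ \sum_g c' g.
    have mz : {morph (fun n => pull t *~ n) : i j / i + j} by move=> i j; rewrite mulrzDr.
    by rewrite /gact (big_morph _ mz (mulr0z _)); apply: eq_bigr => g _; rewrite lr ?inE.
  have pushU v : push (U v) = 0.
    rewrite cE (av_homMz ph) (av_homB ph) /rot_act !(av_hom_sumr ph) -sumrB.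
    by rewrite big1 ?mul0rz // => g _; rewrite !pr ?inE // subrr.
  have pushY v : push (Yo v) = 0 by rewrite pushg y_aug mulr0z.
  have pushD v : push (delta v) = 0 by rewrite /rot_diff (av_homB ph) !pr ?inE // subrr.
  have Upull t : U (pull t) = 0 by rewrite cE lr ?inE // subrr mul0rz.
  have UU v : U (U v) = U v *~ ((2 * p)%N%:Z * d).
    rewrite cE (sign_refl cE) rot_actN // opprK (sign_rot cE) -mulr2n -mulrnA.
    by rewrite pmulrn -mulrzA mulnC.
  have UY v : U (Yo v) = 0 by rewrite cE sY subrr mul0rz.
  have UD v : U (delta v) = 0.
    by rewrite cE rot_diff_refl // rot_actN // !rot_act_diff // oppr0 subrr mul0rz.
  have XU v : Xo (U v) = 0 by rewrite cE (av_homMz Xh) (av_homB Xh) !XN subrr mul0rz.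
  have WXpull t : W (Xo (pull t)) = 0.
    by rewrite pullg (av_homMz Wh) pullg two_dim_aug mulr0z mul0rz.
  (* [Xo] absorbs [s], while [s] changes the sign of [delta (Yo v)]: the cross term equals its
     opposite, so its double is 0. Hence the doubled preimages [v2] and [v3]. *)
  have XD v : Xo (delta (Yo v)) *+ 2 = 0.
    rewrite mulr2n -{1}[Xo _]Xs rot_diff_refl // sY (av_homN Xh).
    by rewrite addNr.
  have Tpull t : theta (pull t) = 0.
    by apply: rot_antidiff_fixed => g _; rewrite !lr ?inE.
  have TN v : theta (rotN v) = 0.
    apply: rot_antidiff_fixed => g gr; first exact: rot_act_rotl.
    by rewrite rot_s rot_act_rotl.
  have TU v : theta (U v) = 0.
    by rewrite cE (av_homMz th) (av_homB th) !TN subrr mul0rz.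
  have XTY v : Xo (theta (Yo v)) *+ 2 = 0.
    rewrite mulr2n -{1}[Xo _]Xs rot_antidiff_refl // sY (av_homN Xh).
    by rewrite addNr.
  have TD v : theta (delta (Yo v)) = Yo v *+ p *+ 2.
    by rewrite rot_antidiff_diff // rotY subr0.
  have [y1 y1E] := divisible JY_ab (cardG_gt0 [set: gT]%G) y0.
  have p2 : (2 * p)%N%:Z != 0 :> int by rewrite -lt0n muln_gt0.
  have m2 : m%:Z != 0 :> int by rewrite -lt0n.
  (* The divisors match [U U = 2 p d U], then [W Xo Yo W = a m W] on a doubled term, then also
     [theta delta = 2 p] on the image of [Yo]. *)
  have [t1 t1E] := divisible_int JX_ab (mulf_neq0 p2 d0) z1.
  have [t2 t2E] := divisible_int JX_ab (mulf_neq0 (mulf_neq0 a0 m2) (isT : 2%:Z != 0)) z2.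
  have [t3 t3E] := divisible_int JX_ab (mulf_neq0 (mulf_neq0 a0 m2)
     (mulf_neq0 p2 (isT : 2%:Z != 0))) z3.
  have [v2 v2E] : exists v, v = Yo (W t2) *+ 2 by exists (Yo (W t2) *+ 2).
  have [v3 v3E] : exists v, v = delta (Yo (W t3)) *+ 2 by exists (delta (Yo (W t3)) *+ 2).
  exists (pull y1 + U t1 + v2 + v3) => //.
  congr (_, (_, (_, _))).
  + rewrite !(av_homD ph) v2E v3E !(av_homMn ph) pp pushU pushY pushD !mul0rn !addr0.
    by rewrite y1E.
  + rewrite !(av_homD Uh) v2E v3E !(av_homMn Uh) Upull UU UY UD !mul0rn !addr0 add0r.
    by rewrite -z1E t1E (av_homMz Uh).
  + rewrite !(av_homD Xh) v2E v3E !(av_homMn Xh) XU XD !addr0 (av_homD Wh) WXpull add0r.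
    by rewrite (av_homMn Wh) XYW -z2E t2E (av_homMz Wh) pmulrn -mulrzA.
  rewrite !(av_homD th) v2E v3E !(av_homMn th) Tpull TU !add0r TD.
  rewrite (av_homD Xh) (av_homMn Xh (theta _)) XTY add0r !(av_homMn Xh, av_homMn Wh) XYW.
  by rewrite -z3E t3E (av_homMz Wh) !pmulrn -!mulrzA; congr (_ *~ _); rewrite !PoszM; ring.
(* [p z] is the sum of [P z = p z - N z] and [N z]; the kernel conditions give [4 p b P z = 0]
   ([e4]) and [2 d N z = 0] ([e3]). *)
pose K : int := p%:Z * (4%:Z * p%:Z * b) * (2%:Z * d).
have K0 : (0 < `|K|)%N by rewrite absz_gt0 !mulf_neq0 // -lt0n.
have [l lP] := torsion_finite JX_ab K0; exists l => z _ Fz; apply: lP.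
have [h1 h2 h3 h4] : [/\ push z = 0, U z = 0, W (Xo z) = 0 & W (Xo (theta z)) = 0].
  by case: Fz.
apply: mulrz_absz.
pose P v := v *+ p - rotN v.
have Ps v : P (rho s v) = rho s (P v).
  by rewrite /P (av_homB (rho_hom s)) (av_homMn (rho_hom s)) rot_s.
have PD u v : P (u + v) = P u + P v by rewrite /P rotD mulrnDl opprD addrACA.
have dP v : delta (P v) = delta v *+ p.
  rewrite /P (av_homB dh) (av_homMn dh) {2}/rot_diff !rot_act_rotl ?groupV ?cycle_id //.
  by rewrite subrr subr0.
have yw0 v : W (Xo v) = 0 -> P (v + rho s v) *~ b = 0.
  by move=> E; have [_ [_ <- _]] := ops rhoA v; rewrite E (av_hom0 Yh).
(* The condition at [z] controls [P z + P (rho s z)]; the one at [theta z], after [delta], controls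
   [P z - P (rho s z)]. *)
have e1 := yw0 _ h3; have /(congr1 delta) := yw0 _ h4.
have dt : delta (theta z) = P z *+ 2 by apply: rot_diff_antidiff.
have ds v : delta (rho s v) = - rho s (delta v) by rewrite rot_diff_refl // opprK.
rewrite (av_homMz dh) dP (av_homD dh) ds dt (av_homMn (rho_hom s)) -Ps (av_hom0 dh) => e2.
have e3 : rotN z *~ (2%:Z * d) = 0.
  have h1' : rotN z + rotN (rho s z) = 0.
    by rewrite -sum_dihedral_act -pl h1 (av_hom0 lh).
  have := h2; rewrite cE => h2'.
  have -> : rotN z *~ (2%:Z * d) = ((rotN z + rotN (rho s z)) + (rotN z - rotN (rho s z))) *~ d.
    by rewrite addrACA subrr addr0 -mulr2n pmulrn -mulrzA.
  by rewrite mulrzDl h1' mul0rz add0r h2'.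
have e4 : P z *~ (4%:Z * p%:Z * b) = 0.
  move: e1; rewrite PD => e1.
  by rewrite (mulrz_halves _ (P (rho s z))) e1 mul0rz add0r e2.
have -> : z *~ K =
  P z *~ (4%:Z * p%:Z * b) *~ (2%:Z * d) + rotN z *~ (2%:Z * d) *~ (4%:Z * p%:Z * b).
  rewrite /P -!mulrzA [_ * (4%:Z * _ * _)]mulrC -mulrzDl subrK pmulrn -mulrzA.
  by congr (_ *~ _); rewrite /K; ring.
by rewrite e3 e4 !mul0rz addr0.
Qed.

End TwoDimensionalPart.
End Decomposition.

Theorem mainTheorem7
  (R : realType) (p : nat) (p_prime : prime p) (p_odd : odd p)
  (* D_p = < r, s : r^p = s^2 = (rs)^2 = 1 >, of order 2p *)
  (gT : finGroupType) (r s : gT)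
  (order_G : #|[set: gT]%G| = (2 * p)%N)
  (gen_G : [set: gT]%G = <<[set r; s]>>%g :> {set gT})
  (rp : (r ^+ p)%g = 1%g) (s2 : (s ^+ 2)%g = 1%g)
  (rs2 : ((r * s) ^+ 2)%g = 1%g)
  (* X with its action of D_p *)
  (X : variety R[i]) (X_curve : smooth_projective_curve X)
  (X_genus : genus_ge X 2)
  (act : gT -> X -> X) (act_aut : curve_action act)
  (* the quotients Y = X / D_p, Xr = X / <r>, Xs = X / <s> *)
  (Y Xr Xs : variety R[i])
  (Y_curve : smooth_projective_curve Y)
  (Xr_curve : smooth_projective_curve Xr)
  (Xs_curve : smooth_projective_curve Xs)
  (qY : X -> Y) (qr : X -> Xr) (qs : X -> Xs)
  (qYP : quotient_by act [set: gT]%G qY)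
  (qrP : quotient_by act <[r]>%g qr)
  (qsP : quotient_by act <[s]>%g qs)
  (* the induced coverings Xr -> Y and Xs -> Y *)
  (fr : Xr -> Y) (fs : Xs -> Y)
  (frP : forall x, fr (qr x) = qY x) (fsP : forall x, fs (qs x) = qY x)
  (* Jacobians *)
  (JX JY Jr Js : gvariety R[i])
  (ajX : X -> JX) (ajY : Y -> JY) (ajr : Xr -> Jr) (ajs : Xs -> Js)
  (JXP : jacobian ajX) (JYP : jacobian ajY)
  (JrP : jacobian ajr) (JsP : jacobian ajs)
  (* norm maps of the coverings, and the induced action on JX *)
  (Nr : Jr -> JY) (Ns : Js -> JY) (rho : gT -> JX -> JX)
  (NrP : norm_map ajr ajY fr Nr) (NsP : norm_map ajs ajY fs Ns)
  (rhoP : forall g, norm_map ajX ajX (act g) (rho g))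
  (* the rational representations U' and W *)
  (sQ : irrType rat [set: gT]%G) (sC : irrType R[i] [set: gT]%G)
  (U' : mx_representation rat [set: gT]%G 1)
  (U'_nontrivial : exists g, U' g <> 1%:M)
  (n : nat) (W : mx_representation rat [set: gT]%G n)
  (W_irr : mx_irreducible W)
  (W_complex : mx_rsim (extend_scalars R[i] W) (sum_irr_of_degree sC 2))
  (* primitive idempotents of Q_U' and Q_W, with integral multiples *)
  (eU eW : 'M[rat]_#|[set: gT]%G|) (mU mW : nat) (cU cW : gT -> int)
  (eUP : primitive_idempotent_of sQ U' eU)
  (eWP : primitive_idempotent_of sQ W eW)
  (cUP : integral_multiple eU mU cU) (cWP : integral_multiple eW mW cW) :
  let B_U' := image_of (gring_act rho cU) in
  let B_W := image_of (gring_act rho cW) in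
  [/\ isogenous (whole JX) (abprod (whole JY) (abprod B_U' (abprod B_W B_W))),
      isogenous B_U' (prym Nr) &
      isogenous B_W (prym Ns)].
Proof.
move=> B_U' B_W.
case: n W W_irr W_complex eWP => [|n' W' W'_irr W'_complex eW'P].
  by move=> W0 /mx_irrP[].
have WN := op_rot_sum gen_G s2 rs2 W'_irr W'_complex.
have [a a0 cE] := sign_operator p_prime p_odd order_G gen_G rp s2 rs2 U'_nontrivial eUP cUP.
have [x [y [d [b [d0 b0 y_aug ops]]]]] :=
  conjugate_operators p_prime p_odd order_G gen_G rp s2 rs2 W'_irr WN eW'P cWP.
have rhoA := jacobian_action act_aut JXP rhoP.
have m0 : (0 < mW)%N by case: cWP.
split.
- exact: (isogeny_jacobian p_prime p_odd order_G gen_G rp s2 rs2 act_aut qYP JXP JYP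
    rhoP d0 b0 m0 y_aug ops a0 (cE _ _ rhoA)).
- exact: (isogeny_sign p_prime p_odd order_G gen_G rp s2 rs2 act_aut qYP JXP JYP
    rhoP a0 (cE _ _ rhoA) qrP frP JrP NrP).
- exact: (isogeny_two_dim p_prime p_odd order_G gen_G rp s2 rs2 act_aut qYP JXP JYP
    rhoP d0 b0 y_aug ops qsP fsP JsP NsP).
Qed.
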